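(* Let $a>0$. There is a positive constant $c$, depending only on $a$, such that the following holds. Let $f_n$, $n\in\mathbb{N}$, be centred inner functions with $\lambda_n=|f_n'(0)|\ge a$ for all $n$ and $\lambda_n\lambda_{n-1}\cdots\lambda_1\to 0$ as $n\to\infty$, and put $\mu_n=1-\lambda_n$ for $n=1,2,\ldots$. (a) If $$\limsup_{n\to\infty}(\lambda_n\cdots\lambda_1)^{1/n}<1,\quad\text{that is (equivalently),}\quad \underline{\mu}:=\liminf_{n\to\infty}\frac1n\sum_{k=1}^n\mu_k>0,$$ then the lower entropy of $(f_n)$ satisfies $\underline{h}((f_n))\ge c\,\underline{\mu}$. (b) If $$\liminf_{n\to\infty}(\lambda_n\cdots\lambda_1)^{1/n}<1,\quad\text{that is (equivalently),}\quad \mu:=\limsup_{n\to\infty}\frac1n\sum_{k=1}^n\mu_k>0,$$ then the metric entropy of $(f_n)$ satisfies $h((f_n))\ge c\,\mu$.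
   Context: $\mathbb{D}=\{z\in\mathbb{C}:|z|<1\}$ is the unit disc. An inner function is a function analytic in $\mathbb{D}$, mapping $\mathbb{D}$ into its closure, with non-tangential boundary values of modulus $1$ almost everywhere on $\partial\mathbb{D}$. It is centred if it fixes $0$. Non-tangential boundary values (defined almost everywhere on $\partial\mathbb{D}$) are denoted by the same letter as the function, and preimages of subsets of $\partial\mathbb{D}$ are taken under these boundary maps (so are defined up to null sets). $|E|$ denotes the one-dimensional Lebesgue measure of $E\subset\partial\mathbb{D}$. Entropies: given centred inner functions $(f_n)$, put $F_n=f_n\circ\cdots\circ f_1$. Let $\mathcal{A}$ denote the set of finite partitions of $\partial\mathbb{D}$ (into measurable sets). For such a partition $\{A_1,\ldots,A_N\}$ and $k_0,k_1,\ldots,k_n\in\{1,\ldots,N\}$, let $$A_{k_0\ldots k_n}=A_{k_0}\cap F_1^{-1}(A_{k_1})\cap\cdots\cap F_n^{-1}(A_{k_n}).$$ The lower entropy of $(f_n)$ is $$\underline{h}((f_n)):=\sup_{\mathcal{A}}\liminf_{n\to\infty}\frac{1}{n+1}\sum_{k_0=1}^N\cdots\sum_{k_n=1}^N|A_{k_0\ldots k_n}|\log\frac{2\pi}{|A_{k_0\ldots k_n}|},$$ where the supremum is over all partitions in $\mathcal{A}$ and a term with $|A_{k_0\ldots k_n}|=0$ is interpreted as $0$. The metric entropy $h((f_n))$ is defined by the same formula with $\limsup_{n\to\infty}$ in place of $\liminf_{n\to\infty}$. *)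

(* Defs.v *)
From HB Require Import structures.
From mathcomp Require Import all_boot all_order all_algebra complex.
From mathcomp Require Import all_classical all_reals all_analysis.
Set Implicit Arguments.
Unset Strict Implicit.
Unset Printing Implicit Defensive.
Import Order.TTheory GRing.Theory Num.Theory.
Import numFieldNormedType.Exports.
Local Open Scope classical_set_scope.
Local Open Scope ring_scope.

(* The metric topology of [R[i]] and its structure of normed space over
   itself, which make [derivable] and [derive1] complex differentiation. They
   are copied from [R[i]^o], as the library does for an abstract
   [numFieldType]. *)
HB.instance Definition _ (R : realType) :=
  PseudoPointedMetric.copy R[i] (R[i])^o.
HB.instance Definition _ (R : realType) := GRing.ComAlgebra.copy R[i] (R[i])^o.
HB.instance Definition _ (R : realType) := Vector.copy R[i] (R[i])^o.
HB.instance Definition _ (R : realType) := NormedModule.copy R[i] (R[i])^o.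

Section InnerFunctions.
Context {R : realType}.
Local Notation C := R[i].
Implicit Types (f : C -> C) (E : set C) (zeta w : C).

Definition unit_disc : set C := [set z | `|z| < 1].

Definition unit_circle : set C := [set z | `|z| = 1].

Definition expi (t : R) : C := (cos t +i* sin t)%C.

(* The circle is parametrised bijectively by [expi] on [0, 2 pi). *)
Definition angles E : set R := [set t | 0 <= t < 2 * pi /\ E (expi t)].

(* Lebesgue (not only Borel) measurable subsets of the circle. *)
Definition circle_measurable E : Prop :=
  E `<=` unit_circle /\
  ((@wlength R idfun)^*)%mu.-cara.-measurable (angles E).

Definition arclength E : \bar R := completed_lebesgue_measure (angles E).

Definition stolz (M : R) zeta : set C :=
  [set z | unit_disc z /\ `|z - zeta| < M%:C%C * (1 - `|z|)].

Definition nontangential_limit f zeta w : Prop :=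
  forall M : R, 1 < M -> f z @[z --> within (stolz M zeta) (nbhs zeta)] --> w.

(* Functions on the disc are represented by total functions on the plane; no
   definition below depends on their values outside the disc. *)
Definition inner_function f : Prop :=
  [/\ (forall z, unit_disc z -> derivable f z 1),
      (forall z, unit_disc z -> `|f z| <= 1) &
      {ae @lebesgue_measure R, forall t, 0 <= t < 2 * pi ->
        exists w, nontangential_limit f (expi t) w /\ unit_circle w}].

Definition centred_inner_function f : Prop := inner_function f /\ f 0 = 0.

(* Preimage under the boundary map. It leaves out the points at which there is
   no non-tangential limit, which form a null set when [f] is inner. *)
Definition boundary_preimage f E : set C :=
  [set zeta | unit_circle zeta /\
    exists w, nontangential_limit f zeta w /\ E w].

End InnerFunctions.

Section Entropy.
Context {R : realType}.
Local Notation C := R[i].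
(* Sequences are indexed from 1; the term [f 0] is never used. *)
Implicit Types f : nat -> C -> C.

Fixpoint forward_iterate f (n : nat) : C -> C :=
  if n is m.+1 then f m.+1 \o forward_iterate f m else id.

(* Some of the [A i] may be empty; an empty cell does not affect entropy. *)
Definition circle_partition (N : nat) (A : 'I_N -> set C) : Prop :=
  [/\ (forall i, circle_measurable (A i)),
      trivIset [set: 'I_N] A &
      \bigcup_(i in [set: 'I_N]) A i = unit_circle].

Definition cell f (N : nat) (A : 'I_N -> set C) (n : nat)
    (k : {ffun 'I_n.+1 -> 'I_N}) : set C :=
  A (k ord0) `&` \bigcap_(j in [set: 'I_n])
    boundary_preimage (forward_iterate f j.+1) (A (k (lift ord0 j))).

Definition entropy_term (x : R) : R :=
  if x == 0 then 0 else x * ln (2 * pi / x).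

Definition mean_partition_entropy f (N : nat) (A : 'I_N -> set C) (n : nat) : R :=
  n.+1%:R^-1 * \sum_(k : {ffun 'I_n.+1 -> 'I_N})
    entropy_term (fine (arclength (cell f A k))).

Definition lower_entropy f : \bar R :=
  ereal_sup [set h | exists (N : nat) (A : 'I_N -> set C),
    circle_partition A /\
    h = limn_einf (fun n => (mean_partition_entropy f A n)%:E)].

Definition metric_entropy f : \bar R :=
  ereal_sup [set h | exists (N : nat) (A : 'I_N -> set C),
    circle_partition A /\
    h = limn_esup (fun n => (mean_partition_entropy f A n)%:E)].

(* The norm of [R[i]] takes its values in [R[i]]. *)
Definition lambda f (n : nat) : R := complex.Re `|(f n)^`()%classic 0|.

Definition mu f (n : nat) : R := 1 - lambda f n.

Definition lambda_prod f (n : nat) : R := \prod_(1 <= k < n.+1) lambda f k.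

(* The next two sequences are meaningful for [n >= 1]. *)
Definition lambda_geometric_mean f (n : nat) : R :=
  lambda_prod f n `^ n%:R^-1.

Definition mu_mean f (n : nat) : R := n%:R^-1 * \sum_(1 <= k < n.+1) mu f k.

Definition lower_mu f : \bar R := limn_einf (fun n => (mu_mean f n)%:E).

Definition upper_mu f : \bar R := limn_esup (fun n => (mu_mean f n)%:E).

End Entropy.

(* Main.v *)
(* The entropy gained by one more centred inner function f is bounded below by
   (pi / 3) (1 - |f'(0)|), for the partition of the circle into 8 equal arcs J_i.

   Boundary values. Goursat's theorem on polar rectangles yields the mean value property
   and the Poisson formula for bounded functions with radial boundary values. Applied to
   Cauchy kernels composed with f, they show that the boundary map of f preserves arc
   length, and more precisely that the integral of x over the preimage of a Borel set B
   is conj(f'(0)) times the integral of x over B. Fatou's theorem at Lebesgue points shows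
   that boundary maps compose.

   One step. Let the Q_m partition the circle, q_m = |Q_m|, and let a_im be the length of
   the part of the preimage of Q_m inside J_i. Since ln y >= 1 - 1 / y, cutting the
   preimages by the J_i increases the entropy by at least 2 pi - sum a_im^2 / q_m, a
   quantity that decreases when the Q_m are refined. For fine Q_m, comparing the indicator
   of pairs in different arcs with |x - y|^4 - |x - y|^2 bounds it below by
   (pi / 3) (1 - |f'(0)|^2) (2 - |f'(0)|^2).

   Summing over f_1, ..., f_n gives the entropy bound with c = pi / 6. The two forms of
   the hypotheses are compared through 1 - x <= - ln x <= (1 - x) / a on [a, 1]. *)
Require Import Defs.
From mathcomp Require Import all_boot all_order all_algebra complex.
From mathcomp Require Import all_classical all_reals all_analysis.
From mathcomp Require Import ring lra.
Import Order.TTheory GRing.Theory Num.Theory.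
Import numFieldNormedType.Exports.
Import Normc measurable_realfun.
Set Implicit Arguments.
Unset Strict Implicit.
Unset Printing Implicit Defensive.
Local Open Scope classical_set_scope.
Local Open Scope ring_scope.

Local Notation Re := complex.Re.
Local Notation Im := complex.Im.

(** * Real-valued moduli, the exponential parametrisation, complex derivatives in epsilon-delta
    form *)

Section ComplexBasics.
Context {R : realType}.
Local Notation C := R[i].
Implicit Types (z w : C) (x y t : R).

(** The shape of the chord polynomial is forced near the rotations, for which nothing is gained: a
    bound proportional to 1 - |f'(0)| needs a kernel that vanishes on the diagonal, and the kernel
    must be nonpositive on pairs in a common arc. In degree one only the multiples a (1 - cos)
    vanish on the diagonal, and nonpositivity nearby gives a <= 0, so the bound would be void; hence
    a kernel of degree two, and hence second Fourier coefficients. The first coefficients of a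
    preimage are controlled for each Borel set separately. For the second ones there is only one
    global identity, the mean of (f(z) / z)^2, and it can be localised only where the image point is
    nearly constant. This is why the Q_m have to be fine while the cells to be split are arbitrary,
    and why monotonicity under refinement is needed. The gain does not depend on the partition that
    is pulled back, so the same eight arcs serve at every time, and the two limits follow from one
    inequality for each n. *)

Definition N z : R := Re `|z|.

Lemma NE z : N z = normc z. Proof. by rewrite /N; case: z. Qed.
Lemma normE z : `|z| = (N z)%:C%C.
Proof. by rewrite /N normc_def. Qed.
Lemma N_def z : N z = Num.sqrt (Re z ^+ 2 + Im z ^+ 2).
Proof. by rewrite /N normc_def. Qed.
Lemma N_ge0 z : 0 <= N z. Proof. by rewrite N_def sqrtr_ge0. Qed.
Lemma NM z w : N (z * w) = N z * N w. Proof. by rewrite !NE normcM. Qed.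
Lemma NV z : N z^-1 = (N z)^-1. Proof. by rewrite !NE normcV. Qed.
Lemma ND z w : N (z + w) <= N z + N w.
Proof. by rewrite -lecR rmorphD /= -!normE ler_normD. Qed.
Lemma N0 : N 0 = 0. Proof. by rewrite NE normc0. Qed.
Lemma N1 : N 1 = 1. Proof. by rewrite NE normc1. Qed.
Lemma NN z : N (- z) = N z. Proof. by rewrite /N normrN. Qed.
Lemma NB z w : N (z - w) = N (w - z). Proof. by rewrite -NN opprB. Qed.
Lemma N_tri u z w : N (z - w) <= N (z - u) + N (u - w).
Proof. by have := ND (z - u) (u - w); rewrite addrA subrK. Qed.
Lemma N_eq0 z : (N z == 0) = (z == 0).
Proof. by apply/eqP/eqP => [|->]; rewrite ?N0// NE => /eq0_normc. Qed.
Lemma N_gt0 z : (0 < N z) = (z != 0).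
Proof. by rewrite lt_def N_ge0 andbT N_eq0. Qed.
Lemma NX z n : N (z ^+ n) = N z ^+ n.
Proof. by elim: n => [|n IH]; rewrite ?expr0 ?N1// !exprS NM IH. Qed.
Lemma N_real x : N x%:C%C = `|x|.
Proof. by rewrite N_def /= expr0n/= addr0 sqrtr_sqr. Qed.
Lemma N_sqr z : N z ^+ 2 = Re z ^+ 2 + Im z ^+ 2.
Proof. by rewrite N_def sqr_sqrtr// addr_ge0// sqr_ge0. Qed.
Lemma N_Re z : `|Re z| <= N z.
Proof. by rewrite N_def -sqrtr_sqr ler_wsqrtr// lerDl sqr_ge0. Qed.
Lemma N_Im z : `|Im z| <= N z.
Proof. by rewrite N_def -sqrtr_sqr ler_wsqrtr// lerDr sqr_ge0. Qed.
Lemma N_le z : N z <= `|Re z| + `|Im z|.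
Proof.
rewrite -(@ler_pXn2r _ 2)// ?nnegrE ?N_ge0 ?addr_ge0//.
rewrite N_sqr sqrrD !real_normK ?num_real// -addrA lerD2l lerDr.
by rewrite mulrn_wge0// mulr_ge0.
Qed.
Lemma N_conj z : N (z^*)%C = N z.
Proof. by rewrite !N_def; case: z => a b /=; rewrite sqrrN. Qed.
Lemma mul_conj z : z * (z^*)%C = ((N z) ^+ 2)%:C%C.
Proof. by rewrite -sqr_normc normE -rmorphXn. Qed.
Lemma N_subge z w : N z - N w <= N (z - w).
Proof. by rewrite lerBlDr; have := ND (z - w) w; rewrite subrK. Qed.

Lemma ReD z w : Re (z + w) = Re z + Re w.
Proof. by case: z; case: w. Qed.
Lemma ImD z w : Im (z + w) = Im z + Im w.
Proof. by case: z; case: w. Qed.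
Lemma ReN z : Re (- z) = - Re z. Proof. by case: z. Qed.
Lemma ImN z : Im (- z) = - Im z. Proof. by case: z. Qed.
Lemma ReM z w : Re (z * w) =
  Re z * Re w - Im z * Im w.
Proof. by case: z; case: w. Qed.
Lemma ImM z w : Im (z * w) =
  Re z * Im w + Im z * Re w.
Proof. by case: z; case: w. Qed.
Lemma Re_conj z : Re (z^*)%C = Re z. Proof. by case: z. Qed.
Lemma Im_conj z : Im (z^*)%C = - Im z. Proof. by case: z. Qed.
Lemma complex_ext z w : Re z = Re w ->
  Im z = Im w -> z = w.
Proof. by case: z; case: w => /= a b c d -> ->. Qed.

Lemma N_expi t : N (expi t) = 1.
Proof. by rewrite N_def /= cos2Dsin2 sqrtr1. Qed.
Lemma expi_neq0 t : expi t != 0.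
Proof. by rewrite -N_gt0 N_expi. Qed.
Lemma expiD t u : expi (t + u) = expi t * expi u.
Proof. by apply: complex_ext; rewrite ?ReM ?ImM /= ?cosD ?sinD// addrC. Qed.
Lemma expi0 : expi 0 = 1 :> C.
Proof. by apply: complex_ext; rewrite /= ?cos0 ?sin0. Qed.
Lemma expi_conj t : ((expi t)^*)%C = expi (- t).
Proof. by apply: complex_ext; rewrite /= ?cosN ?sinN. Qed.
Lemma expiV t : (expi t)^-1 = ((expi t)^*)%C.
Proof.
apply: (mulfI (expi_neq0 t)); rewrite mulfV ?expi_neq0//.
by rewrite mul_conj N_expi expr1n.
Qed.
Lemma expi_2pi t : expi (t + 2 * pi) = expi t.
Proof.
by rewrite expiD (_ : expi (2 * pi) = 1) ?mulr1//; apply: complex_ext;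
   rewrite /= mulr_natl ?cos2pi ?sin2pi.
Qed.

Lemma le_sin_id t : `|sin t| <= `|t|.
Proof.
wlog t0 : t / 0 <= t => [H|].
  have [/H//|/ltW t0] := leP 0 t.
  by rewrite -normrN -sinN -(normrN t); apply: H; rewrite oppr_ge0.
have dsin x : is_derive x 1 (sin : R -> R) (cos x) by exact: is_derive_sin.
have [] := @MVT_segment R sin cos 0 t t0.
  by apply: continuous_subspaceT => x; exact: continuous_sin.
move=> c _; rewrite sin0 !subr0 => ->.
by rewrite normrM ler_piMl// ler_norml cos_geN1 cos_le1.
Qed.

Lemma N_expiB s t : N (expi s - expi t) <= `|s - t|.
Proof.
have -> : N (expi s - expi t) = 2 * `|sin ((s - t) / 2)|.
  rewrite N_def (_ : 2 * `|_| = `|2 * sin ((s - t) / 2)|); last first.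
    by rewrite normrM (ger0_norm (ler0n _ 2)).
  rewrite -sqrtr_sqr; congr Num.sqrt.
  rewrite /=; have {1 2}-> : s = t + ((s - t) / 2 + (s - t) / 2) by lra.
  set d := (s - t) / 2.
  rewrite cosD sinD (cosD d) (sinD d).
  have ht := cos2Dsin2 t; have hd := cos2Dsin2 d.
  (* Rotation invariance made explicit: the squared chord is cos^2 t + sin^2 t times a function of d
     alone. *)
  transitivity ((cos t ^+ 2 + sin t ^+ 2) *
     ((cos d ^+ 2 - sin d ^+ 2 - 1) ^+ 2 + 4 * sin d ^+ 2 * cos d ^+ 2)); first ring.
  have -> : cos d ^+ 2 = 1 - sin d ^+ 2 by lra.
  rewrite -/d ht; ring.
have := le_sin_id ((s - t) / 2).
by rewrite normrM (ger0_norm (_ : 0 <= 2^-1)) ?invr_ge0//; lra.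
Qed.

Lemma cvg_N (T : Type) (F : set_system T) {FF : Filter F} (g : T -> C) (l : C) :
  g @ F --> l <-> forall e : R, 0 < e -> \forall x \near F, N (g x - l) < e.
Proof.
split=> [/cvgrPdist_lt H e e0|H].
  have /H : 0 < e%:C%C by rewrite ltcR.
  by apply: filterS => x; rewrite normE ltcR NB.
apply/cvgrPdist_lt => e.
case: e => e e'; rewrite ltcE /= => /andP[/eqP -> e0].
apply: filterS (H _ e0) => x Hx.
by rewrite normE NB ltcR.
Qed.

Lemma cvg_ReIm (T : Type) (F : set_system T) {FF : Filter F} (g : T -> C) (l : C) :
  g @ F --> l <-> (Re (g x) @[x --> F] --> Re l) /\
    (Im (g x) @[x --> F] --> Im l).
Proof.
rewrite cvg_N; split=> [H|[/cvgrPdist_lt Hr /cvgrPdist_lt Hi] e e0].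
  split; apply/cvgrPdist_lt => e /H; apply: filterS => x; apply: le_lt_trans.
    by rewrite distrC -ReN -ReD N_Re.
  by rewrite distrC -ImN -ImD N_Im.
have e2 : 0 < e / 2 by rewrite divr_gt0.
move: (Hr _ e2) (Hi _ e2); apply: filterS2 => x h1 h2.
apply: (le_lt_trans (N_le _)).
rewrite ReD ReN ImD ImN distrC (distrC (Im _)).
by rewrite [e]splitr ltrD.
Qed.

(** A form without quotients: w = z needs no exception, and the inequality is exactly the error
    estimate that Goursat's argument integrates. *)
Definition cdiff (f : C -> C) (z d : C) := forall e : R, 0 < e ->
  exists2 del : R, 0 < del & forall w, N (w - z) < del ->
    N (f w - f z - d * (w - z)) <= e * N (w - z).

Definition ccont (f : C -> C) (z : C) := forall e : R, 0 < e ->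
  exists2 del : R, 0 < del & forall w, N (w - z) < del -> N (f w - f z) < e.

Lemma nbhs_N z (P : set C) : nbhs z P <->
  exists2 del : R, 0 < del & forall w, N (w - z) < del -> P w.
Proof.
split.
  move=> /nbhs_ballP[[e e']]/=; rewrite ltcE /= => /andP[/eqP -> e0] H.
  exists e => // w Hw; apply: H.
  by rewrite -ball_normE /= normE ltcR NB.
move=> [d d0 H]; apply/nbhs_ballP; exists d%:C%C => /=; first by rewrite ltcR.
by move=> w; rewrite -ball_normE /= normE ltcR NB => /H.
Qed.

Lemma dnbhs_N z (P : set C) : z^' P <->
  exists2 del : R, 0 < del & forall w, N (w - z) < del -> w != z -> P w.
Proof. by have := @nbhs_N z [set w | w != z -> P w]. Qed.

Lemma derivable_cdiff f z : derivable f z 1 -> cdiff f z (f^`()%classic z).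
Proof.
move=> /cvg_ex[/= l H].
have -> : f^`()%classic z = l by rewrite derive1E; apply: cvg_lim H.
move/(@cvg_N _ (0^')) : H => H e e0.
have /dnbhs_N [del del0 Hd] := H _ e0.
exists del => // w wz.
have [->|wnz] := eqVneq w z; first by rewrite !subrr mulr0 subr0 N0 mulr0.
have h0 : w - z != 0 by rewrite subr_eq0.
have := Hd (w - z); rewrite subr0 => /(_ wz h0).
rewrite /GRing.scale /= mulr1 subrK => H1.
rewrite -ler_pdivrMr ?N_gt0// -NV -NM mulrC.
apply: ltW; apply: le_lt_trans H1.
by rewrite mulrBr mulrCA mulVf// mulr1.
Qed.

Lemma cdiff_ccont f z d : cdiff f z d -> ccont f z.
Proof.
move=> H e e0; have [del del0 Hd] := H 1 ltr01.
have M0 : 0 < N d + 2 by rewrite ltr_wpDl ?N_ge0.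
exists (Num.min del (e / (N d + 2))); first by rewrite lt_min del0 divr_gt0.
move=> w; rewrite lt_min => /andP[/Hd H1]; rewrite ltr_pdivlMr// => H2.
have := ND (f w - f z - d * (w - z)) (d * (w - z)); rewrite subrK NM => H3.
have := N_ge0 (w - z); have := N_ge0 d; nra.
Qed.

End ComplexBasics.

(** * Rules for complex derivatives *)

Section ComplexDiff.
Context {R : realType}.
Local Notation C := R[i].
Implicit Types (f g : C -> C) (z w d : C).

Lemma ccontD f g z : ccont f z -> ccont g z -> ccont (fun w => f w + g w) z.
Proof.
move=> hf hg e e0; have e2 : 0 < e / 2 by rewrite divr_gt0.
have [d1 d10 H1] := hf _ e2; have [d2 d20 H2] := hg _ e2.
exists (Num.min d1 d2); first by rewrite lt_min d10.
move=> w; rewrite lt_min => /andP[/H1 h1 /H2 h2].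
have := ND (f w - f z) (g w - g z).
by rewrite addrACA -opprD; move/le_lt_trans; apply; lra.
Qed.
Lemma ccontM f g z : ccont f z -> ccont g z -> ccont (fun w => f w * g w) z.
Proof.
move=> hf hg e e0; have nf := N_ge0 (f z); have ng := N_ge0 (g z).
have s0 : 0 < N (f z) + N (g z) + 2 by lra.
pose n := Num.min 1 (e / (N (f z) + N (g z) + 2)).
have n0 : 0 < n by rewrite lt_min ltr01 divr_gt0.
have n1 : n <= 1 by rewrite /n ge_min lexx.
have ne : n * (N (f z) + N (g z) + 2) <= e.
  by rewrite -ler_pdivlMr// /n ge_min lexx orbT.
have [d1 d10 H1] := hf _ n0; have [d2 d20 H2] := hg _ n0.
exists (Num.min d1 d2); first by rewrite lt_min d10.
move=> w; rewrite lt_min => /andP[/H1 h1 /H2 h2].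
have -> : f w * g w - f z * g z =
   (f w - f z) * (g w - g z) + (f z * (g w - g z) + (f w - f z) * g z) by ring.
have h3 := ND ((f w - f z) * (g w - g z)) (f z * (g w - g z) + (f w - f z) * g z).
have h4 := ND (f z * (g w - g z)) ((f w - f z) * g z).
rewrite !NM in h3 h4.
have := N_ge0 (f w - f z); have := N_ge0 (g w - g z); nra.
Qed.
Lemma ccontV f z : ccont f z -> f z != 0 -> ccont (fun w => (f w)^-1) z.
Proof.
move=> hf f0 e e0; have n0 : 0 < N (f z) by rewrite N_gt0.
pose n := Num.min (N (f z) / 2) (e * N (f z) ^+ 2 / 2).
have np : 0 < n by rewrite lt_min !divr_gt0// mulr_gt0// exprn_gt0.
have n1 : n <= N (f z) / 2 by rewrite /n ge_min lexx.
have n2 : n <= e * N (f z) ^+ 2 / 2 by rewrite /n ge_min lexx orbT.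
have [d1 d10 H1] := hf _ np; exists d1 => // w /H1 h1.
have h2 : N (f z) / 2 < N (f w).
  by have := N_subge (f z) (f w); rewrite NB; lra.
have w0 : f w != 0 by rewrite -N_gt0; lra.
have -> : (f w)^-1 - (f z)^-1 = (f z - f w) / (f w * f z).
  by rewrite invfM mulrBl (mulrC (f w)^-1) mulrA mulfV// mul1r (mulrC (f z)^-1) mulrA mulfV// mul1r.
rewrite NM NV NM NB ltr_pdivrMr ?mulr_gt0//; last lra.
nra.
Qed.
Lemma ccont_cst d z : ccont (fun=> d) z.
Proof. by move=> e e0; exists 1 => // w _; rewrite subrr N0. Qed.
Lemma ccont_id z : ccont id z.
Proof. by move=> e e0; exists e => // w. Qed.
Lemma ccont_comp f g z : ccont f z -> ccont g (f z) -> ccont (g \o f) z.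
Proof.
move=> hf hg e /hg[d d0 Hd]; have [d' d'0 Hd'] := hf _ d0.
by exists d' => // w /Hd' /Hd.
Qed.
(** Carathéodory's criterion. The slope, completed by d at z, is continuous there; the rules for
    sums, products and compositions become identities between slopes. *)
Lemma cdiff_carath f z d : cdiff f z d <->
  exists2 phi, phi z = d /\ ccont phi z & forall w, f w - f z = phi w * (w - z).
Proof.
split=> [H|[phi [<- hc] Hp] e /hc[del del0 Hd]].
  exists (fun w => if w == z then d else (f w - f z) / (w - z)).
    rewrite eqxx; split=> // e e0.
    have e2 : 0 < e / 2 by rewrite divr_gt0.
    have [del del0 Hd] := H _ e2; exists del => // w /Hd.
    rewrite eqxx; case: eqP => [->|/eqP wz]; first by rewrite (subrr d) N0.
    have h0 : w - z != 0 by rewrite subr_eq0.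
    rewrite (_ : (f w - f z) / (w - z) - d = (f w - f z - d * (w - z)) / (w - z)).
      by rewrite NM NV -ler_pdivrMr ?N_gt0// => /le_lt_trans; apply; lra.
    by rewrite [RHS]mulrBl mulfK.
  move=> w; case: eqP => [->|/eqP wz]; first by rewrite !subrr mulr0.
  by rewrite divfK// subr_eq0.
exists del => // w /Hd H; rewrite Hp -mulrBl NM ler_wpM2r ?N_ge0//; exact: ltW.
Qed.
Lemma cdiff_cst d z : cdiff (fun=> d) z 0.
Proof.
by apply/cdiff_carath; exists (fun=> 0) => [|w]; rewrite ?subrr ?mul0r//; split=> //; exact: ccont_cst.
Qed.
Lemma cdiff_id z : cdiff id z 1.
Proof.
by apply/cdiff_carath; exists (fun=> 1) => [|w]; rewrite ?mul1r//; split=> //; exact: ccont_cst.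
Qed.
Lemma cdiffD f g z d d' : cdiff f z d -> cdiff g z d' ->
  cdiff (fun w => f w + g w) z (d + d').
Proof.
move=> /cdiff_carath[p [p1 p2] p3] /cdiff_carath[q [q1 q2] q3].
apply/cdiff_carath; exists (fun w => p w + q w); first by rewrite p1 q1; split=> //; exact: ccontD.
by move=> w; rewrite mulrDl -p3 -q3 opprD addrACA.
Qed.
Lemma cdiffM f g z d d' : cdiff f z d -> cdiff g z d' ->
  cdiff (fun w => f w * g w) z (d * g z + f z * d').
Proof.
move=> hf hg; have cg := cdiff_ccont hg.
move: hf hg => /cdiff_carath[p [p1 p2] p3] /cdiff_carath[q [q1 q2] q3].
apply/cdiff_carath; exists (fun w => p w * g w + f z * q w).
  rewrite p1 q1; split=> //; apply: ccontD; apply: ccontM => //; exact: ccont_cst.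
move=> w; transitivity ((f w - f z) * g w + f z * (g w - g z)); first ring.
rewrite p3 q3; ring.
Qed.
(** The slope of 1 / f is - p(w) / (f(w) f(z)) only where f does not vanish, whereas Carathéodory's
    form asks for an identity on the whole plane; the estimate is therefore made directly near z. *)
Lemma cdiffV f z d : cdiff f z d -> f z != 0 ->
  cdiff (fun w => (f w)^-1) z (- d / f z ^+ 2).
Proof.
move=> hf f0; have cf := cdiff_ccont hf.
have n0 : 0 < N (f z) by rewrite N_gt0.
have [del del0 Hd] := cf _ n0.
have nz w : N (w - z) < del -> f w != 0.
  move=> /Hd; apply: contraTneq => ->; by rewrite sub0r NN ltxx.
move: hf => /cdiff_carath[p [p1 p2] p3].
have cV : ccont (fun w => - p w * (f w)^-1 * (f z)^-1) z.
  apply: ccontM; last exact: ccont_cst.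
  apply: ccontM; last exact: ccontV.
  have := ccontM (ccont_cst (-1) z) p2.
  by move=> H e /H[d1 d10 H1]; exists d1 => // w /H1; rewrite !mulN1r.
move=> e e0; have [d2 d20 H2] := cV _ e0.
exists (Num.min del d2); first by rewrite lt_min del0.
move=> w; rewrite lt_min => /andP[/nz fw /H2 /ltW h].
have -> : (f w)^-1 - (f z)^-1 - - d / f z ^+ 2 * (w - z) =
   (- p w * (f w)^-1 * (f z)^-1 - (- p z * (f z)^-1 * (f z)^-1)) * (w - z).
  have E : f w = p w * (w - z) + f z by rewrite -p3 subrK.
  rewrite [RHS]mulrBl p1; congr (_ - _); last by field.
  apply: (mulfI fw); apply: (mulfI f0); rewrite mulrBr mulrBr.
  rewrite mulfV // mulr1 (mulrCA (f z) (f w)) mulfV // mulr1.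
  transitivity (- (p w * (w - z))); first by rewrite -p3; ring.
  by field; rewrite f0.
by rewrite NM ler_wpM2r ?N_ge0.
Qed.
Lemma cdiff_comp f g z d d' : cdiff f z d -> cdiff g (f z) d' ->
  cdiff (g \o f) z (d' * d).
Proof.
move=> hf; have cf := cdiff_ccont hf.
move: hf => /cdiff_carath[p [p1 p2] p3] /cdiff_carath[q [q1 q2] q3].
apply/cdiff_carath; exists (fun w => q (f w) * p w).
  rewrite p1 q1; split=> //; apply: ccontM => //; exact: (ccont_comp cf).
by move=> w /=; rewrite q3 p3 mulrA.
Qed.
End ComplexDiff.

(** * Integrals of bounded Borel functions over sets of finite measure *)

Section BoundedMeasurable.
Context {R : realType}.
Local Notation C := R[i].
Local Notation mu := (@lebesgue_measure R).
Implicit Types (f g : R -> R) (D E : set R) (K : R).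

Lemma aeS (P Q : R -> Prop) : (forall t, P t -> Q t) ->
  {ae mu, forall t, P t} -> {ae mu, forall t, Q t}.
Proof. by move=> H; apply: filterS => //; exact: (ae_filter_ringOfSetsType mu). Qed.
Lemma aeS2 (P Q S : R -> Prop) : (forall t, P t -> Q t -> S t) ->
  {ae mu, forall t, P t} -> {ae mu, forall t, Q t} -> {ae mu, forall t, S t}.
Proof. by move=> H; apply: filterS2 => //; exact: (ae_filter_ringOfSetsType mu). Qed.
Lemma ae_all (P : R -> Prop) : (forall t, P t) -> {ae mu, forall t, P t}.
Proof. by move=> H; apply: aeW. Qed.

(** Bounded Borel functions on the whole line form an algebra, stable under precomposition with
    Borel maps, and are integrable on every [fmeas] set, so that integrability can be read off the
    shape of the integrand. *)
Definition bm f := measurable_fun [set: R] f /\ exists K, forall t, `|f t| <= K.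

Definition fmeas D := measurable D /\ (mu D < +oo)%E.

Lemma bmD f g : bm f -> bm g -> bm (fun t => f t + g t).
Proof.
move=> [mf [K HK]] [mg [L HL]]; split; first exact: measurable_funD.
by exists (K + L) => t; apply: (le_trans (ler_normD _ _)); rewrite lerD.
Qed.
Lemma bmM f g : bm f -> bm g -> bm (fun t => f t * g t).
Proof.
move=> [mf [K HK]] [mg [L HL]]; split; first exact: measurable_funM.
by exists (K * L) => t; rewrite normrM ler_pM.
Qed.
Lemma bm_cst K : bm (fun=> K).
Proof. by split; [exact: measurable_cst|exists `|K|]. Qed.
Lemma bmN f : bm f -> bm (fun t => - f t).
Proof.
move=> [mf [K HK]]; split; first exact: measurableT_comp.
by exists K => t; rewrite normrN.
Qed.
Lemma bmB f g : bm f -> bm g -> bm (fun t => f t - g t).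
Proof. by move=> hf /bmN; exact: bmD. Qed.
Lemma bm_comp f (h : R -> R) : bm f -> measurable_fun [set: R] h -> bm (f \o h).
Proof. by move=> [mf [K HK]] mh; split; [exact: measurableT_comp|exists K => t; exact: HK]. Qed.
Lemma bm_indic E : measurable E -> bm (\1_E : R -> R).
Proof.
move=> mE; split; first exact: measurable_indic.
by exists 1 => t; rewrite indicE; case: (_ \in _); rewrite ?normr1 ?normr0.
Qed.
Lemma bm_cos : bm cos.
Proof.
split; last by exists 1 => t; rewrite ler_norml cos_geN1 cos_le1.
by apply: continuous_measurable_fun => x; exact: continuous_cos.
Qed.
Lemma bm_sin : bm sin.
Proof.
split; last by exists 1 => t; rewrite ler_norml sin_geN1 sin_le1.
by apply: continuous_measurable_fun => x; exact: continuous_sin.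
Qed.
Lemma bm_norm f : bm f -> bm (fun t => `|f t|).
Proof.
move=> [mf [K HK]]; split; first exact: measurableT_comp.
by exists K => t; rewrite normr_id.
Qed.

Lemma bm_integrable D f : fmeas D -> bm f -> mu.-integrable D (EFin \o f).
Proof.
move=> [mD fD] [mf [K HK]]; apply: measurable_bounded_integrable => //.
  exact: measurable_funTS.
exists K; split; first by rewrite num_real.
by move=> M KM x _; apply: (le_trans (HK x)); exact: ltW.
Qed.

Definition RI D f : R := \int[mu]_(t in D) f t.

Lemma RI_D D f g : fmeas D -> bm f -> bm g ->
  RI D (fun t => f t + g t) = RI D f + RI D g.
Proof. by move=> hD hf hg; apply: RintegralD; [exact: hD.1|exact: bm_integrable..]. Qed.
Lemma RI_B D f g : fmeas D -> bm f -> bm g ->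
  RI D (fun t => f t - g t) = RI D f - RI D g.
Proof. by move=> hD hf hg; apply: RintegralB; [exact: hD.1|exact: bm_integrable..]. Qed.
Lemma RI_Z D K f : fmeas D -> bm f -> RI D (fun t => K * f t) = K * RI D f.
Proof. by move=> hD hf; apply: RintegralZl; [exact: hD.1|exact: bm_integrable]. Qed.
Lemma RI_N D f : fmeas D -> bm f -> RI D (fun t => - f t) = - RI D f.
Proof.
move=> hD hf; rewrite -mulN1r -RI_Z//; congr RI; apply/funext => t.
by rewrite mulN1r.
Qed.
Definition meas D : R := fine (mu D).
Lemma RI_cst D K : fmeas D -> RI D (fun=> K) = K * meas D.
Proof. by move=> [mD _]; rewrite /RI Rintegral_cst. Qed.
Lemma RI_le D f g : fmeas D -> bm f -> bm g ->
  (forall t, D t -> f t <= g t) -> RI D f <= RI D g.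
Proof. by move=> hD hf hg H; apply: le_Rintegral => //; [exact: hD.1|exact: bm_integrable..]. Qed.
Lemma RI_eq D f g : (forall t, D t -> f t = g t) -> RI D f = RI D g.
Proof. by move=> H; apply: eq_Rintegral => t /set_mem/H. Qed.
Lemma RI_abs D f : fmeas D -> bm f -> `|RI D f| <= RI D (fun t => `|f t|).
Proof. by move=> hD hf; apply: le_normr_Rintegral; [exact: hD.1|exact: bm_integrable]. Qed.
Lemma RI_ge0 D f : (forall t, D t -> 0 <= f t) -> 0 <= RI D f.
Proof. by move=> H; apply: Rintegral_ge0. Qed.
Lemma meas_ge0 D : 0 <= meas D. Proof. by rewrite fine_ge0. Qed.
Lemma RI_bound D f K : fmeas D -> bm f -> (forall t, D t -> `|f t| <= K) ->
  `|RI D f| <= K * meas D.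
Proof.
move=> hD hf H; apply: (le_trans (RI_abs hD hf)); rewrite -RI_cst//.
by apply: RI_le => //; [exact: bm_norm|exact: bm_cst].
Qed.
Lemma fmeasS D E : measurable E -> E `<=` D -> fmeas D -> fmeas E.
Proof.
move=> mE ED [mD fD]; split=> //; apply: le_lt_trans fD.
by apply: le_measure => //; rewrite inE.
Qed.
Lemma RI_U D E f : fmeas (D `|` E) -> measurable D -> measurable E ->
  [disjoint D & E] -> bm f -> RI (D `|` E) f = RI D f + RI E f.
Proof. by move=> hDE mD mE DE hf; apply: Rintegral_setU => //; exact: bm_integrable. Qed.
Lemma RI_indic D E f : RI (D `&` E) f = RI D (fun t => f t * \1_E t).
Proof.
rewrite /RI Rintegral_mkcondr; apply: RI_eq => t _.
by rewrite patchE indicE; case: (t \in E); rewrite ?mulr1 ?mulr0.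
Qed.
Lemma meas_RI D : fmeas D -> meas D = RI D (fun=> 1).
Proof. by move=> hD; rewrite RI_cst// mul1r. Qed.
Lemma fmeas_mu D : fmeas D -> mu D = (meas D)%:E.
Proof. by move=> [mD fD]; rewrite fineK// ge0_fin_numE. Qed.

Lemma RI_sum D (I : Type) (s : seq I) (P : pred I) (F : I -> R -> R) : fmeas D ->
  (forall i, bm (F i)) ->
  bm (fun t => \sum_(i <- s | P i) F i t) /\
  RI D (fun t => \sum_(i <- s | P i) F i t) = \sum_(i <- s | P i) RI D (F i).
Proof.
move=> hD hF; elim: s => [|a s [IH1 IH2]].
  split; first by under eq_fun do rewrite big_nil; exact: bm_cst.
  by under RI_eq do rewrite big_nil; rewrite RI_cst// mul0r big_nil.
have E : (fun t => \sum_(i <- a :: s | P i) F i t) =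
  (fun t => (if P a then F a t else 0) + \sum_(i <- s | P i) F i t).
  by apply/funext => t; rewrite big_cons; case: (P a); rewrite ?add0r.
have hPa : bm (fun t => if P a then F a t else 0).
  by case: (P a); [exact: hF|exact: bm_cst].
rewrite E; split; first exact: bmD.
rewrite RI_D// IH2 big_cons; case: (P a) => //.
by rewrite RI_cst// mul0r add0r.
Qed.

Lemma RI_dct D (F : nat -> R -> R) f K : fmeas D -> (forall n, bm (F n)) -> bm f ->
  (forall n t, D t -> `|F n t| <= K) ->
  (\forall t \ae mu, D t -> F n t @[n --> \oo] --> f t) ->
  RI D (F n) @[n --> \oo] --> RI D f.
Proof.
move=> hD hF hf HK H; have [mD fD] := hD.
have [] := @dominated_convergence _ _ R mu D mD (fun n => EFin \o F n) (EFin \o f)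
   (cst K%:E).
- by move=> n; apply/measurable_EFinP; exact: (measurable_funTS (hF n).1).
- by apply/measurable_EFinP; exact: (measurable_funTS hf.1).
- by move: H; apply: aeS => t H Dt; apply: cvg_EFin; [exact: nearW|exact: H].
- exact: (bm_integrable hD (bm_cst K)).
- by apply: aeW => t n Dt /=; rewrite lee_fin HK.
move=> _ _ H2; apply: (@fine_cvg _ _ _ _ (fun n => (\int[mu]_(x in D) (F n x)%:E)%E)).
rewrite /RI /Rintegral fineK//; apply: integrable_fin_num => //.
exact: bm_integrable.
Qed.
End BoundedMeasurable.

(** * Complex-valued integrals *)

Section ComplexIntegral.
Context {R : realType}.
Local Notation C := R[i].
Local Notation mu := (@lebesgue_measure R).
Implicit Types (f g : R -> C) (D E : set R) (K : R) (z w : C).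

Definition cbm g := bm (fun t => Re (g t)) /\ bm (fun t => Im (g t)).
Definition CI D g : C := (RI D (fun t => Re (g t)) +i* RI D (fun t => Im (g t)))%C.

Lemma cbmP g K : measurable_fun [set: R] (fun t => Re (g t)) ->
  measurable_fun [set: R] (fun t => Im (g t)) -> (forall t, N (g t) <= K) -> cbm g.
Proof.
move=> mr mi H; split; split=> //; exists K => t; apply: le_trans (H t).
  exact: N_Re.
exact: N_Im.
Qed.
Lemma cbmD f g : cbm f -> cbm g -> cbm (fun t => f t + g t).
Proof.
move=> [f1 f2] [g1 g2]; split.
  by under eq_fun do rewrite ReD; exact: bmD.
by under eq_fun do rewrite ImD; exact: bmD.
Qed.
Lemma cbmM f g : cbm f -> cbm g -> cbm (fun t => f t * g t).
Proof.
move=> [f1 f2] [g1 g2]; split.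
  by under eq_fun do rewrite ReM; apply: bmB; exact: bmM.
by under eq_fun do rewrite ImM; apply: bmD; exact: bmM.
Qed.
Lemma cbm_conj f : cbm f -> cbm (fun t => ((f t)^*)%C).
Proof.
move=> [f1 f2]; split.
  by under eq_fun do rewrite Re_conj.
by under eq_fun do rewrite Im_conj; exact: bmN.
Qed.
Lemma cbm_cst z : cbm (fun=> z). Proof. by split; exact: bm_cst. Qed.
Lemma cbmN f : cbm f -> cbm (fun t => - f t).
Proof.
move=> [f1 f2]; split.
  by under eq_fun do rewrite ReN; exact: bmN.
by under eq_fun do rewrite ImN; exact: bmN.
Qed.
Lemma cbmB f g : cbm f -> cbm g -> cbm (fun t => f t - g t).
Proof. by move=> hf /cbmN; exact: cbmD. Qed.
Lemma cbm_expi : cbm (expi : R -> C).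
Proof. by split; [exact: bm_cos|exact: bm_sin]. Qed.
Lemma cbm_comp f (h : R -> R) : cbm f -> measurable_fun [set: R] h -> cbm (f \o h).
Proof. by move=> [f1 f2] mh; split; [exact: (bm_comp f1 mh)|exact: (bm_comp f2 mh)]. Qed.
Lemma cbm_real (h : R -> R) : bm h -> cbm (fun t => (h t)%:C%C).
Proof. by move=> hh; split=> //=; exact: bm_cst. Qed.

Lemma CI_D D f g : fmeas D -> cbm f -> cbm g ->
  CI D (fun t => f t + g t) = CI D f + CI D g.
Proof.
move=> hD [f1 f2] [g1 g2]; apply: complex_ext; rewrite ?ReD ?ImD/= -RI_D//;
  by apply: RI_eq => t _; rewrite ?ReD ?ImD.
Qed.
Lemma CI_Z D z f : fmeas D -> cbm f -> CI D (fun t => z * f t) = z * CI D f.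
Proof.
move=> hD [f1 f2]; apply: complex_ext; rewrite ?ReM ?ImM/= -!RI_Z//.
  rewrite -RI_B//; [|by apply: bmM => //; exact: bm_cst..].
  by apply: RI_eq => t _; rewrite ReM.
rewrite -RI_D//; [|by apply: bmM => //; exact: bm_cst..].
by apply: RI_eq => t _; rewrite ImM.
Qed.
Lemma CI_conj D f : fmeas D -> cbm f -> CI D (fun t => ((f t)^*)%C) = ((CI D f)^*)%C.
Proof.
move=> hD [f1 f2]; apply: complex_ext; rewrite ?Re_conj ?Im_conj/=.
  by apply: RI_eq => t _; rewrite Re_conj.
by rewrite -RI_N//; apply: RI_eq => t _; rewrite Im_conj.
Qed.
Lemma CI_N D f : fmeas D -> cbm f -> CI D (fun t => - f t) = - CI D f.
Proof.
move=> hD hf; rewrite -mulN1r -CI_Z//; congr CI; apply/funext => t.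
by rewrite mulN1r.
Qed.
Lemma CI_B D f g : fmeas D -> cbm f -> cbm g ->
  CI D (fun t => f t - g t) = CI D f - CI D g.
Proof. by move=> hD hf hg; rewrite CI_D// ?CI_N//; exact: cbmN. Qed.
Lemma CI_eq D f g : (forall t, D t -> f t = g t) -> CI D f = CI D g.
Proof. by move=> H; apply: complex_ext => /=; apply: RI_eq => t /H ->. Qed.
Lemma CI_cst D z : fmeas D -> CI D (fun=> z) = z * (meas D)%:C%C.
Proof.
by move=> hD; apply: complex_ext; rewrite ?ReM ?ImM/= ?RI_cst// ?mulr0 ?subr0 ?add0r.
Qed.
Lemma CI_real D (h : R -> R) : fmeas D -> CI D (fun t => (h t)%:C%C) = (RI D h)%:C%C.
Proof.
by move=> hD; apply: complex_ext => //=; rewrite RI_cst// mul0r.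
Qed.
(** A unimodular factor u makes the integral real and nonnegative, so only the real part of u f has
    to be estimated and no constant is lost. *)
Lemma N_CI D f K : fmeas D -> cbm f -> (forall t, D t -> N (f t) <= K) ->
  N (CI D f) <= K * meas D.
Proof.
move=> hD hf H.
pose v := CI D f; pose u := if v == 0 then 1 else (v^*)%C / (N v)%:C%C.
have [uv Nu] : u * v = (N v)%:C%C /\ N u = 1.
  rewrite /u; case: eqP => [->|/eqP v0]; first by rewrite mulr0 N0 N1.
  have n0 : N v != 0 by rewrite N_eq0.
  have n0' : (N v)%:C%C != 0 by rewrite -N_eq0 N_real normr_eq0.
  split; last by rewrite NM NV N_conj N_real ger0_norm ?N_ge0// mulfV.
  by rewrite mulrAC (mulrC _ v) mul_conj expr2 rmorphM/= mulfK.
have -> : N (CI D f) = Re (CI D (fun t => u * f t)) by rewrite CI_Z// uv.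
have [w1 w2] : cbm (fun t => u * f t) by apply: cbmM => //; exact: cbm_cst.
apply: le_trans (ler_norm _) _; rewrite /CI/=; apply: RI_bound => // t Dt.
by apply: (le_trans (N_Re _)); rewrite NM Nu mul1r H.
Qed.
Lemma CI_U D E f : fmeas (D `|` E) -> measurable D -> measurable E ->
  [disjoint D & E] -> cbm f -> CI (D `|` E) f = CI D f + CI E f.
Proof.
by move=> hDE mD mE DE [f1 f2]; apply: complex_ext; rewrite ?ReD ?ImD/= RI_U.
Qed.
Lemma CI_sum D (I : Type) (s : seq I) (P : pred I) (F : I -> R -> C) : fmeas D ->
  (forall i, cbm (F i)) ->
  cbm (fun t => \sum_(i <- s | P i) F i t) /\
  CI D (fun t => \sum_(i <- s | P i) F i t) = \sum_(i <- s | P i) CI D (F i).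
Proof.
move=> hD hF; elim: s => [|a s [IH1 IH2]].
  split; first by under eq_fun do rewrite big_nil; exact: cbm_cst.
  by under CI_eq do rewrite big_nil; rewrite CI_cst// mul0r big_nil.
have E : (fun t => \sum_(i <- a :: s | P i) F i t) =
  (fun t => (if P a then F a t else 0) + \sum_(i <- s | P i) F i t).
  by apply/funext => t; rewrite big_cons; case: (P a); rewrite ?add0r.
have hPa : cbm (fun t => if P a then F a t else 0).
  by case: (P a); [exact: hF|exact: cbm_cst].
rewrite E; split; first exact: cbmD.
rewrite CI_D// IH2 big_cons; case: (P a) => //.
by rewrite CI_cst// mul0r add0r.
Qed.
Lemma CI_dct D (F : nat -> R -> C) f K : fmeas D -> (forall n, cbm (F n)) -> cbm f ->
  (forall n t, D t -> N (F n t) <= K) ->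
  {ae mu, forall t, D t -> F n t @[n --> \oo] --> f t} ->
  CI D (F n) @[n --> \oo] --> CI D f.
Proof.
move=> hD hF [f1 f2] HK H; apply/cvg_ReIm; split=> /=.
  apply: (@RI_dct _ _ (fun n t => Re (F n t)) _ K) => //.
  - by move=> n; have [] := hF n.
  - by move=> n t /(HK n); apply: le_trans; exact: N_Re.
  by move: H; apply: aeS => t H /H/cvg_ReIm[].
apply: (@RI_dct _ _ (fun n t => Im (F n t)) _ K) => //.
- by move=> n; have [] := hF n.
- by move=> n t /(HK n); apply: le_trans; exact: N_Im.
by move: H; apply: aeS => t H /H/cvg_ReIm[].
Qed.
End ComplexIntegral.

(** * Goursat's bisection for an abstract function of rectangles *)

Section Goursat.
Context {R : realType}.
Variables (J : R -> R -> R -> R -> R) (r0 t0 w0 l0 : R).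
Let inside r t w l := [/\ r0 <= r, r + w <= r0 + w0, t0 <= t & t + l <= t0 + l0].

(** If the value were positive, some quarter would keep a fourth of it, and so on. The nested
    rectangles shrink to a point, near which the value is at most e times the squared size, which
    also decreases by a factor 4 at each step: a contradiction for small e. *)
Lemma goursat_bisection : 0 < w0 -> 0 < l0 ->
  (forall r t w l, 0 < w -> 0 < l -> inside r t w l ->
    J r t w l <= J r t (w / 2) (l / 2) + J (r + w / 2) t (w / 2) (l / 2) +
      (J r (t + l / 2) (w / 2) (l / 2) + J (r + w / 2) (t + l / 2) (w / 2) (l / 2))) ->
  (forall r' t', r0 <= r' <= r0 + w0 -> t0 <= t' <= t0 + l0 -> forall e, 0 < e ->
    exists2 d, 0 < d & forall r t w l, 0 < w < d -> 0 < l < d -> inside r t w l ->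
      r <= r' <= r + w -> t <= t' <= t + l -> J r t w l <= e * (w + l) ^+ 2) ->
  J r0 t0 w0 l0 <= 0.
Proof.
move=> w00 l00 Hsub Hloc; rewrite leNgt; apply/negP => J0.
pose j n := J r0 t0 w0 l0 / 4 ^+ n.
pose W n := w0 / 2 ^+ n; pose L n := l0 / 2 ^+ n.
have W0 n : 0 < W n by rewrite divr_gt0// exprn_gt0.
have L0 n : 0 < L n by rewrite divr_gt0// exprn_gt0.
have WS n : W n = W n.+1 + W n.+1.
  by rewrite /W exprS invfM; have : (2:R) ^+ n != 0 by []; move=> ?; field.
have LS n : L n = L n.+1 + L n.+1.
  by rewrite /L exprS invfM; have : (2:R) ^+ n != 0 by []; move=> ?; field.
(* The first quarter, in a fixed order, that keeps a fourth of the value; when three of them fail,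
   subadditivity leaves the last. *)
pose step n (p : R * R) : R * R :=
  let: (r, t) := p in let w := W n.+1 in let l := L n.+1 in
  if j n.+1 <= J r t w l then (r, t) else
  if j n.+1 <= J (r + w) t w l then (r + w, t) else
  if j n.+1 <= J r (t + l) w l then (r, t + l) else (r + w, t + l).
pose fix p n := if n is m.+1 then step m (p m) else (r0, t0).
have jS n : j n = 4 * j n.+1.
  by rewrite /j exprS invfM; have : (4:R) ^+ n != 0 by []; move=> ?; field.
have inv n : inside (p n).1 (p n).2 (W n) (L n) /\ j n <= J (p n).1 (p n).2 (W n) (L n).
  elim: n => [|n [[i1 i2 i3 i4] IH]].
    by rewrite /= /W /L /j !expr0 !divr1; split=> //; split=> //.
  rewrite /=; case: (p n) i1 i2 i3 i4 IH => r t /= i1 i2 i3 i4 IH.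
  have := Hsub r t (W n) (L n) (W0 n) (L0 n).
  have -> : W n / 2 = W n.+1 by have := WS n; lra.
  have -> : L n / 2 = L n.+1 by have := LS n; lra.
  move=> /(_ (And4 i1 i2 i3 i4)) H.
  move: (W0 n.+1) (L0 n.+1) (WS n) (LS n) (jS n) i2 i4 IH H.
  move: (W n.+1) (L n.+1) (W n) (L n) (j n) (j n.+1) => w' l' w l a b w'0 l'0 -> -> ->.
  clear -i1 i3 w'0 l'0 => i2 i4 IH H.
  case: ifPn => [H1|]; last rewrite -ltNge => n1; first by split => //=; split; lra.
  case: ifPn => [H1|]; last rewrite -ltNge => n2; first by split => //=; split; lra.
  case: ifPn => [H1|]; last rewrite -ltNge => n3; first by split => //=; split; lra.
  by split => /=; [split|]; lra.
have stepn n : [/\ (p n).1 <= (p n.+1).1, (p n.+1).1 + W n.+1 <= (p n).1 + W n,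
    (p n).2 <= (p n.+1).2 & (p n.+1).2 + L n.+1 <= (p n).2 + L n].
  have := WS n; have := LS n; have := W0 n.+1; have := L0 n.+1.
  rewrite /=; case: (p n) => r t /=.
  by case: ifP => _; [|case: ifP => _; [|case: ifP => _]] => /= *; split; lra.
have key (q V : nat -> R) : (forall n, q n <= q n.+1) -> (forall n, 0 < V n) ->
    (forall n, q n.+1 + V n.+1 <= q n + V n) -> exists c, forall n, q n <= c <= q n + V n.
  move=> q1 V0 q2.
  have nd : nondecreasing_seq q by apply/nondecreasing_seqP.
  have ni : nonincreasing_seq (fun n => q n + V n) by apply/nonincreasing_seqP.
  have ub n m : q n <= q m + V m.
    have := nd _ _ (leq_maxl n m); have := ni _ _ (leq_maxr n m).
    by have := V0 (maxn n m); lra.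
  have cq : cvgn q.
    apply: nondecreasing_is_cvgn => //; exists (q 0%N + V 0%N) => _ [n _ <-]; exact: ub.
  exists (limn q) => n; apply/andP; split; first exact: nondecreasing_cvgn_le.
  by apply: limr_le => //; apply: nearW => m; exact: ub.
have [r' Hr] : exists c, forall n, (p n).1 <= c <= (p n).1 + W n.
  by apply: key => // n; case: (stepn n).
have [t' Ht] : exists c, forall n, (p n).2 <= c <= (p n).2 + L n.
  by apply: key => // n; case: (stepn n).
have Hr0 := Hr 0%N; have Ht0 := Ht 0%N.
rewrite /= /W expr0 divr1 in Hr0; rewrite /= /L expr0 divr1 in Ht0.
(* With this e, the bound e (W n + L n)^2 is half of [j n] at every scale. *)
pose e := J r0 t0 w0 l0 / (2 * (w0 + l0) ^+ 2).
have wl : 0 < (w0 + l0) ^+ 2 by rewrite exprn_gt0// addr_gt0.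
have e0 : 0 < e by rewrite divr_gt0// mulr_gt0.
have [d d0 Hd] := Hloc r' t' Hr0 Ht0 e e0.
have [n Hn] : exists n, W n < d /\ L n < d.
  have m0 : 0 < d / (w0 + l0) by rewrite divr_gt0// addr_gt0.
  have : (2 : R)^-1 ^+ n @[n --> \oo] --> 0.
    by apply: cvg_expr; rewrite ger0_norm ?invr_ge0// invf_lt1// ltr1n.
  move=> /cvgrPdist_lt/(_ _ m0)[n _ /(_ n (leqnn n))].
  rewrite sub0r normrN ger0_norm ?exprn_ge0 ?invr_ge0// exprVn.
  rewrite ltr_pdivlMr ?addr_gt0// => H; exists n.
  have p2 : 0 < (2 : R) ^- n by rewrite invr_gt0 exprn_gt0.
  rewrite /W /L; split; nra.
have [ins jn] := inv n.
have := Hd _ _ _ _ _ _ ins (Hr n) (Ht n).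
rewrite W0 L0 Hn.1 Hn.2 => /(_ isT isT) H.
have := le_trans jn H.
have -> : e * (W n + L n) ^+ 2 = j n / 2.
  rewrite /e /W /L /j (_ : 4 = 2 ^+ 2 :> R); last by ring.
  rewrite exprAC; have : (2:R) ^+ n != 0 by [].
  by move=> h; field; rewrite h; apply/andP; split; lra.
have : 0 < j n by rewrite divr_gt0// exprn_gt0.
lra.
Qed.
End Goursat.

(** * Goursat's theorem on polar rectangles *)

Section Annulus.
Context {R : realType}.
Local Notation C := R[i].
Local Notation mu := (@lebesgue_measure R).

Definition seg (a b : R) : set R := [set` `[a, b[%R].

Lemma fmeas_seg a b : fmeas (seg a b).
Proof.
split; first exact: measurable_itv.
by rewrite lebesgue_measure_itv; case: ifP => // _; rewrite /= -EFinB ltry.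
Qed.
Lemma meas_seg a b : a <= b -> meas (seg a b) = b - a.
Proof.
rewrite /meas lebesgue_measure_itv/= lte_fin le_eqVlt.
by case: ltgtP => //= ->; rewrite subrr.
Qed.
Lemma segE a b t : seg a b t <-> a <= t < b.
Proof. by rewrite /seg /= in_itv. Qed.
Lemma seg_split a b c : a <= b -> b <= c ->
  seg a c = seg a b `|` seg b c /\ [disjoint seg a b & seg b c].
Proof.
move=> ab bc; split.
  rewrite predeqE => t; rewrite /setU /= !segE; split.
    by move=> /andP[-> ->]/=; rewrite andbT; case: (ltP t b); [left|right].
  by move=> [] /andP[h1 h2]; apply/andP; split; lra.
apply/disj_setPS => t [] /segE /andP[_ h1] /segE /andP[h2 _].
by move: (le_lt_trans h2 h1); rewrite ltxx.
Qed.
Lemma CI_seg a b c (g : R -> C) : a <= b -> b <= c -> cbm g ->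
  CI (seg a c) g = CI (seg a b) g + CI (seg b c) g.
Proof.
move=> ab bc hg; have [E dj] := seg_split ab bc.
rewrite E CI_U//; [by rewrite -E; exact: fmeas_seg|exact: (fmeas_seg a b).1|].
exact: (fmeas_seg b c).1.
Qed.

Lemma RI_FTC (a b : R) (f F : R -> R) : a <= b -> continuous f ->
  (forall x : R, is_derive x (1 : R) F (f x)) -> RI (seg a b) f = F b - F a.
Proof.
rewrite le_eqVlt => /predU1P[->|ab] cf dF.
  rewrite subrr (_ : seg b b = set0) ?/RI ?Rintegral_set0//.
  by rewrite /seg set_itvxx.
rewrite /RI /seg Rintegral_itv_bndo_bndc.
  rewrite /Rintegral (@continuous_FTC2 _ _ F)//.
  - by apply: continuous_subspaceT => x; exact: cf.
  - have dc : forall x, {for x, continuous F}.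
      move=> x; apply/differentiable_continuous/derivable1_diffP.
      by have [] := dF x.
    split; first by move=> x _; have [] := dF x.
      by apply: cvg_at_right_filter; exact: dc.
    by apply: cvg_at_left_filter; exact: dc.
  by move=> x _; rewrite derive1E; exact: derive_val.
have : mu.-integrable `[a, b] (EFin \o f).
  apply: continuous_compact_integrable; first exact: segment_compact.
  by apply: continuous_subspaceT => x; exact: cf.
apply: integrableS => //.
by move=> x; rewrite /= !in_itv/= => /andP[-> /ltW ->].
Qed.

Lemma CI_expi a b : a <= b -> 'i%C * CI (seg a b) expi = expi b - expi a :> C.
Proof.
move=> ab; have RIc : RI (seg a b) cos = sin b - sin a.
  by apply: RI_FTC => // x; exact: continuous_cos.
have RIs : RI (seg a b) sin = - cos b - - cos a.
  apply: (@RI_FTC a b sin (fun x => - cos x)) => // x; first exact: continuous_sin.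
  have H : is_derive x 1 (-%R \o cos : R -> R) (- (- sin x)) by apply: is_deriveN.
  by move: H; rewrite opprK.
by apply: complex_ext; rewrite /= RIc RIs; ring.
Qed.

Section FormIntegral.
Variables (r1 r2 : R).
Hypotheses (r1_gt0 : 0 < r1) (r12 : r1 < r2).
(* Clamping the radius makes the integrands below bounded and measurable on the whole
   line. *)
Definition clampr (r : R) := Num.max r1 (Num.min r r2).
Local Notation k := clampr.

Lemma clampr_in r : r1 <= k r <= r2.
Proof. by rewrite /k le_max lexx /= ge_max ge_min lexx orbT andbT ltW. Qed.
Lemma clampr_id r : r1 <= r <= r2 -> k r = r.
Proof. by move=> /andP[h1 h2]; rewrite /k (min_idPl h2) (max_idPr h1). Qed.
Lemma clampr_gt0 r : 0 < k r.
Proof. by apply: lt_le_trans r1_gt0 _; have /andP[] := clampr_in r. Qed.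
Lemma measurable_clampr : measurable_fun [set: R] k.
Proof.
apply: measurable_maxr; first exact: measurable_cst.
by apply: measurable_minr; [exact: measurable_id|exact: measurable_cst].
Qed.

(** Integrability along the two families of sides, circular and radial; the factor 1 / r is that of
    dz / z on a radius. *)
Definition sections (G : R -> R -> C) := (forall r, cbm (G r)) /\
  (forall t, cbm (fun r => (k r)^-1%:C%C * G r t)).

(* The integral of h(z) dz / z, with dz / z = dr / r + i dt, along the boundary of the
   polar rectangle [r, r + w] x [t, t + l], where G r t = h(r e^{it}). *)
Definition form (G : R -> R -> C) r t w l : C :=
  'i%C * (CI (seg t (t + l)) (G (r + w)) - CI (seg t (t + l)) (G r)) +
  (CI (seg r (r + w)) (fun p => (k p)^-1%:C%C * G p t) -
   CI (seg r (r + w)) (fun p => (k p)^-1%:C%C * G p (t + l))).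

Lemma form_split G r t w l : sections G -> 0 < w -> 0 < l ->
  form G r t w l = form G r t (w / 2) (l / 2) + form G (r + w / 2) t (w / 2) (l / 2) +
    (form G r (t + l / 2) (w / 2) (l / 2) + form G (r + w / 2) (t + l / 2) (w / 2) (l / 2)).
Proof.
move=> [G1 G2] w0 l0; rewrite /form.
have -> : r + w / 2 + w / 2 = r + w by lra.
have -> : t + l / 2 + l / 2 = t + l by lra.
have [h1 h2] : t <= t + l / 2 /\ t + l / 2 <= t + l by split; lra.
have [h3 h4] : r <= r + w / 2 /\ r + w / 2 <= r + w by split; lra.
rewrite !(CI_seg h1 h2)// !(CI_seg h3 h4)//.
ring.
Qed.

Lemma formD G G' r t w l : sections G -> sections G' ->
  form (fun p s => G p s + G' p s) r t w l = form G r t w l + form G' r t w l.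
Proof.
move=> [G1 G2] [H1 H2]; rewrite /form !CI_D//; try exact: fmeas_seg.
have E u : CI (seg r (r + w)) (fun p => (k p)^-1%:C%C * (G p u + G' p u)) =
   CI (seg r (r + w)) (fun p => (k p)^-1%:C%C * G p u) +
   CI (seg r (r + w)) (fun p => (k p)^-1%:C%C * G' p u).
  rewrite -CI_D//; last exact: fmeas_seg.
  by apply: CI_eq => p _; rewrite mulrDr.
rewrite !E; ring.
Qed.

Lemma sections_affine (A B : C) :
  sections (fun p s => A + B * (k p)%:C%C * expi s).
Proof.
have bk : bm (fun p => (k p)).
  split; first exact: measurable_clampr.
  exists r2 => p; rewrite gtr0_norm ?clampr_gt0//.
  by have /andP[] := clampr_in p.
have bV : bm (fun p => (k p)^-1).
  split.
    have -> : (fun p => (k p)^-1) = (fun p => expR (- ln (k p))).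
      by apply/funext => p; rewrite expRN lnK// posrE clampr_gt0.
    apply: measurableT_comp; first exact: measurable_expR.
    apply: measurableT_comp => //; apply: measurableT_comp; first exact: measurable_ln.
    exact: measurable_clampr.
  exists r1^-1 => p; rewrite gtr0_norm ?invr_gt0 ?clampr_gt0//.
  by rewrite lef_pV2 ?posrE ?clampr_gt0//; have /andP[] := clampr_in p.
split=> [p|s].
  by apply: cbmD; [exact: cbm_cst|apply: cbmM; [exact: cbm_cst|exact: cbm_expi]].
apply: cbmM; first exact: cbm_real.
apply: cbmD; first exact: cbm_cst.
apply: cbmM; last exact: cbm_cst.
by apply: cbmM; [exact: cbm_cst|exact: cbm_real].
Qed.

(** For h(z) = A + B z the form is A dz / z + B dz. The first part cancels between opposite sides,
    and the second is exact, so its integral around the rectangle vanishes. *)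
Lemma form_affine A B r t w l : 0 < w -> 0 < l -> r1 <= r -> r + w <= r2 ->
  form (fun p s => A + B * (k p)%:C%C * expi s) r t w l = 0.
Proof.
move=> w0 l0 hr hw; rewrite /form.
have tl : t <= t + l by lra.
have L p : CI (seg t (t + l)) (fun s => A + B * (k p)%:C%C * expi s) =
    A * l%:C%C + B * (k p)%:C%C * CI (seg t (t + l)) expi.
  rewrite CI_D ?CI_cst ?CI_Z//; try exact: fmeas_seg; try exact: cbm_cst;
    try exact: cbm_expi.
    by rewrite meas_seg// addrAC subrr add0r.
  by apply: cbmM; [exact: cbm_cst|exact: cbm_expi].
have bV s : cbm (fun p => (k p)^-1%:C%C * (A + B * (k p)%:C%C * expi s)).
  exact: (sections_affine A B).2.
have -> : CI (seg r (r + w)) (fun p => (k p)^-1%:C%C * (A + B * (k p)%:C%C * expi t)) -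
     CI (seg r (r + w)) (fun p => (k p)^-1%:C%C * (A + B * (k p)%:C%C * expi (t + l))) =
   B * (expi t - expi (t + l)) * w%:C%C.
  rewrite -CI_B//; last exact: fmeas_seg.
  rewrite (@CI_eq _ _ _ (fun=> B * (expi t - expi (t + l)))).
    rewrite CI_cst; last exact: fmeas_seg.
    by rewrite meas_seg; [rewrite addrAC subrr add0r|lra].
  move=> p _; rewrite fmorphV; have k0 : (k p)%:C%C != 0 :> C.
    by rewrite -N_eq0 N_real normr_eq0 gt_eqF// clampr_gt0.
  by field.
have k1 : k r = r by apply: clampr_id; lra.
have k2 : k (r + w) = r + w by apply: clampr_id; lra.
rewrite !L k1 k2.
have := CI_expi tl => H.
transitivity (B * w%:C%C * ('i%C * CI (seg t (t + l)) expi) + B * (expi t - expi (t + l)) * w%:C%C).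
  by rewrite rmorphD /=; ring.
by rewrite H; ring.
Qed.

Lemma N_form G r t w l K : sections G -> 0 < w -> 0 < l -> r1 <= r -> r + w <= r2 ->
  (forall p s, r <= p <= r + w -> t <= s <= t + l -> N (G p s) <= K) ->
  N (form G r t w l) <= 2 * K * l + 2 * (K / r1) * w.
Proof.
move=> [G1 G2] w0 l0 hr hw HK; rewrite /form.
have tl : t <= t + l by lra.
have rw : r <= r + w by lra.
have ml : meas (seg t (t + l)) = l by rewrite meas_seg// addrAC subrr add0r.
have mw : meas (seg r (r + w)) = w by rewrite meas_seg// addrAC subrr add0r.
have a p : r <= p <= r + w -> N (CI (seg t (t + l)) (G p)) <= K * l.
  move=> hp; rewrite -[in leRHS]ml; apply: N_CI => //; first exact: fmeas_seg.
  by move=> s /segE hs; apply: HK => //; lra.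
have b s : t <= s <= t + l ->
    N (CI (seg r (r + w)) (fun p => (k p)^-1%:C%C * G p s)) <= K / r1 * w.
  move=> hs; rewrite -[in leRHS]mw; apply: N_CI => //; first exact: fmeas_seg.
  move=> p /segE hp; rewrite NM N_real gtr0_norm ?invr_gt0 ?clampr_gt0// mulrC.
  rewrite ler_pM ?N_ge0 ?invr_ge0 ?(ltW (clampr_gt0 _))//; first by apply: HK => //; lra.
  by rewrite lef_pV2 ?posrE ?clampr_gt0//; have /andP[] := clampr_in p.
have Ni : N ('i%C : C) = 1 by rewrite N_def/= expr0n expr1n add0r sqrtr1.
apply: (le_trans (ND _ _)); rewrite NM Ni mul1r; apply: lerD.
  apply: (le_trans (ND _ _)); rewrite NN.
  by have := a (r + w); have := a r; lra.
apply: (le_trans (ND _ _)); rewrite NN.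
by have := b (t + l); have := b t; lra.
Qed.
End FormIntegral.

Definition pcont (g : R -> C) := forall t e, 0 < e ->
  exists2 d, 0 < d & forall s, `|s - t| < d -> N (g s - g t) < e.

Lemma pcont_cbm g K : pcont g -> (forall t, N (g t) <= K) -> cbm g.
Proof.
move=> hg; apply: cbmP; apply: continuous_measurable_fun => t;
  apply/cvgrPdist_lt => e /(hg t)[d d0 Hd]; apply/nbhs_ballP; exists d => //= s;
  rewrite /ball /= distrC => /Hd; apply: le_lt_trans.
  by rewrite distrC -ReN -ReD; exact: N_Re.
by rewrite distrC -ImN -ImD; exact: N_Im.
Qed.

Lemma pcont_polar (k : R -> R) (l : R -> R) : (forall s t, `|k s - k t| <= `|s - t|) ->
  (forall s t, `|l s - l t| <= `|s - t|) ->
  pcont (fun t => (k t)%:C%C * expi (l t)).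
Proof.
move=> hk hl t e e0; have n0 : 0 <= `|k t| by [].
exists (e / (2 + `|k t|)); first by rewrite divr_gt0//; lra.
move=> s; rewrite ltr_pdivlMr; last lra.
move=> st.
have -> : (k s)%:C%C * expi (l s) - (k t)%:C%C * expi (l t) =
   (k s - k t)%:C%C * expi (l s) + (k t)%:C%C * (expi (l s) - expi (l t)).
  by rewrite rmorphB /=; ring.
apply: (le_lt_trans (ND _ _)); rewrite !NM !N_real N_expi mulr1.
have := hk s t; have := hl s t; have := N_expiB (l s) (l t).
have : 0 <= `|s - t| by [].
move=> st0 h1 h2 h3.
have : `|k t| * N (expi (l s) - expi (l t)) <= `|k t| * `|s - t|.
  by rewrite ler_wpM2l//; apply: le_trans h1 _.
by nra.
Qed.

Lemma pcont_comp (h : C -> C) g : pcont g -> (forall t, ccont h (g t)) -> pcont (h \o g).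
Proof.
move=> hg hh t e e0; have [d d0 Hd] := hh t e e0; have [d' d'0 Hd'] := hg t d d0.
by exists d' => // s /Hd' /Hd.
Qed.

Lemma perimeter_bound (X v w l : R) : 0 <= X -> 0 < v -> 0 < w -> 0 < l ->
  2 * X * l + 2 * (X * v) * w <= X * (2 * (1 + v) * (w + l)).
Proof.
move=> X0 v0 w0 l0; have h1 : 0 <= X * w by rewrite mulr_ge0// ltW.
have h2 : 0 <= X * (v * l) by rewrite mulr_ge0// mulr_ge0// ltW.
lra.
Qed.

Definition circle_mean (h : C -> C) (r : R) : C :=
  CI (seg 0 (2 * pi)) (fun t => h (r%:C%C * expi t)).

(* Goursat's bisection for h(z) dz / z on [r1, r2] x [0, 2 pi]: the two radial sides
   cancel by periodicity. *)
Lemma circle_mean_const (h : C -> C) r1 r2 K : 0 < r1 -> r1 < r2 ->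
  (forall z, r1 <= N z <= r2 -> exists d, cdiff h z d) ->
  (forall z, r1 <= N z <= r2 -> N (h z) <= K) ->
  circle_mean h r1 = circle_mean h r2.
Proof.
move=> r10 r12 hd hK; pose k := clampr r1 r2.
have kin := clampr_in r12; have kid := @clampr_id r1 r2; have k0 p : 0 < k p by exact: clampr_gt0.
have Nk p s : r1 <= N ((k p)%:C%C * expi s) <= r2.
  by rewrite NM N_expi mulr1 N_real gtr0_norm.
have klip s t : `|k s - k t| <= `|s - t|.
  rewrite /k /clampr /Num.max /Num.min; have := ler_norm (s - t).
  have := ler_norm (t - s); rewrite (distrC t s) => h1 h2.
  by do ![case: ifP]; move=> *; rewrite ler_norml; lra.
pose H p s := h ((k p)%:C%C * expi s).
have hc z : r1 <= N z <= r2 -> ccont h z by move=> /hd[d]; exact: cdiff_ccont.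
have sH : sections r1 r2 H.
  split=> [p|s].
    apply: (@pcont_cbm _ K) => [|t]; last exact: hK.
    apply: (@pcont_comp h (fun t => (k p)%:C%C * expi t)) => [|t]; last exact: hc.
    by apply: (@pcont_polar (fun=> k p) id) => s t; rewrite // subrr normr0.
  apply: cbmM; last first.
    apply: (@pcont_cbm _ K) => [|t]; last exact: hK.
    apply: (@pcont_comp h (fun p => (k p)%:C%C * expi s)) => [|t]; last exact: hc.
    by apply: (@pcont_polar k (fun=> s)) => // u t; rewrite subrr normr0.
  have := (sections_affine r10 r12 1 0).2 0; congr cbm; apply/funext => p.
  by rewrite !mul0r addr0 mulr1.
pose J r t w l := N (form r1 r2 H r t w l).
have p0 : 0 < 2 * pi :> R by rewrite mulr_gt0// pi_gt0.
have : J r1 0 (r2 - r1) (2 * pi) <= 0.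
  apply: goursat_bisection => //; first lra.
    move=> r t w l w0 l0 _; rewrite /J (form_split _ _ sH)//.
    by apply: (le_trans (ND _ _)); apply: lerD; apply: ND.
  move=> r' t' hr' _ e e0; pose z := r'%:C%C * expi t'.
  have hr2 : r1 <= r' <= r2 by lra.
  have [d hd'] : exists d, cdiff h z d.
    by apply: hd; rewrite /z NM N_expi mulr1 N_real gtr0_norm; lra.
  have i1 : 0 < 1 + r1^-1 by rewrite addr_gt0// invr_gt0.
  (* The factor 1 + r2 turns w + l into a bound for the distance to z, and 2 (1 + 1 / r1) bounds the
     weighted perimeter; dividing by c leaves exactly e (w + l)^2. *)
  pose c := 2 * (1 + r2) * (1 + r1^-1).
  have c0 : 0 < c by rewrite /c !mulr_gt0//; lra.
  have [del del0 Hdel] := hd' _ (divr_gt0 e0 c0).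
  exists (del / (2 * (1 + r2))); first by rewrite divr_gt0//; lra.
  move=> r t w l /andP[w0 wd] /andP[l0 ld] [i2 i3 i4 i5] hr ht.
  have hwl : (1 + r2) * (w + l) < del.
    by move: wd ld; rewrite !ltr_pdivlMr; try lra; move=> *; lra.
  (* The affine approximation of h at z has integral 0 around the rectangle, so only the remainder
     [E], small by differentiability, contributes. *)
  pose A := h z - d * z.
  pose G p s := A + d * (k p)%:C%C * expi s.
  have sG : sections r1 r2 G := sections_affine r10 r12 A d.
  pose E p s := H p s + - G p s.
  have sNG : sections r1 r2 (fun p s => - G p s).
    split=> [p|s]; first by apply: cbmN; exact: sG.1.
    have := cbmN (sG.2 s); congr cbm; apply/funext => p.
    by rewrite mulrN.
  have sE : sections r1 r2 E.
    split=> [p|s]; first by apply: cbmD; [exact: sH.1|exact: sNG.1].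
    have := cbmD (sH.2 s) (sNG.2 s); congr cbm; apply/funext => p.
    by rewrite mulrDr.
  have -> : J r t w l = N (form r1 r2 E r t w l).
    rewrite /J; congr N.
    have -> : H = (fun p s => E p s + G p s).
      by apply/funext => p; apply/funext => s; rewrite /E subrK.
    by rewrite formD// [X in _ + X]form_affine ?addr0//; lra.
  have hE p s : r <= p <= r + w -> t <= s <= t + l ->
      N (E p s) <= e / c * ((1 + r2) * (w + l)).
    move=> hp hs; have kp : k p = p by apply: kid; lra.
    have hz : N ((k p)%:C%C * expi s - z) <= (1 + r2) * (w + l).
      rewrite /z kp.
      have -> : p%:C%C * expi s - r'%:C%C * expi t' =
        (p - r')%:C%C * expi s + r'%:C%C * (expi s - expi t').
        by rewrite rmorphB /=; ring.
      apply: (le_trans (ND _ _)); rewrite !NM !N_real N_expi mulr1.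
      have h1 := N_expiB s t'.
      have h2 : `|p - r'| <= w by rewrite ler_norml; lra.
      have h3 : `|s - t'| <= l by rewrite ler_norml; lra.
      have h4 : `|r'| <= r2 by rewrite ger0_norm; lra.
      have : `|r'| * N (expi s - expi t') <= r2 * l.
        by rewrite ler_pM// ?N_ge0//; apply: le_trans h1 h3.
      have : 0 <= r2 * w by rewrite mulr_ge0//; lra.
      by nra.
    have -> : E p s = h ((k p)%:C%C * expi s) - h z - d * ((k p)%:C%C * expi s - z).
      by rewrite /E /H /G /A; ring.
    apply: (le_trans (Hdel _ (le_lt_trans hz hwl))).
    by rewrite ler_wpM2l// ltW// divr_gt0.
  apply: (le_trans (N_form r10 r12 sE w0 l0 _ _ hE)); try lra.
  set X := e / c * _.
  have -> : e * (w + l) ^+ 2 = X * (2 * (1 + r1^-1) * (w + l)).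
    rewrite /X /c; field; rewrite !gt_eqF//; lra.
  have X0 : 0 <= X.
    have ec : 0 < e / c by rewrite divr_gt0.
    by rewrite /X; apply: mulr_ge0; [exact: ltW|apply: mulr_ge0; lra].
  have V0 : 0 < r1^-1 by rewrite invr_gt0.
  exact: perimeter_bound.
rewrite le_eqVlt ltNge N_ge0 orbF /J N_eq0 => /eqP F0.
have := F0; rewrite /form addrC.
have -> : r1 + (r2 - r1) = r2 by lra.
rewrite add0r.
have -> : (fun p => (clampr r1 r2 p)^-1%:C%C * H p (2 * pi)) =
    (fun p => (clampr r1 r2 p)^-1%:C%C * H p 0).
  by apply/funext => p; rewrite /H -[2 * pi]add0r expi_2pi.
rewrite subrr add0r => /eqP; rewrite mulf_eq0 => /orP[/eqP H0|].
  by have := congr1 (@complex.Im R) H0; rewrite /= => /eqP; rewrite oner_eq0.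
rewrite subr_eq0 => /eqP H1.
rewrite /circle_mean; have k1 : k r1 = r1 by apply: kid; lra.
have k2 : k r2 = r2 by apply: kid; lra.
by move: H1; rewrite /H k1 k2 => <-.
Qed.
End Annulus.

(** * The mean value property, up to the boundary *)

Section MeanValue.
Context {R : realType}.
Local Notation C := R[i].
Local Notation mu := (@lebesgue_measure R).
Local Notation I := (seg 0 (2 * pi) : set R).

Lemma twopi_gt0 : 0 < 2 * pi :> R. Proof. by rewrite mulr_gt0// pi_gt0. Qed.
Lemma fmeas_I : fmeas I. Proof. exact: fmeas_seg. Qed.
Lemma meas_I : meas I = 2 * pi.
Proof. by rewrite meas_seg ?subr0// ltW// twopi_gt0. Qed.

Lemma harmonic2_cvg : (n.+2%:R^-1 : R) @[n --> \oo] --> (0 : R).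
Proof.
by have := @cvg_harmonic R; rewrite -cvg_shiftS.
Qed.

(* The exceptional circle of radius rho makes room for the difference quotient
   w (h w - h z) / (w - z), for which differentiability at w = z is not known in
   advance. *)
Section OneFunction.
Variables (h : C -> C) (rho K : R).
Hypotheses (hc : forall z, N z < 1 -> ccont h z)
  (hd : forall z, N z < 1 -> z != 0 -> N z != rho -> exists d, cdiff h z d)
  (hK : forall z, N z < 1 -> N (h z) <= K) (rho_ge0 : 0 <= rho).

Lemma N_polar (r t : R) : 0 <= r -> N (r%:C%C * expi t) = r.
Proof. by move=> r0; rewrite NM N_expi mulr1 N_real ger0_norm. Qed.

Lemma cbm_circle r : 0 <= r < 1 -> cbm (fun t => h (r%:C%C * expi t)).
Proof.
move=> /andP[r0 r1]; have hr t := N_polar t r0.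
apply: (@pcont_cbm _ _ K) => [|t]; last by apply: hK; rewrite hr.
apply: (@pcont_comp _ h (fun t => r%:C%C * expi t)) => [|t]; last by apply: hc; rewrite hr.
by apply: (@pcont_polar _ (fun=> r) id) => s t; rewrite // subrr normr0.
Qed.

Lemma circle_mean_cvg (r_ : nat -> R) (r : R) : (forall n, 0 <= r_ n < 1) -> 0 <= r < 1 ->
  r_ n @[n --> \oo] --> r -> circle_mean h (r_ n) @[n --> \oo] --> circle_mean h r.
Proof.
move=> hr_ hr rn; apply: (@CI_dct _ _ (fun n t => h ((r_ n)%:C%C * expi t)) _ K).
- exact: fmeas_I.
- by move=> n; exact: cbm_circle.
- exact: cbm_circle.
- by move=> n t _; apply: hK; have /andP[? ?] := hr_ n; rewrite N_polar.
apply: ae_all => t _; apply/cvg_N => e e0.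
have [r0 r1] := andP hr.
have zr : N (r%:C%C * expi t) < 1 by rewrite N_polar.
have [d d0 Hd] := hc zr e0.
move/cvgrPdist_lt : rn => /(_ _ d0); apply: filterS => n hn; apply: Hd.
by rewrite -mulrBl NM N_expi mulr1 -rmorphB/= N_real distrC.
Qed.

(** Constancy on the annuli between radii r_n and r, with r_n decreasing to r0, passes to the limit.
    The inner radius may thus be 0 or rho, where h is only continuous. *)
Lemma circle_mean_down (r0 r : R) : 0 <= r0 -> r0 < r -> r < 1 -> ~~ (r0 < rho <= r) ->
  circle_mean h r = circle_mean h r0.
Proof.
move=> r00 r0r r1 nr; pose r_ n := r0 + (r - r0) * n.+2%:R^-1.
have b n : 0 < n.+2%:R^-1 :> R by rewrite invr_gt0.
have b1 n : n.+2%:R^-1 < 1 :> R by rewrite invf_lt1// ltr1n.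
have hr_ n : r0 < r_ n < r.
  rewrite /r_; move: (n.+2%:R^-1) (b n) (b1 n) => v v0 v1.
  by apply/andP; split; nra.
have cr : r_ n @[n --> \oo] --> r0.
  rewrite -[X in _ --> X]addr0; apply: cvgD; first exact: cvg_cst.
  by rewrite -(mulr0 (r - r0)); apply: cvgMr; exact: harmonic2_cvg.
have hr2 n : 0 <= r_ n < 1 by have := hr_ n; lra.
have hr3 : 0 <= r0 < 1 by lra.
have := circle_mean_cvg hr2 hr3 cr.
have -> : (fun n => circle_mean h (r_ n)) = (fun=> circle_mean h r).
  apply/funext => n; have hn := hr_ n.
  have H1 z : r_ n <= N z <= r -> exists d, cdiff h z d.
    move=> hz; apply: hd; first lra.
      by rewrite -N_gt0; lra.
    by apply: contra nr => /eqP <-; lra.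
  have H2 z : r_ n <= N z <= r -> N (h z) <= K by move=> hz; apply: hK; lra.
  by apply: circle_mean_const H1 H2; lra.
move/(@cvg_lim C^o) => <- //.
by rewrite lim_cst.
Qed.

Lemma circle_mean_up (r r1 : R) : 0 < r -> r < r1 -> r1 < 1 -> ~~ (r <= rho < r1) ->
  circle_mean h r = circle_mean h r1.
Proof.
move=> r0 rr1 r11 nr; pose r_ n := r1 - (r1 - r) * n.+2%:R^-1.
have b n : 0 < n.+2%:R^-1 :> R by rewrite invr_gt0.
have b1 n : n.+2%:R^-1 < 1 :> R by rewrite invf_lt1// ltr1n.
have hr_ n : r < r_ n < r1.
  rewrite /r_; move: (n.+2%:R^-1) (b n) (b1 n) => v v0 v1.
  by apply/andP; split; nra.
have cr : r_ n @[n --> \oo] --> r1.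
  rewrite -[X in _ --> X]subr0; apply: cvgB; first exact: cvg_cst.
  by rewrite -(mulr0 (r1 - r)); apply: cvgMr; exact: harmonic2_cvg.
have hr2 n : 0 <= r_ n < 1 by have := hr_ n; lra.
have hr3 : 0 <= r1 < 1 by lra.
have := circle_mean_cvg hr2 hr3 cr.
have -> : (fun n => circle_mean h (r_ n)) = (fun=> circle_mean h r).
  apply/funext => n; have hn := hr_ n.
  have H1 z : r <= N z <= r_ n -> exists d, cdiff h z d.
    move=> hz; apply: hd; first lra.
      by rewrite -N_gt0; lra.
    by apply: contra nr => /eqP <-; lra.
  have H2 z : r <= N z <= r_ n -> N (h z) <= K by move=> hz; apply: hK; lra.
  by symmetry; apply: circle_mean_const H1 H2; lra.
move/(@cvg_lim C^o) => <- //.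
by rewrite lim_cst.
Qed.

Lemma circle_mean0 : circle_mean h 0 = (2 * pi)%:C%C * h 0.
Proof.
rewrite /circle_mean; under CI_eq do rewrite mul0r.
rewrite (CI_cst _ fmeas_I) meas_I; exact: mulrC.
Qed.

(** The exceptional circle is crossed by continuity: the mean on it is a limit of means from inside,
    and every larger circle descends to it from outside. *)
Lemma mean_value (r : R) : 0 < r < 1 -> circle_mean h r = (2 * pi)%:C%C * h 0.
Proof.
rewrite -circle_mean0 => /andP[r0 r1].
have below s : 0 < s -> s < rho -> s < 1 -> circle_mean h s = circle_mean h 0.
  by move=> *; apply: circle_mean_down => //; lra.
have at_rho : rho < 1 -> circle_mean h rho = circle_mean h 0.
  move: rho_ge0; rewrite le_eqVlt => /predU1P[<-//|p0] p1.
  have [q0 q1] : 0 < rho / 2 /\ rho / 2 < rho by split; lra.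
  rewrite -(below _ q0 q1 (lt_trans q1 p1)).
  by symmetry; apply: circle_mean_up => //; rewrite ltxx andbF.
have [rp|pr|E] := ltgtP r rho; [exact: below| |by move: at_rho; rewrite -E; exact].
rewrite -at_rho; last exact: lt_trans pr r1.
by apply: circle_mean_down => //; rewrite ltxx.
Qed.

(** A sequence rather than a continuous parameter, for dominated convergence; the shift by 2 keeps
    all radii strictly between 0 and 1. *)
Definition radius (n : nat) : R := 1 - n.+2%:R^-1.

Lemma radius_in n : 0 < radius n < 1.
Proof.
have : 0 < n.+2%:R^-1 :> R by rewrite invr_gt0.
have : n.+2%:R^-1 < 1 :> R by rewrite invf_lt1// ltr1n.
by rewrite /radius; move: (n.+2%:R^-1) => v; lra.
Qed.

Lemma mean_boundary (b : R -> C) : cbm b ->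
  {ae mu, forall t, I t -> h ((radius n)%:C%C * expi t) @[n --> \oo] --> b t} ->
  CI I b = (2 * pi)%:C%C * h 0.
Proof.
move=> hb H.
have : CI I (fun t => h ((radius n)%:C%C * expi t)) @[n --> \oo] --> CI I b.
  apply: (@CI_dct _ _ (fun n t => h ((radius n)%:C%C * expi t)) _ K) => //.
  - exact: fmeas_I.
  - by move=> n; apply: cbm_circle; have := radius_in n; lra.
  - by move=> n t _; apply: hK; have := radius_in n => ?; rewrite N_polar; lra.
have -> : (fun n => CI I (fun t => h ((radius n)%:C%C * expi t))) =
    (fun=> (2 * pi)%:C%C * h 0).
  by apply/funext => n; exact: (mean_value (radius_in n)).
move/(@cvg_lim C^o) => <- //.
by rewrite lim_cst.
Qed.
End OneFunction.
End MeanValue.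

(** * Boundary maps as Borel maps of the angle *)

Section BoundaryAngle.
Context {R : realType}.
Local Notation C := R[i].
Local Notation mu := (@lebesgue_measure R).
Local Notation I := (seg 0 (2 * pi) : set R).

(* A Borel determination of the argument in [0, 2 pi). *)
Definition angle (x y : R) : R :=
  if (-1 < x) && (x < 1) then (if 0 <= y then acos x else 2 * pi - acos x)
  else if x <= -1 then pi else 0.

Lemma angle_in x y : 0 <= angle x y < 2 * pi.
Proof.
have p0 := pi_gt0 R; rewrite /angle; case: ifPn => [/andP[h1 h2]|_].
  have a1 : -1 <= x <= 1 by lra.
  have a2 : -1 <= x < 1 by lra.
  have := acos_lepi a1; have := acos_gt0 a2.
  by case: ifP => _ *; lra.
by case: ifP => _; lra.
Qed.

Lemma expi_angle (x y : R) : x ^+ 2 + y ^+ 2 = 1 -> expi (angle x y) = (x +i* y)%C.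
Proof.
move=> h.
have s x2 : 1 - x ^+ 2 = x2 -> y ^+ 2 = x2 by lra.
rewrite /angle; case: ifPn => [/andP[h1 h2]|].
  have a1 : -1 <= x <= 1 by lra.
  have a2 : x \in `[-1, 1] by rewrite in_itv.
  have sq : Num.sqrt (1 - x ^+ 2) = `|y| by rewrite -(s _ erefl) sqrtr_sqr.
  case: ifPn => [y0|]; rewrite -?ltNge => *.
    by apply: complex_ext; rewrite /= ?acosK// sin_acos// sq ger0_norm.
  have -> : expi (2 * pi - acos x) = expi (- acos x) :> C.
    by rewrite addrC expi_2pi.
  rewrite -expi_conj; apply: complex_ext; rewrite /= ?acosK//.
  by rewrite sin_acos// sq ltr0_norm// opprK.
rewrite negb_and -!leNgt => hx.
have y0 : y = 0 by apply/eqP; rewrite -sqrf_eq0; nra.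
case: ifPn => [x1|x1]; apply: complex_ext => /=; rewrite ?cospi ?sinpi ?cos0 ?sin0 ?y0//.
  nra.
by rewrite -ltNge in x1; nra.
Qed.

Lemma measurable_angle (x y : R -> R) : measurable_fun [set: R] x ->
  measurable_fun [set: R] y -> measurable_fun [set: R] (fun t => angle (x t) (y t)).
Proof.
move=> mx my; rewrite /angle.
have mc K : measurable_fun [set: R] (fun=> K : R) by exact: measurable_cst.
(* [acos] is cut off to 0 outside the open interval on which its continuity gives measurability; the
   branch that calls it only sees values inside. *)
pose g (s : R) := if (-1 < s) && (s < 1) then acos s else 0.
have mlt : measurable_fun [set: R] (fun s : R => (-1 < s) && (s < 1)).
  by apply: measurable_and; apply: measurable_fun_ltr.
have mg : measurable_fun [set: R] g.
  apply: measurable_fun_if => //.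
  have -> : [set: R] `&` (fun s : R => (-1 < s) && (s < 1)) @^-1` [set true] = `]-1, 1[%classic.
    by rewrite setTI predeqE => s; rewrite /= in_itv.
  apply: open_continuous_measurable_fun; first exact: interval_open.
  move=> s /set_mem; rewrite /= in_itv => hs; exact: continuous_acos.
have mlt' : measurable_fun [set: R] (fun t : R => (-1 < x t) && (x t < 1)).
  exact: (measurableT_comp mlt mx).
have -> : (fun t => if (-1 < x t) && (x t < 1) then if 0 <= y t then acos (x t) else 2 * pi - acos (x t)
   else if x t <= -1 then pi else 0) =
   (fun t => if (-1 < x t) && (x t < 1) then if 0 <= y t then g (x t) else 2 * pi - g (x t)
   else if x t <= -1 then pi else 0).
  by apply/funext => t; rewrite /g; case: ifP.
apply: measurable_fun_ifT => //; apply: measurable_fun_ifT => //.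
- exact: measurable_fun_ler.
- exact: measurableT_comp.
- by apply: measurable_funB => //; exact: measurableT_comp.
- exact: measurable_fun_ler.
Qed.

Definition holo (f : C -> C) := forall z, N z < 1 -> exists d, cdiff f z d.
Definition ntlim (f : C -> C) (t : R) (w : C) := nontangential_limit f (expi t) w.
(** The map is total, Borel and has range in [0, 2 pi), only its link with f being almost
    everywhere: compositions and preimages then need no exceptional set of their own. *)
Definition boundary_angle (f : C -> C) (tau : R -> R) :=
  [/\ measurable_fun [set: R] tau, (forall t, 0 <= tau t < 2 * pi) &
    {ae mu, forall t, I t -> ntlim f t (expi (tau t))}].

(** On the radius |z - zeta| = 1 - |z|, so the radius lies in the Stolz region of aperture 2. *)
Lemma ntlim_radial f t w (r_ : nat -> R) : ntlim f t w -> (forall n, 0 <= r_ n < 1) ->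
  r_ n @[n --> \oo] --> (1 : R) -> f ((r_ n)%:C%C * expi t) @[n --> \oo] --> w.
Proof.
move=> H hr cr; have h2 : 1 < 2 :> R by rewrite ltr1n.
have {}H := H _ h2; apply/cvg_N => e e0.
move/cvg_N : H => /(_ _ e0).
rewrite /within /= => /nbhs_N[d d0 Hd].
move/cvgrPdist_lt : cr => /(_ _ d0); apply: filterS => n hn.
have [r0 r1] := andP (hr n).
have E : N ((r_ n)%:C%C * expi t - expi t) = 1 - r_ n.
  rewrite -[X in _ - X]mul1r -mulrBl NM N_expi mulr1 (_ : _ - 1 = (r_ n - 1)%:C%C).
    by rewrite N_real distrC ger0_norm// subr_ge0 ltW.
  by rewrite rmorphB.
have Ez : N ((r_ n)%:C%C * expi t) = r_ n by rewrite NM N_expi mulr1 N_real ger0_norm.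
apply: Hd.
  by rewrite E; move: hn; rewrite ger0_norm// subr_ge0 ltW.
split; first by rewrite /unit_disc /= normE Ez ltcR.
rewrite /= !normE E Ez.
rewrite (_ : 2%:C%C * (1 - (r_ n)%:C%C) = (2 * (1 - r_ n))%:C%C); last first.
  by rewrite rmorphM/= rmorphB.
by rewrite ltcR; lra.
Qed.

Lemma radius_cvg : radius n @[n --> \oo] --> (1 : R).
Proof.
rewrite -[X in _ --> X]subr0; apply: cvgB; [exact: cvg_cst|exact: harmonic2_cvg].
Qed.

Lemma inner_holo (f : C -> C) : inner_function f -> holo f.
Proof.
move=> [H _ _] z z1; exists (f^`()%classic z); apply: derivable_cdiff; apply: H.
by rewrite /unit_disc /= normE ltcR.
Qed.

Lemma inner_le1 (f : C -> C) : inner_function f -> forall z, N z < 1 -> N (f z) <= 1.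
Proof.
move=> [_ H _] z z1; rewrite -lecR -normE; apply: H.
by rewrite /unit_disc /= normE ltcR.
Qed.

Lemma holo_ccont (f : C -> C) : holo f -> forall z, N z < 1 -> ccont f z.
Proof. by move=> H z /H[d]; exact: cdiff_ccont. Qed.

(** The upper limits of the real and imaginary parts along the radii are Borel everywhere and agree
    almost everywhere with the non-tangential limit; [angle] turns them into a total map. *)
Lemma inner_boundary_angle (f : C -> C) : inner_function f -> exists tau, boundary_angle f tau.
Proof.
move=> hf; have hh := inner_holo hf; have h1 := inner_le1 hf.
have hc := holo_ccont hh.
pose w n t := f ((radius n)%:C%C * expi t).
have r0 n : 0 <= (radius n : R) < 1 by have := @radius_in R n; lra.
have cw n : cbm (w n) by exact: (cbm_circle hc h1 (r0 n)).
have Nw n t : N (w n t) <= 1.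
  by apply: h1; have /andP[? ?] := r0 n; rewrite N_polar.
pose x t := limn_sup (fun n => Re (w n t)).
pose y t := limn_sup (fun n => Im (w n t)).
have mx : measurable_fun [set: R] x.
  apply: (@measurable_fun_limn_sup _ _ _ _ (fun n t => Re (w n t))).
  - move=> t _; exists 1 => _ [n _ <-].
    by apply: le_trans (ler_norm _) _; apply: le_trans (N_Re _) _.
  - move=> t _; exists (-1) => _ [n _ <-].
    by have := le_trans (N_Re _) (Nw n t); rewrite ler_norml => /andP[].
  by move=> n; have [[]] := cw n.
have my : measurable_fun [set: R] y.
  apply: (@measurable_fun_limn_sup _ _ _ _ (fun n t => Im (w n t))).
  - move=> t _; exists 1 => _ [n _ <-].
    by apply: le_trans (ler_norm _) _; apply: le_trans (N_Im _) _.
  - move=> t _; exists (-1) => _ [n _ <-].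
    by have := le_trans (N_Im _) (Nw n t); rewrite ler_norml => /andP[].
  by move=> n; have [_ []] := cw n.
exists (fun t => angle (x t) (y t)); split.
- exact: measurable_angle.
- by move=> t; exact: angle_in.
case: hf => _ _; apply: aeS => t H /segE /H[v [hv v1]].
have /cvg_ReIm[cr ci] := ntlim_radial hv r0 radius_cvg.
have xE : x t = Re v.
  exact: (cvg_limn_inf_sup cr).2.
have yE : y t = Im v.
  exact: (cvg_limn_inf_sup ci).2.
rewrite xE yE expi_angle.
  by case: v hv {v1 cr ci xE yE}.
have Nv : N v = 1.
  by move: v1; rewrite /unit_circle /= normE => /(congr1 (@complex.Re R)).
by rewrite -N_sqr Nv expr1n.
Qed.
End BoundaryAngle.

(** * The Poisson formula for bounded functions with radial boundary values *)

Section Poisson.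
Context {R : realType}.
Local Notation C := R[i].
Local Notation mu := (@lebesgue_measure R).
Local Notation I := (seg 0 (2 * pi) : set R).

(** A limit along one sequence of radii is all that dominated convergence needs, and it passes
    through products and continuous maps. *)
Definition rlim (h : C -> C) (t : R) (v : C) :=
  h ((radius n)%:C%C * expi t) @[n --> \oo] --> v.

Lemma rlimM h g t v w : rlim h t v -> rlim g t w -> rlim (fun z => h z * g z) t (v * w).
Proof.
move=> /cvg_ReIm[h1 h2] /cvg_ReIm[g1 g2]; apply/cvg_ReIm; rewrite ReM ImM; split.
  under eq_fun do rewrite ReM; by apply: cvgB; apply: cvgM.
by under eq_fun do rewrite ImM; apply: cvgD; apply: cvgM.
Qed.
Lemma rlim_comp h (g : C -> C) t v : rlim h t v -> ccont g v -> rlim (g \o h) t (g v).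
Proof.
move=> /cvg_N H hg; apply/cvg_N => e /hg[d d0 Hd].
by apply: filterS (H _ d0) => n; exact: Hd.
Qed.
Lemma rlim_id t : rlim id t (expi t).
Proof.
apply/cvg_N => e e0; have /cvgrPdist_lt/(_ _ e0) := @radius_cvg R.
apply: filterS => n hn; rewrite -[X in _ - X]mul1r -mulrBl NM N_expi mulr1.
move: (radius n) hn => r hn; have -> : r%:C%C - 1 = (r - 1)%:C%C by rewrite rmorphB.
by rewrite N_real distrC.
Qed.
Lemma rlim_cont (g : C -> C) t : ccont g (expi t) -> rlim g t (g (expi t)).
Proof. by move=> hg; exact: (rlim_comp (@rlim_id t) hg). Qed.

Lemma cbm_cont (g : C -> C) K : (forall t, ccont g (expi t)) ->
  (forall t, N (g (expi t)) <= K) -> cbm (fun t => g (expi t)).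
Proof.
move=> hg hK; apply: (@pcont_cbm _ _ K) => //; apply: (@pcont_comp _ g expi) => //.
by move=> t e e0; exists e => // s; apply: le_lt_trans; exact: N_expiB.
Qed.

Lemma ccont_local (f g : C -> C) z : ccont f z -> (exists2 d, 0 < d & forall w, N (w - z) < d -> f w = g w) ->
  ccont g z.
Proof.
move=> hf [d d0 H] e /hf[d' d'0 Hd]; exists (Num.min d d'); first by rewrite lt_min d0.
move=> w; rewrite lt_min => /andP[/H <- /Hd]; have := H z.
by rewrite subrr N0 => /(_ d0) ->.
Qed.
Lemma cdiff_local (f g : C -> C) z l : cdiff f z l -> (exists2 d, 0 < d & forall w, N (w - z) < d -> f w = g w) ->
  cdiff g z l.
Proof.
move=> hf [d d0 H] e /hf[d' d'0 Hd]; exists (Num.min d d'); first by rewrite lt_min d0.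
move=> w; rewrite lt_min => /andP[/H <- /Hd]; have := H z.
by rewrite subrr N0 => /(_ d0) ->.
Qed.

Lemma cdiffN (f : C -> C) z d : cdiff f z d -> cdiff (fun w => - f w) z (- d).
Proof.
move=> H e /H[del del0 Hd]; exists del => // w /Hd.
by rewrite -NN; congr (N _ <= _); ring.
Qed.

Lemma conjD (z w : C) : ((z + w)^*)%C = ((z^*)%C + (w^*)%C).
Proof. exact: rmorphD. Qed.
Lemma conjN (z : C) : ((- z)^*)%C = - (z^*)%C.
Proof. exact: rmorphN. Qed.
Lemma conjM (z w : C) : ((z * w)^*)%C = ((z^*)%C * (w^*)%C).
Proof. exact: rmorphM. Qed.

Section Kernels.
Variable z : C.
Hypothesis z1 : N z < 1.

(* The kernels of Cauchy and Poisson at the point z of the disc. *)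
Definition ck (w : C) := (1 - (z^*)%C * w)^-1.
Definition pk (t : R) : R := (1 - N z ^+ 2) / N (expi t - z) ^+ 2.

Lemma ck_den w : N w <= 1 -> 1 - N z <= N (1 - (z^*)%C * w).
Proof.
move=> w1; have := N_subge 1 ((z^*)%C * w); rewrite N1 NM N_conj.
by have := N_ge0 z; have := N_ge0 w; nra.
Qed.
Lemma ck_den_neq0 w : N w <= 1 -> 1 - (z^*)%C * w != 0.
Proof.
by move=> /ck_den h; rewrite -N_gt0; apply: lt_le_trans h; rewrite subr_gt0.
Qed.
Lemma N_ck w : N w <= 1 -> N (ck w) <= (1 - N z)^-1.
Proof.
move=> w1; rewrite NV lef_pV2 ?posrE ?ck_den ?subr_gt0//.
by rewrite N_gt0 ck_den_neq0.
Qed.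
Lemma cdiff_ck w : N w <= 1 -> exists d, cdiff ck w d.
Proof.
move=> w1; eexists; apply: cdiffV; last exact: ck_den_neq0.
apply: cdiffD; first exact: cdiff_cst.
by apply: cdiffN; apply: cdiffM; [exact: cdiff_cst|exact: cdiff_id].
Qed.
Lemma ck0 : ck 0 = 1. Proof. by rewrite /ck mulr0 subr0 invr1. Qed.

Lemma pole_den t : 1 - N z <= N (expi t - z).
Proof. by have := N_subge (expi t) z; rewrite N_expi. Qed.
Lemma pole_neq0 t : expi t - z != 0.
Proof. by rewrite -N_gt0; apply: lt_le_trans (pole_den t); rewrite subr_gt0. Qed.

Lemma conj_ck t : ((ck (expi t))^*)%C = expi t / (expi t - z).
Proof.
rewrite /ck conjc_inv conjD conjN conjM conjcK conjc1 -expiV.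
by field; rewrite expi_neq0 pole_neq0.
Qed.
(** On the circle the kernel is the sum of a function holomorphic in the disc that vanishes at 0 and
    of a term with a simple pole at z. Against boundary values of h, the first integrates to 0 and
    the second gives h(z). *)
Lemma pkE t : (pk t)%:C%C = (ck (expi t) - 1) + expi t / (expi t - z).
Proof.
rewrite /pk rmorphM/= fmorphV/= -mul_conj (rmorphB (real_complex R)) /= -mul_conj.
have E : ((expi t - z)^*)%C = (expi t)^-1 * (1 - (z^*)%C * expi t).
  by rewrite conjD conjN -expiV mulrBr mulr1 mulrCA mulVf ?mulr1// expi_neq0.
rewrite E /ck; have := ck_den_neq0 (_ : N (expi t) <= 1); rewrite N_expi => /(_ (lexx _)) h.
field; by rewrite expi_neq0 pole_neq0 h.
Qed.
Lemma pk_ge0 t : 0 <= pk t.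
Proof.
by rewrite /pk divr_ge0 ?exprn_ge0 ?N_ge0// subr_ge0 expr_le1 ?N_ge0// ltW.
Qed.
Lemma cbm_ck : cbm (fun t => ck (expi t)).
Proof.
apply: (@cbm_cont _ (1 - N z)^-1) => t; last by apply: N_ck; rewrite N_expi.
by have [|d] := @cdiff_ck (expi t); [rewrite N_expi|exact: cdiff_ccont].
Qed.
Lemma cbm_pole : cbm (fun t => expi t / (expi t - z)).
Proof. by have := cbm_conj cbm_ck; congr cbm; apply/funext => t; rewrite conj_ck. Qed.
Lemma bm_pk : bm pk.
Proof.
have [+ _] := cbmD (cbmB cbm_ck (cbm_cst 1)) cbm_pole; congr bm.
by apply/funext => t; rewrite -pkE.
Qed.

Lemma CI_ck : CI I (fun t => ck (expi t)) = (2 * pi)%:C%C.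
Proof.
rewrite (@mean_boundary _ ck 0 (1 - N z)^-1) ?ck0 ?mulr1//.
- by move=> w w1; have [|d] := @cdiff_ck w; [exact: ltW|exact: cdiff_ccont].
- by move=> w w1 _ _; apply: cdiff_ck; exact: ltW.
- by move=> w w1; apply: N_ck; exact: ltW.
- exact: cbm_ck.
apply: ae_all => t _; apply: rlim_cont.
by have [|d] := @cdiff_ck (expi t); [rewrite N_expi|exact: cdiff_ccont].
Qed.
Lemma CI_pole : CI I (fun t => expi t / (expi t - z)) = (2 * pi)%:C%C.
Proof.
under CI_eq do rewrite -conj_ck.
by rewrite CI_conj ?CI_ck ?conjc_real//; [exact: fmeas_I|exact: cbm_ck].
Qed.
Lemma RI_pk : RI I pk = 2 * pi.
Proof.
have : CI I (fun t => (pk t)%:C%C) = (2 * pi)%:C%C.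
  under CI_eq do rewrite pkE.
  have c1 := @cbm_cst R 1; have cB := cbmB cbm_ck c1.
  rewrite (CI_D fmeas_I cB cbm_pole) (CI_B fmeas_I cbm_ck c1) CI_ck CI_pole.
  by rewrite (CI_cst _ fmeas_I) meas_I mul1r subrr add0r.
by rewrite CI_real; [move=> []|exact: fmeas_I].
Qed.
End Kernels.

(* The origin is exempted in order to cover f(z) / z. *)
Definition gholo (K : R) (h : C -> C) :=
  [/\ (forall z, N z < 1 -> ccont h z),
      (forall z, N z < 1 -> z != 0 -> exists d, cdiff h z d) &
      (forall z, N z < 1 -> N (h z) <= K)].
Definition radial (h : C -> C) (b : R -> C) :=
  cbm b /\ {ae mu, forall t, I t -> rlim h t (b t)}.

Lemma mean_radial K h b : gholo K h -> radial h b -> CI I b = (2 * pi)%:C%C * h 0.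
Proof.
move=> [h1 h2 h3] [b1 b2]; apply: (@mean_boundary _ h 0 K) => // z z1 z0 _.
exact: h2.
Qed.

Lemma gholoM K L h g : gholo K h -> gholo L g -> gholo (K * L) (fun z => h z * g z).
Proof.
move=> [h1 h2 h3] [g1 g2 g3]; split.
- by move=> z z1; apply: ccontM; [exact: h1|exact: g1].
- move=> z z1 z0; have [d hd] := h2 z z1 z0; have [d' hd'] := g2 z z1 z0.
  by eexists; apply: cdiffM; eassumption.
- by move=> z z1; rewrite NM ler_pM ?N_ge0 ?h3 ?g3.
Qed.
Lemma radialM h g b c : radial h b -> radial g c ->
  radial (fun z => h z * g z) (fun t => b t * c t).
Proof.
move=> [b1 b2] [c1 c2]; split; first exact: cbmM.
apply: aeS2 b2 c2 => t H1 H2 It; apply: rlimM; [exact: H1|exact: H2].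
Qed.

(* The mean value property of w (h w - h z) / (w - z). *)
Lemma poisson_formula K h b z : gholo K h -> radial h b -> N z < 1 ->
  CI I (fun t => b t * (pk z t)%:C%C) = (2 * pi)%:C%C * h z.
Proof.
move=> gh rb z1; have [cb rb2] := rb; have [hc hd hK] := gh.
have K0 : 0 <= K by apply: le_trans (N_ge0 _) (hK 0 _); rewrite N0.
(* At the origin [gholo] gives no derivative, but the kernel is 1 there and the claim is the mean
   value property. *)
have [->|z0] := eqVneq z 0.
  rewrite -(mean_radial gh rb); apply: CI_eq => t _.
  by rewrite /pk subr0 N_expi N0 expr0n/= subr0 expr1n divr1 mulr1.
have [d hdz] := hd z z1 z0.
pose phi w := if w == z then d else (h w - h z) / (w - z).
have phiE w : w != z -> exists2 e, 0 < e & forall u, N (u - w) < e ->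
    (h u - h z) / (u - z) = phi u.
  move=> wz; exists (N (w - z)); first by rewrite N_gt0 subr_eq0.
  move=> u hu; rewrite /phi; case: eqP => // uz.
  by move: hu; rewrite uz NB ltxx.
have diffphi w : N w < 1 -> w != 0 -> w != z -> exists l, cdiff phi w l.
  move=> w1 w0 wz; have [l hl] := hd w w1 w0.
  eexists; apply: cdiff_local (phiE w wz).
  apply: cdiffM.
    by apply: cdiffD; [exact: hl|exact: cdiff_cst].
  apply: cdiffV; last by rewrite subr_eq0.
  by apply: cdiffD; [exact: cdiff_id|exact: cdiff_cst].
have contz : ccont phi z.
  move=> e e0; have e2 : 0 < e / 2 by rewrite divr_gt0.
  have [del del0 H] := hdz _ e2; exists del => // w /H.
  rewrite /phi eqxx; case: eqP => [->|/eqP wz]; first by rewrite (subrr d) N0.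
  have h0 : w - z != 0 by rewrite subr_eq0.
  rewrite (_ : (h w - h z) / (w - z) - d = (h w - h z - d * (w - z)) / (w - z)).
    by rewrite NM NV -ler_pdivrMr ?N_gt0// => /le_lt_trans; apply; lra.
  by rewrite [RHS]mulrBl mulfK.
have contphi w : N w < 1 -> ccont phi w.
  move=> w1; have [->//|wz] := eqVneq w z.
  apply: ccont_local (phiE w wz); apply: ccontM.
    by apply: ccontD; [exact: hc|exact: ccont_cst].
  apply: ccontV; last by rewrite subr_eq0.
  by apply: ccontD; [exact: ccont_id|exact: ccont_cst].
have [del del0 Hdel] := contz 1 ltr01.
have bphi w : N w < 1 -> N (phi w) <= (N d + 1) + (K + K) / del.
  move=> w1; have Nd := N_ge0 d; have Kd : 0 <= (K + K) / del.
    by rewrite divr_ge0 ?addr_ge0// ltW.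
  have [/Hdel|wdel] := ltP (N (w - z)) del.
    have := N_subge (phi w) (phi z); rewrite {2}/phi eqxx => H1 H2.
    have {1}-> : d = phi z by rewrite /phi eqxx.
    by have := N_subge (phi w) (phi z); lra.
  have wz : w != z by rewrite -subr_eq0 -N_gt0; lra.
  rewrite /phi (negbTE wz) NM NV.
  have : N (h w - h z) / N (w - z) <= (K + K) / del.
    rewrite ler_pM ?N_ge0 ?invr_ge0 ?N_ge0//.
      by apply: le_trans (ND _ _) _; rewrite NN lerD ?hK.
    by rewrite lef_pV2 ?posrE//; lra.
  by lra.
pose b1 t := (b t - h z) * (expi t / (expi t - z)).
have cb1 : cbm b1.
  by apply: cbmM; [apply: cbmB => //; exact: cbm_cst|exact: cbm_pole].
have E1 : CI I b1 = 0.
  transitivity ((2 * pi)%:C%C * (0 * phi 0)); last by rewrite mul0r mulr0.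
  apply: (@mean_boundary _ (fun w => w * phi w) (N z) (1 * ((N d + 1) + (K + K) / del))).
  - by move=> w w1; apply: ccontM; [exact: ccont_id|exact: contphi].
  - move=> w w1 w0 wz; have wz' : w != z by apply: contra wz => /eqP ->.
    have [l hl] := diffphi w w1 w0 wz'.
    by eexists; exact: (cdiffM (cdiff_id w) hl).
  - by move=> w w1; rewrite NM ler_pM ?N_ge0 ?bphi// ltW.
  - exact: N_ge0.
  - exact: cb1.
  apply: aeS rb2 => t H It; rewrite /b1 mulrCA.
  apply: (@rlimM id phi); first exact: rlim_id.
  apply/cvg_N => e e0.
  have : rlim (fun w => (h w + - h z) * (w - z)^-1) t ((b t - h z) / (expi t - z)).
    apply: rlimM.
      apply: (@rlim_comp h (fun u => u + - h z)); first exact: H.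
      by apply: ccontD; [exact: ccont_id|exact: ccont_cst].
    apply: (@rlim_cont (fun w => (w - z)^-1)); apply: ccontV; last exact: pole_neq0.
    by apply: ccontD; [exact: ccont_id|exact: ccont_cst].
  move=> /cvg_N/(_ _ e0).
  have : rlim id t (expi t) by exact: rlim_id.
  have pz : 0 < N (expi t - z) by rewrite N_gt0 pole_neq0.
  move=> /cvg_N/(_ _ pz); apply: filterS2 => n hn.
  rewrite /phi; case: eqP => // E; move: hn; rewrite E NB ltxx//.
have ghck : gholo ((1 - N z)^-1 + 1) (fun w => ck z w - 1).
  split=> w w1; have wle : N w <= 1 by exact: ltW.
  - have [l /cdiff_ccont hl] := cdiff_ck z1 wle.
    by apply: ccontD => //; exact: ccont_cst.
  - move=> _; have [l hl] := cdiff_ck z1 wle.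
    by eexists; apply: cdiffD; [exact: hl|exact: cdiff_cst].
  - by apply: le_trans (ND _ _) _; rewrite NN N1 lerD2r; exact: N_ck.
have rck : radial (fun w => ck z w - 1) (fun t => ck z (expi t) - 1).
  split; first by apply: cbmB; [exact: cbm_ck|exact: cbm_cst].
  apply: ae_all => t _; apply: (@rlim_cont (fun w => ck z w - 1)).
  apply: ccontD; last exact: ccont_cst.
  by have [|l] := @cdiff_ck z z1 (expi t); [rewrite N_expi|exact: cdiff_ccont].
have E2 : CI I (fun t => b t * (ck z (expi t) - 1)) = 0.
  by rewrite (mean_radial (gholoM gh ghck) (radialM rb rck)) ck0 subrr !mulr0.
have -> : (fun t => b t * (pk z t)%:C%C) =
   (fun t => b t * (ck z (expi t) - 1) + (b1 t + h z * (expi t / (expi t - z)))).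
  by apply/funext => t; rewrite pkE// /b1; ring.
have fI := @fmeas_I R.
have cp := cbm_pole z1.
have chp : cbm (fun t => h z * (expi t / (expi t - z))) by apply: cbmM => //; exact: cbm_cst.
have cbk : cbm (fun t => b t * (ck z (expi t) - 1)) by apply: cbmM => //; exact: rck.1.
have cs : cbm (fun t => b1 t + h z * (expi t / (expi t - z))) by exact: cbmD.
rewrite CI_D// CI_D// E1 E2 CI_Z// CI_pole// !add0r.
exact: mulrC.
Qed.
End Poisson.

(** * Fatou's theorem at Lebesgue points, in Stolz regions *)

Section Fatou.
Context {R : realType}.
Local Notation C := R[i].
Local Notation mu := (@lebesgue_measure R).
Local Notation I := (seg 0 (2 * pi) : set R).

Lemma N_CI_le D (f : R -> C) (k : R -> R) : fmeas D -> cbm f -> bm k ->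
  (forall t, D t -> N (f t) <= k t) -> N (CI D f) <= RI D k.
Proof.
move=> hD hf hk H; pose v := CI D f; pose u := if v == 0 then 1 else (v^*)%C / (N v)%:C%C.
have [uv Nu] : u * v = (N v)%:C%C /\ N u = 1.
  rewrite /u; case: eqP => [->|/eqP v0]; first by rewrite mulr0 N0 N1.
  have n0 : N v != 0 by rewrite N_eq0.
  have n0' : (N v)%:C%C != 0 by rewrite -N_eq0 N_real normr_eq0.
  split; last by rewrite NM NV N_conj N_real ger0_norm ?N_ge0// mulfV.
  by rewrite mulrAC (mulrC _ v) mul_conj expr2 rmorphM/= mulfK.
have -> : N (CI D f) = Re (CI D (fun t => u * f t)) by rewrite CI_Z// uv.
have [w1 w2] : cbm (fun t => u * f t) by apply: cbmM => //; exact: cbm_cst.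
rewrite /CI/=; apply: RI_le => // t Dt.
apply: (le_trans (ler_norm _)); apply: (le_trans (N_Re _)).
by rewrite NM Nu mul1r H.
Qed.

Lemma RI_seg a b c (g : R -> R) : a <= b -> b <= c -> bm g ->
  RI (seg a c) g = RI (seg a b) g + RI (seg b c) g.
Proof.
move=> ab bc hg; have [E dj] := seg_split ab bc.
rewrite E RI_U//; [by rewrite -E; exact: fmeas_seg|exact: (fmeas_seg a b).1|].
exact: (fmeas_seg b c).1.
Qed.

Lemma N_expiB_sin (s t : R) : N (expi s - expi t) = 2 * `|sin ((s - t) / 2)|.
Proof.
rewrite N_def (_ : 2 * `|_| = `|2 * sin ((s - t) / 2)|); last first.
  by rewrite normrM (ger0_norm (ler0n _ 2)).
rewrite -sqrtr_sqr; congr Num.sqrt.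
rewrite /=; have {1 2}-> : s = t + ((s - t) / 2 + (s - t) / 2) by lra.
set d := (s - t) / 2.
rewrite cosD sinD (cosD d) (sinD d).
have ht := cos2Dsin2 t; have hd := cos2Dsin2 d.
transitivity ((cos t ^+ 2 + sin t ^+ 2) *
   ((cos d ^+ 2 - sin d ^+ 2 - 1) ^+ 2 + 4 * sin d ^+ 2 * cos d ^+ 2)); first ring.
have -> : cos d ^+ 2 = 1 - sin d ^+ 2 by lra.
rewrite -/d ht; ring.
Qed.

(** From cos x = 1 - 2 sin^2 (x / 2) and |sin (x / 2)| <= 1 / 2. It serves to compare chords with
    arcs, and again for pairs of points in one of the eight arcs. *)
Lemma cos_ge_half (x : R) : `|x| <= 1 -> 2^-1 <= cos x.
Proof.
move=> x1; have -> : x = x / 2 + x / 2 by lra.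
rewrite cosD -!expr2; have := cos2Dsin2 (x / 2).
have := le_sin_id (x / 2); set s := sin _ => h1 h2.
have : `|x / 2| <= 1 / 2 by rewrite normrM (ger0_norm (_ : 0 <= 2^-1)) ?invr_ge0//; lra.
move/(le_trans h1); rewrite ler_norml => /andP[h3 h4].
by nra.
Qed.

Lemma sin_ge_half (x : R) : `|x| <= 1 -> `|x| / 2 <= `|sin x|.
Proof.
wlog x0 : x / 0 <= x => [H|].
  have [/H//|/ltW x0] := leP 0 x.
  by rewrite -normrN -(normrN (sin x)) -sinN; apply: H; rewrite oppr_ge0.
rewrite ger0_norm// => x1.
have dsin (y : R) : is_derive y 1 (sin : R -> R) (cos y) by exact: is_derive_sin.
have [|c cx] := @MVT_segment R sin cos 0 x x0.
  by apply: continuous_subspaceT => y; exact: continuous_sin.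
rewrite sin0 !subr0 => ->.
have : 2^-1 <= cos c.
  by apply: cos_ge_half; move: cx; rewrite in_itv/= => ?; rewrite ger0_norm; lra.
by move=> h; rewrite ger0_norm; nra.
Qed.

Lemma chord_ge (s t : R) : `|s - t| <= 2 -> `|s - t| / 2 <= N (expi s - expi t).
Proof.
move=> h; rewrite N_expiB_sin.
have e : `|(s - t) / 2| = `|s - t| / 2 by rewrite normrM (ger0_norm (_ : 0 <= 2^-1)) ?invr_ge0.
by have := @sin_ge_half ((s - t) / 2); rewrite e; lra.
Qed.

(** As t0 is interior, |t - t0| / 2 stays in a compact subinterval of ]0, pi[, where sin has a
    positive minimum. At t0 = 0 this would fail for t close to 2 pi. *)
Lemma chord_far (t0 eta : R) : 0 < t0 < 2 * pi -> 0 < eta -> eta < 2 ->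
  exists2 m, 0 < m & forall t, I t -> eta <= `|t - t0| -> m <= N (expi t - expi t0).
Proof.
move=> ht0 eta0 eta2; have p0 := pi_gt0 R; have p2 := pi_ge2 R.
pose c' := Num.min t0 (2 * pi - t0) / 2.
have c0 : 0 < c' by rewrite /c' divr_gt0// lt_min; lra.
have c1 : c' <= t0 / 2 by rewrite /c' ler_pM2r ?invr_gt0// ge_min lexx.
have c2 : c' <= (2 * pi - t0) / 2 by rewrite /c' ler_pM2r ?invr_gt0// ge_min lexx orbT.
(* If this interval is empty, no t is at distance eta from t0 and any m is suitable. *)
have [far|near] := leP (eta / 2) (pi - c'); last first.
  exists 1 => // t /segE ht; have : `|t - t0| / 2 <= pi - c'.
    by rewrite ler_pdivrMr// ler_norml; lra.
  by lra.
have [|x hx Hx] := @EVT_min R sin (eta / 2) (pi - c') far.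
  by apply: continuous_subspaceT => y; exact: continuous_sin.
exists (2 * sin x).
  by rewrite mulr_gt0// sin_gt0_pi//; move: hx; rewrite in_itv/=; lra.
move=> t /segE ht hn; rewrite N_expiB_sin ler_pM2l//.
have h : `|t - t0| / 2 <= pi - c'.
  by rewrite ler_pdivrMr// ler_norml; lra.
have -> : `|sin ((t - t0) / 2)| = `|sin (`|t - t0| / 2)|.
  by have [h1|h1] := ger0P (t - t0); rewrite // mulNr sinN normrN.
apply: le_trans (ler_norm _); apply: Hx; rewrite in_itv/=; lra.
Qed.

Lemma dyadic_scale (d e : R) : 0 < d -> d <= e -> exists k, 2 ^+ k * d <= e < 2 ^+ k.+1 * d.
Proof.
move=> d0 de.
have ex : exists n, e < 2 ^+ n * d.
  exists (Num.truncn (e / d)).+1.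
  rewrite -ltr_pdivrMr//; apply: lt_le_trans (truncnS_gt _) _.
  by rewrite -natrX ler_nat ltnW// ltn_expl.
have := ex_minnP ex; case=> -[|n]; first by rewrite expr0 mul1r => h _; move: (lt_le_trans h de); rewrite ltxx.
move=> h1 h2; exists n; rewrite h1 andbT leNgt; apply/negP => /h2.
by rewrite ltnn.
Qed.

Lemma symmetric_split (t0 p e c : R) : 0 < p -> p <= e -> e <= t0 -> e <= c - t0 ->
  [/\ 0 <= t0 - p, t0 - p <= c, t0 - p <= t0 + p & t0 + p <= c].
Proof. by split; lra. Qed.
Lemma left_far (t0 p e c t : R) : 0 < p -> p <= e -> e <= c - t0 ->
  0 <= t < t0 - p -> 0 <= t < c /\ p <= `|t - t0|.
Proof. by move=> *; split; [lra|rewrite ler0_norm; lra]. Qed.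
Lemma right_far (t0 p e c t : R) : 0 < p -> p <= e -> e <= t0 ->
  t0 + p <= t < c -> 0 <= t < c /\ p <= `|t - t0|.
Proof. by move=> *; split; [lra|rewrite ger0_norm; lra]. Qed.

Section LebesguePoint.
Variables (phi : R -> R) (K t0 M : R).
Hypotheses (bphi : bm phi) (phiK : forall t, `|phi t| <= K)
  (ht0 : 0 < t0 < 2 * pi) (M1 : 1 < M).
Hypothesis leb : forall e, 0 < e -> exists2 eta, 0 < eta &
  forall s, 0 < s <= eta -> RI (seg (t0 - s) (t0 + s)) (fun t => `|phi t - phi t0|) <= e * s.
Let g t := `|phi t - phi t0|.
Let bg : bm g. Proof. by apply: bm_norm; apply: bmB => //; exact: bm_cst. Qed.

Lemma pk_peak (z : C) t : N z < 1 -> pk z t <= 2 / (1 - N z).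
Proof.
move=> z1; have h := pole_den z t; have := N_ge0 z => n0.
rewrite /pk ler_pdivrMr ?exprn_gt0//; last lra.
have : (1 - N z) ^+ 2 <= N (expi t - z) ^+ 2 by rewrite ler_sqr ?nnegrE//; lra.
move=> h2; have : 2 / (1 - N z) * (1 - N z) ^+ 2 <= 2 / (1 - N z) * N (expi t - z) ^+ 2.
  by rewrite ler_wpM2l// divr_ge0//; lra.
have -> : 2 / (1 - N z) * (1 - N z) ^+ 2 = 2 * (1 - N z) by field; lra.
by nra.
Qed.
(** In the Stolz region, |z - expi t0| < M (1 - |z|) <= M |expi t - z|, so the chord from expi t0 to
    expi t is at most (1 + M) |expi t - z|: the kernel decays like the inverse square of the
    chord. *)
Lemma pk_tail (z : C) t : N z < 1 -> N (z - expi t0) < M * (1 - N z) ->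
  forall a, 0 < a -> a <= N (expi t - expi t0) ->
  pk z t <= 2 * (1 + M) ^+ 2 * (1 - N z) / a ^+ 2.
Proof.
move=> z1 hz a a0 ha; have n0 := N_ge0 z; have M1' := M1.
have h1 : N (expi t - expi t0) <= (1 + M) * N (expi t - z).
  apply: le_trans (N_tri z _ _) _.
  have : M * (1 - N z) <= M * N (expi t - z) by apply: ler_wpM2l; [lra|exact: pole_den].
  by lra.
have p1 : 0 < N (expi t - z) by have := pole_den z t; lra.
rewrite /pk ler_pdivrMr ?exprn_gt0//.
have h2 : a ^+ 2 <= (1 + M) ^+ 2 * N (expi t - z) ^+ 2.
  by rewrite -exprMn ler_sqr ?nnegrE//; nra.
have a2 : 0 < a ^+ 2 by rewrite exprn_gt0.
have -> : 2 * (1 + M) ^+ 2 * (1 - N z) / a ^+ 2 * N (expi t - z) ^+ 2 =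
  2 * (1 - N z) * ((1 + M) ^+ 2 * N (expi t - z) ^+ 2 / a ^+ 2) by field; lra.
have : 1 <= (1 + M) ^+ 2 * N (expi t - z) ^+ 2 / a ^+ 2 by rewrite ler_pdivlMr// mul1r.
by nra.
Qed.

(** Dyadic decomposition at scale d = 1 - |z|. The central interval contributes at most 2 e by
    [pk_peak]. At distance between q d and 2 q d the kernel is at most 8 (1 + M)^2 / (q^2 d), while
    |phi - phi(t0)| has integral at most 2 e q d, which gives 16 (1 + M)^2 e / q, a geometric series
    in q = 2^k; the constant 128 is generous. *)
Lemma near_integral (z : C) (e eta : R) k : N z < 1 -> N (z - expi t0) < M * (1 - N z) ->
  0 < e -> eta <= 2 ->
  (forall s, 0 < s <= eta -> RI (seg (t0 - s) (t0 + s)) g <= e * s) ->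
  2 ^+ k * (1 - N z) <= eta ->
  RI (seg (t0 - 2 ^+ k * (1 - N z)) (t0 + 2 ^+ k * (1 - N z))) (fun t => g t * pk z t) <=
   2 * e + 128 * (1 + M) ^+ 2 * e * (1 - (2 ^+ k)^-1).
Proof.
move=> z1 hz e0 eta2 H; have M1' := M1; set d := 1 - N z.
have d0 : 0 < d by rewrite /d; lra.
have bgp : bm (fun t => g t * pk z t) by apply: bmM => //; exact: bm_pk.
have g0 t : 0 <= g t by rewrite /g.
elim: k => [|k IH].
  rewrite expr0 mul1r invr1 subrr mulr0 addr0 => de.
  have := H d; rewrite d0 de => /(_ isT) h.
  have : RI (seg (t0 - d) (t0 + d)) (fun t => g t * pk z t) <=
     RI (seg (t0 - d) (t0 + d)) (fun t => 2 / d * g t).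
    apply: RI_le => //; [exact: fmeas_seg|by apply: bmM => //; exact: bm_cst|].
    by move=> t _; rewrite mulrC ler_wpM2r// pk_peak.
  rewrite RI_Z//; last exact: fmeas_seg.
  have : 2 / d * RI (seg (t0 - d) (t0 + d)) g <= 2 / d * (e * d).
    by rewrite ler_wpM2l// divr_ge0// ltW.
  have -> : 2 / d * (e * d) = 2 * e by field; lra.
  by lra.
rewrite (exprS 2 k); have : 0 < 2 ^+ k :> R by rewrite exprn_gt0.
move: IH; move: (2 ^+ k) => q IH q0 hq.
have qd : 0 < q * d by rewrite mulr_gt0.
have {IH}/(_ _) IH : q * d <= eta -> RI (seg (t0 - q * d) (t0 + q * d)) (fun t => g t * pk z t) <= _ := IH.
have {}IH := IH (ltac:(lra)).
have := H (2 * q * d); rewrite hq andbT => /(_ (ltac:(lra))) h.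
rewrite (@RI_seg _ (t0 - q * d))//; [|lra..].
rewrite (@RI_seg (t0 - q * d) (t0 + q * d))//; [|lra..].
rewrite (@RI_seg _ (t0 - q * d)) in h => //; [|lra..].
rewrite (@RI_seg (t0 - q * d) (t0 + q * d)) in h => //; [|lra..].
pose L := 8 * (1 + M) ^+ 2 * d / (q * d) ^+ 2.
have ann a b : (forall t, seg a b t -> q * d <= `|t - t0| <= 2) ->
   RI (seg a b) (fun t => g t * pk z t) <= L * RI (seg a b) g.
  move=> hab; rewrite -RI_Z//; last exact: fmeas_seg.
  apply: RI_le => //; [exact: fmeas_seg|by apply: bmM => //; exact: bm_cst|].
  move=> t /hab /andP[h1 h2]; rewrite mulrC ler_wpM2r//.
  apply: le_trans (@pk_tail z t z1 hz (q * d / 2) _ _) _.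
  - by rewrite divr_gt0.
  - by apply: le_trans (chord_ge h2); lra.
  rewrite /L -/d le_eqVlt; apply/orP; left; apply/eqP; field; lra.
have A1 := ann (t0 - 2 * q * d) (t0 - q * d).
have A2 := ann (t0 + q * d) (t0 + 2 * q * d).
have {}A1 := A1 (ltac:(by move=> t /segE ht; rewrite ler0_norm; lra)).
have {}A2 := A2 (ltac:(by move=> t /segE ht; rewrite ger0_norm; lra)).
have G0 : 0 <= RI (seg (t0 - q * d) (t0 + q * d)) g by apply: RI_ge0.
have L0 : 0 <= L.
  exact: divr_ge0 (mulr_ge0 (mulr_ge0 (ler0n _ _) (sqr_ge0 _)) (ltW d0)) (sqr_ge0 _).
have LE : L * (e * (2 * q * d)) = 16 * (1 + M) ^+ 2 * e / q.
  by rewrite /L; field; lra.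
have S1 : RI (seg (t0 - 2 * q * d) (t0 - q * d)) g + RI (seg (t0 + q * d) (t0 + 2 * q * d)) g <= e * (2 * q * d) by lra.
have S2 := ler_wpM2l L0 S1.
have qV : (2 * q)^-1 = q^-1 / 2 by field; lra.
have cV : 0 <= 16 * (1 + M) ^+ 2 * e / q.
  exact: divr_ge0 (mulr_ge0 (mulr_ge0 (ler0n _ _) (sqr_ge0 _)) (ltW e0)) (ltW q0).
rewrite qV; lra.
Qed.

(** The largest dyadic interval of radius q d <= eta is the subject of [near_integral]. Outside it
    |t - t0| >= q d > eta / 2, where [chord_far] and [pk_tail] make the kernel uniformly of order 1
    - |z|. *)
Lemma fatou_lebesgue_point e : 0 < e -> exists2 del, 0 < del &
  forall z, N z < 1 -> N (z - expi t0) < del -> N (z - expi t0) < M * (1 - N z) ->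
    `|RI I (fun t => phi t * pk z t) - 2 * pi * phi t0| <= e.
Proof.
move=> e0; have M1' := M1; have ht0' := ht0; have p0 := pi_gt0 R.
have sM : 0 < (1 + M) ^+ 2 by rewrite exprn_gt0//; lra.
(* Makes the near part at most e / 2. *)
pose e1 := e / (2 * (2 + 128 * (1 + M) ^+ 2)).
have e10 : 0 < e1 by rewrite /e1 divr_gt0//; lra.
have [eta0 eta00 H] := leb e10.
pose eta := Num.min (Num.min eta0 1) (Num.min t0 (2 * pi - t0)).
have eta_gt0 : 0 < eta by rewrite /eta !lt_min eta00/=; lra.
have eta1 : eta <= eta0 by rewrite /eta !ge_min lexx.
have eta2 : eta <= 1 by rewrite /eta !ge_min lexx !orbT.
have eta3 : eta <= t0 by rewrite /eta !ge_min lexx !orbT.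
have eta4 : eta <= 2 * pi - t0 by rewrite /eta !ge_min lexx !orbT.
have e2 : 0 < eta / 2 /\ eta / 2 < 2 by split; lra.
have [m m0 Hm] := chord_far ht0' e2.1 e2.2.
have K0 : 0 <= K by apply: le_trans (phiK 0).
(* The far part is at most A (1 - |z|), and 1 - |z| <= |z - expi t0| is made smaller than e / (2 (A
   + 1)). *)
pose A := (K + K) * (2 * (1 + M) ^+ 2 / m ^+ 2) * (2 * pi).
have A0 : 0 <= A.
  apply: mulr_ge0; last lra; apply: mulr_ge0 (addr_ge0 K0 K0) _.
  exact: divr_ge0 (mulr_ge0 (ler0n _ _) (sqr_ge0 _)) (sqr_ge0 _).
exists (Num.min eta (e / (2 * (A + 1)))).
  by rewrite lt_min eta_gt0 divr_gt0//; lra.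
move=> z z1; rewrite lt_min => /andP[hd1 hd2] hz.
set d := 1 - N z; have d0 : 0 < d by rewrite /d; lra.
have dle : d <= N (z - expi t0) by have := N_subge (expi t0) z; rewrite N_expi NB.
have fI := @fmeas_I R.
have bp := bm_pk z1.
have -> : 2 * pi * phi t0 = RI I (fun t => phi t0 * pk z t).
  by rewrite (RI_Z _ fI bp) RI_pk// mulrC.
have bpp : bm (fun t => phi t * pk z t) by apply: bmM.
have bcp : bm (fun t => phi t0 * pk z t) by apply: bmM => //; exact: bm_cst.
rewrite -(RI_B fI bpp bcp).
have bgp : bm (fun t => g t * pk z t) by apply: bmM.
apply: (@le_trans _ _ (RI I (fun t => g t * pk z t))).
  apply: le_trans (RI_abs fI (bmB bpp bcp)) _; apply: RI_le => //.
    by apply: bm_norm; exact: bmB.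
  by move=> t _; rewrite -mulrBl normrM (ger0_norm (pk_ge0 z1 t)).
have [k /andP[k1 k2]] : exists k, 2 ^+ k * d <= eta < 2 ^+ k.+1 * d.
  by apply: dyadic_scale => //; lra.
have H' s : 0 < s <= eta -> RI (seg (t0 - s) (t0 + s)) g <= e1 * s.
  by move=> hs; apply: H; lra.
have near := near_integral z1 hz e10 (ltac:(lra) : eta <= 2) H' k1.
rewrite -/d in near; move: k1 k2 near; rewrite exprS; have : 0 < 2 ^+ k :> R by rewrite exprn_gt0.
move: (2 ^+ k) => q q0 k1 k2.
have qd0 : 0 < q * d by rewrite mulr_gt0.
move=> near; pose T := (K + K) * (2 * (1 + M) ^+ 2 / m ^+ 2) * d.
move: near; have far a b : a <= b -> (forall t, seg a b t -> I t /\ q * d <= `|t - t0|) ->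
    RI (seg a b) (fun t => g t * pk z t) <= T * (b - a).
  move=> ab hab; rewrite -(meas_seg ab) -(RI_cst _ (fmeas_seg _ _)).
  apply: RI_le => //; [exact: fmeas_seg|exact: bm_cst|].
  move=> t /hab[It ht]; rewrite /T -mulrA; apply: ler_pM.
  - exact: normr_ge0.
  - exact: pk_ge0.
  - by apply: le_trans (ler_normB _ _) _; rewrite lerD.
  apply: le_trans (@pk_tail z t z1 hz m m0 _) _; first by apply: Hm => //; lra.
  by rewrite -/d mulrAC.
have [i1 i2 i3 i4] := symmetric_split qd0 k1 eta3 eta4.
rewrite (RI_seg i1 i2 bgp) (RI_seg i3 i4 bgp).
have F1 : RI (seg 0 (t0 - q * d)) (fun t => g t * pk z t) <= T * (t0 - q * d - 0).
  by apply: far => // t /segE; rewrite segE; exact: left_far qd0 k1 eta4.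
have F2 : RI (seg (t0 + q * d) (2 * pi)) (fun t => g t * pk z t) <= T * (2 * pi - (t0 + q * d)).
  by apply: far => // t /segE; rewrite segE; exact: right_far qd0 k1 eta3.
have T0 : 0 <= T.
  apply: mulr_ge0 (ltW d0); apply: mulr_ge0 (addr_ge0 K0 K0) _.
  exact: divr_ge0 (mulr_ge0 (ler0n _ _) (sqr_ge0 _)) (sqr_ge0 _).
have TA : T * (2 * pi) = A * d by rewrite /T /A; ring.
have Ad : A * d <= e / 2.
  have : d <= e / (2 * (A + 1)) by lra.
  have AA : 0 < 2 * (A + 1) by lra.
  by rewrite (ler_pdivlMr _ _ AA) => ?; nra.
have qV : 0 < q^-1 by rewrite invr_gt0.
have E1 : 2 * e1 + 128 * (1 + M) ^+ 2 * e1 = e / 2.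
  rewrite /e1; field; lra.
have : 0 <= 128 * (1 + M) ^+ 2 * e1 * q^-1.
  exact: mulr_ge0 (mulr_ge0 (mulr_ge0 (ler0n _ _) (sqr_ge0 _)) (ltW e10)) (ltW qV).
have Tq : 0 <= T * (q * d) := mulr_ge0 T0 (ltW qd0).
move: F1 F2; set X := RI _ _; set Y := RI _ _; set Z := RI _ _.
lra.
Qed.
End LebesguePoint.

Lemma lebesgue_pt_RI (phi : R -> R) t0 : bm phi -> lebesgue_pt phi t0 -> forall e, 0 < e ->
  exists2 eta, 0 < eta & forall s, 0 < s <= eta ->
    RI (seg (t0 - s) (t0 + s)) (fun t => `|phi t - phi t0|) <= e * s.
Proof.
move=> bphi H e e0.
(* An average less than e / 2 over an interval of length 2 s is an integral less than e s. *)
have e2 : 0 < e / 2 by rewrite divr_gt0.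
have bg : bm (fun t => `|phi t - phi t0|) by apply: bm_norm; apply: bmB => //; exact: bm_cst.
have av s : 0 < s -> davg phi t0 s = (RI (seg (t0 - s) (t0 + s)) (fun t => `|phi t - phi t0|) / (2 * s))%:E.
  move=> s0; rewrite /davg /iavg lebesgue_measure_ball ?(ltW s0)//.
  have s2 : 2 * s != 0 by rewrite mulf_neq0// gt_eqF.
  rewrite mulrC EFinM; congr (_ * _)%E.
    by rewrite -[s *+ 2]mulr_natl inver (negbTE s2).
  rewrite ball_itv /RI /Rintegral fineK; last first.
    by apply: integrable_fin_num; [exact: measurable_itv|exact: (bm_integrable (fmeas_seg _ _) bg)].
  rewrite /seg -(@integral_itv_bndoo _ _ _ _ true true)//.
  apply/measurable_EFinP; exact: measurable_funTS bg.1.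
move: H => /fine_cvgP[_ /cvgrPdist_lt/(_ _ e2)].
rewrite near_withinE => /nbhs_ballP[d /= d0 Hd].
exists (d / 2); first by rewrite divr_gt0.
move=> s /andP[s0 sd]; have := Hd s; rewrite /ball /= sub0r normrN gtr0_norm// => /(_ _ s0).
rewrite av//= sub0r normrN => /(_ (ltac:(lra))).
have I0 : 0 <= RI (seg (t0 - s) (t0 + s)) (fun t => `|phi t - phi t0|) by apply: RI_ge0.
rewrite ger0_norm ?divr_ge0 ?mulr_ge0 ?(ltW s0)//.
have s2 : 0 < 2 * s by lra.
by rewrite (ltr_pdivrMr _ _ s2) => ?; lra.
Qed.

Lemma bm_lebesgue_pt (phi : R -> R) : bm phi -> {ae mu, forall t, lebesgue_pt phi t}.
Proof.
move=> [mphi [K HK]]; apply: lebesgue_differentiation; split=> //; first exact: openT.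
move=> D _ cD; have [r _ Dr] : exists2 r : R, 0 < r & D `<=` seg (- r) r.
  have [M [_ HM]] := compact_bounded cD.
  exists (`|M| + 2) => [|x /(HM (`|M| + 1))]; first by rewrite ltr_wpDl.
  move=> /(_ _) h; apply/segE.
  have : `|x| <= `|M| + 1 by apply: h; apply: le_lt_trans (ler_norm M) _; rewrite ltrDl.
  by rewrite ler_norml; lra.
have mD : measurable D by apply: closed_measurable; apply: compact_closed => //; exact: norm_hausdorff.
have fD : fmeas D by apply: fmeasS mD Dr (fmeas_seg _ _).
have bphi : bm phi by split=> //; exists K.
by have /integrableP[_] := bm_integrable fD bphi.
Qed.
End Fatou.

(** * Weighted pushforwards are determined by their Poisson integrals *)

Section Uniqueness.
Context {R : realType}.
Local Notation C := R[i].
Local Notation mu := (@lebesgue_measure R).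
Local Notation I := (seg 0 (2 * pi) : set R).

Lemma fmeasI (D E : set R) : fmeas D -> measurable E -> fmeas (D `&` E).
Proof. by move=> hD mE; apply: (fmeasS _ (@subIsetl _ D E) hD); apply: measurableI => //; exact: hD.1. Qed.

Lemma EFin_RI D (f : R -> R) : fmeas D -> bm f ->
  (\int[mu]_(t in D) (f t)%:E)%E = (RI D f)%:E.
Proof.
move=> hD hf; rewrite /RI /Rintegral fineK//; apply: integrable_fin_num; first exact: hD.1.
exact: bm_integrable.
Qed.

(** Nonnegativity allows Tonelli's theorem on the whole plane, with D and E entering as indicator
    factors. *)
Lemma RI_fubini D E (h : R * R -> R) K : fmeas D -> fmeas E ->
  measurable_fun [set: R * R] h -> (forall p, 0 <= h p <= K) ->
  bm (fun x => RI E (fun y => h (x, y))) /\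
  RI D (fun x => RI E (fun y => h (x, y))) = RI E (fun y => RI D (fun x => h (x, y))).
Proof.
move=> hD hE mh hK.
have sx x : bm (fun y => h (x, y)).
  split; first by apply: measurableT_comp mh _; exact: measurable_pair1.
  by exists K => y; have /andP[? ?] := hK (x, y); rewrite ger0_norm.
have sy y : bm (fun x => h (x, y)).
  split; first by apply: measurableT_comp mh _; exact: measurable_pair2.
  by exists K => x; have /andP[? ?] := hK (x, y); rewrite ger0_norm.
have i0 (A : set R) x : 0 <= (\1_A x : R) by rewrite indicE.
have mi (A : set R) : measurable A -> measurable_fun [set: R] (\1_A : R -> R).
  by move=> mA; exact: measurable_indic.
have part1 (A B : set R) (g : R * R -> R) : fmeas A -> fmeas B -> measurable_fun [set: R * R] g ->
    (forall p, 0 <= g p <= K) -> (forall x, bm (fun y => g (x, y))) ->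
    measurable_fun [set: R] (fun x => RI B (fun y => g (x, y))).
  move=> hA hB mg gK sg; apply/measurable_EFinP.
  have -> : EFin \o (fun x => RI B (fun y => g (x, y))) =
     fubini_F mu (fun p => (g p * \1_B p.2)%:E).
    apply/funext => x; rewrite /fubini_F /= -EFin_RI// integral_mkcond.
    by apply: eq_integral => y _; rewrite patchE indicE; case: (y \in B); rewrite ?mulr1 ?mulr0.
  apply: measurable_fun_fubini_tonelli_F.
    apply/measurable_EFinP; apply: measurable_funM => //.
    by apply: measurableT_comp; [apply: mi; exact: hB.1|exact: measurable_snd].
  by move=> p; rewrite lee_fin mulr_ge0//; have /andP[] := gK p.
have mF := part1 D E h hD hE mh hK sx.
have bF : bm (fun x => RI E (fun y => h (x, y))).
  split=> //; exists (K * meas E) => x; apply: RI_bound => // y _.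
  by have /andP[? ?] := hK (x, y); rewrite ger0_norm.
have mG := part1 E D (fun p => h (p.2, p.1)) hE hD
  (measurableT_comp mh (@measurable_swap _ _ R R)) (fun p => hK _) sy.
have bG : bm (fun y => RI D (fun x => h (x, y))).
  split=> //; exists (K * meas D) => y; apply: RI_bound => // x _.
  by have /andP[? ?] := hK (x, y); rewrite ger0_norm.
split; first exact: bF.
suff : (\int[mu]_(x in D) (RI E (fun y => h (x, y)))%:E =
        \int[mu]_(y in E) (RI D (fun x => h (x, y)))%:E)%E.
  by rewrite (EFin_RI hD bF) (EFin_RI hE bG) => -[].
have swap : (\int[mu]_x \int[mu]_y (h (x, y) * \1_D x * \1_E y)%:E =
    \int[mu]_y \int[mu]_x (h (x, y) * \1_D x * \1_E y)%:E)%E.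
  apply: (@fubini_tonelli _ _ (measurableTypeR R) (measurableTypeR R) R
    lebesgue_measure lebesgue_measure (fun p : R * R => (h p * \1_D p.1 * \1_E p.2)%:E)).
    apply/measurable_EFinP; apply: measurable_funM; last first.
      by apply: measurableT_comp; [apply: mi; exact: hE.1|exact: measurable_snd].
    apply: measurable_funM => //.
    by apply: measurableT_comp; [apply: mi; exact: hD.1|exact: measurable_fst].
  by move=> p; rewrite lee_fin !mulr_ge0//; have /andP[] := hK p.
have e1 x : (\int[mu]_y (h (x, y) * \1_D x * \1_E y)%:E)%E = (\1_D x * RI E (fun y => h (x, y)))%:E.
  rewrite -(RI_Z _ hE (sx x)) -(EFin_RI hE (bmM (bm_cst _) (sx x))) [RHS]integral_mkcond.
  apply: eq_integral => y _; rewrite patchE !indicE.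
  by case: (x \in D); case: (y \in E); rewrite ?mulr1 ?mulr0 ?mul1r ?mul0r.
have e2 y : (\int[mu]_x (h (x, y) * \1_D x * \1_E y)%:E)%E = (\1_E y * RI D (fun x => h (x, y)))%:E.
  rewrite -(RI_Z _ hD (sy y)) -(EFin_RI hD (bmM (bm_cst _) (sy y))) [RHS]integral_mkcond.
  apply: eq_integral => x _; rewrite patchE !indicE.
  by case: (x \in D); case: (y \in E); rewrite ?mulr1 ?mulr0 ?mul1r ?mul0r.
rewrite integral_mkcond [RHS]integral_mkcond.
transitivity (\int[mu]_x \int[mu]_y (h (x, y) * \1_D x * \1_E y)%:E)%E.
  apply: eq_integral => x _; rewrite e1 patchE indicE.
  by case: (x \in D); rewrite ?mul1r ?mul0r.
rewrite swap; apply: eq_integral => y _; rewrite /= e2 patchE indicE.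
by case: (y \in E); rewrite ?mul1r ?mul0r.
Qed.

Lemma pk_shift (r y s : R) : pk (r%:C%C * expi y) s = pk r%:C%C (s - y).
Proof.
rewrite /pk NM N_expi mulr1; congr (_ / _ ^+ 2).
rewrite (_ : expi s - r%:C%C * expi y = expi y * (expi (s - y) - r%:C%C)).
  by rewrite NM N_expi mul1r.
by rewrite mulrBr -expiD (addrC y) subrK (mulrC (expi y)).
Qed.
Lemma pk_even (r t : R) : pk r%:C%C (- t) = pk r%:C%C t.
Proof.
rewrite /pk; congr (_ / _ ^+ 2); rewrite -[in RHS]N_conj conjD conjN expi_conj.
by rewrite conjc_real.
Qed.
Lemma pk_sym (r y s : R) : pk (r%:C%C * expi y) s = pk (r%:C%C * expi s) y.
Proof. by rewrite !pk_shift -pk_even opprB. Qed.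

Definition locally_cst (phi : R -> R) t0 :=
  exists2 eta, 0 < eta & forall t, `|t - t0| <= eta -> phi t = phi t0.

Lemma same_side (a s t : R) : `|t - s| < `|s - a| -> (a < t) = (a < s).
Proof.
have [h|h] := ltP a s.
  by rewrite (gtr0_norm (_ : 0 < s - a)) ?subr_gt0// ltr_norml => ?; apply/idP; lra.
rewrite (ler0_norm (_ : s - a <= 0)) ?subr_le0// ltr_norml => ?.
by apply/negbTE; rewrite -leNgt; lra.
Qed.

Lemma indic_itv_locally_cst (a b s : R) : s != a -> s != b -> locally_cst (\1_(`]a, b]%classic)) s.
Proof.
move=> sa sb; pose eta := Num.min `|s - a| `|s - b| / 2.
have ea : 0 < `|s - a| by rewrite normr_gt0 subr_eq0.
have eb : 0 < `|s - b| by rewrite normr_gt0 subr_eq0.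
have e0 : 0 < eta by rewrite /eta divr_gt0// lt_min ea.
have e1 : 2 * eta <= `|s - a| by rewrite /eta mulrCA divff ?mulr1// ge_min lexx.
have e2 : 2 * eta <= `|s - b| by rewrite /eta mulrCA divff ?mulr1// ge_min lexx orbT.
exists eta => // t ht; rewrite !indicE !mem_setE /= !in_itv/= !leNgt.
by rewrite (@same_side a s t) ?(@same_side b s t)//; lra.
Qed.

(** Where phi is locally constant the Lebesgue point condition holds trivially, so Fatou's estimate
    applies at every such t0 and not only at almost every one. This matters because it is evaluated
    at the random point [tau t]. *)
Lemma poisson_radial_cst (phi : R -> R) t0 : bm phi -> 0 < t0 < 2 * pi -> locally_cst phi t0 ->
  RI I (fun t => phi t * pk ((radius n)%:C%C * expi t0) t) @[n --> \oo] --> 2 * pi * phi t0.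
Proof.
move=> bphi ht0 [eta eta0 Heta]; have [mphi [K HK]] := bphi.
apply/cvgrPdist_le => e e0.
have leb e' : 0 < e' -> exists2 eta, 0 < eta & forall s, 0 < s <= eta ->
    RI (seg (t0 - s) (t0 + s)) (fun t => `|phi t - phi t0|) <= e' * s.
  move=> e'0; exists eta => // s /andP[s0 se].
  rewrite (@RI_eq _ _ _ (fun=> 0)) ?(RI_cst _ (fmeas_seg _ _)) ?mul0r ?mulr_ge0 ?ltW//.
  move=> t /segE ht; rewrite Heta ?subrr ?normr0// ler_norml; lra.
have h2 : 1 < 2 :> R by rewrite ltr1n.
have [del del0 Hdel] := fatou_lebesgue_point bphi HK ht0 h2 leb e0.
have /cvgrPdist_lt/(_ _ del0) := @radius_cvg R; apply: filterS => n hn.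
have := @radius_in R n; move: (radius n) hn => r hn hr.
have Nr : N (r%:C%C * expi t0) = r by rewrite N_polar//; lra.
have Ed : N (r%:C%C * expi t0 - expi t0) = 1 - r.
  rewrite -[X in _ - X]mul1r -mulrBl NM N_expi mulr1.
  have -> : r%:C%C - 1 = (r - 1)%:C%C :> C by rewrite rmorphB.
  by rewrite N_real distrC ger0_norm; lra.
rewrite distrC; apply: Hdel; rewrite ?Nr ?Ed; try lra.
by move: hn; rewrite ger0_norm; lra.
Qed.

Variables (tau w1 w2 : R -> R).
Hypotheses (mtau : measurable_fun [set: R] tau) (tauI : forall t, I (tau t))
  (bw1 : bm w1) (bw2 : bm w2) (w10 : forall t, 0 <= w1 t) (w20 : forall t, 0 <= w2 t)
  (kernel : forall z, N z < 1 ->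
     RI I (fun t => w1 t * pk z (tau t)) = RI I (fun t => w2 t * pk z t)).

(** Keeps [u t] almost surely away from the endpoints of an arc, where its indicator may fail to be
    locally constant, and from the angle 0, where [0, 2 pi) is cut. *)
Definition null_fibers (u : R -> R) := forall s, {ae mu, forall t, I t -> u t != s}.

Lemma smoothing_cvg (u w : R -> R) (E : set R) : measurable_fun [set: R] u -> (forall t, I (u t)) ->
  bm w -> null_fibers u -> measurable E ->
  (exists p q, forall s, 0 < s < 2 * pi -> s != p -> s != q -> locally_cst (\1_E) s) ->
  RI I (fun t => w t * RI (I `&` E) (fun y => pk ((radius n)%:C%C * expi y) (u t))) @[n --> \oo] -->
  RI I (fun t => w t * (2 * pi * \1_E (u t))).
Proof.
move=> mu' uI bw nf mE [p [q hpq]]; have [mw [K HK]] := bw.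
have fI := @fmeas_I R.
have K0 : 0 <= K by apply: le_trans (normr_ge0 _) (HK 0).
have bE : bm (\1_E : R -> R) by exact: bm_indic.
have r1 n s : N ((radius n)%:C%C * expi s) < 1 :> R.
  by have /andP[a b] := @radius_in R n; rewrite N_polar// ltW.
have E1 n s : RI (I `&` E) (fun y => pk ((radius n)%:C%C * expi y) s) =
    RI I (fun y => \1_E y * pk ((radius n)%:C%C * expi s) y).
  by rewrite RI_indic; apply: RI_eq => y _; rewrite pk_sym mulrC.
have bu n : bm (fun s => RI (I `&` E) (fun y => pk ((radius n)%:C%C * expi y) s)).
  have fIE : fmeas (I `&` E).
    exact: fmeasI.
  have := @RI_fubini I (I `&` E) (fun p => pk (radius n)%:C%C (p.1 - p.2)) (2 / (1 - radius n)) fI fIE.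
  case.
  - have bpk : bm (pk ((radius n)%:C%C : C)).
      by apply: bm_pk; have := r1 n 0; rewrite NM N_expi mulr1.
    apply: (measurableT_comp bpk.1); apply: measurable_funB; [exact: measurable_fst|exact: measurable_snd].
  - move=> [x y] /=; have h := r1 n 0; rewrite expi0 mulr1 in h.
    rewrite pk_ge0//=; apply: le_trans (pk_peak _ h) _.
    by rewrite N_real ger0_norm//; have /andP[/ltW] := @radius_in R n.
  move=> + _; congr bm; apply/funext => s; apply: RI_eq => y _.
  by rewrite pk_shift.
have bound n s : 0 <= RI (I `&` E) (fun y => pk ((radius n)%:C%C * expi y) s) <= 2 * pi.
  rewrite E1; have bp := bm_pk (r1 n s); apply/andP; split.
    by apply: RI_ge0 => t _; rewrite mulr_ge0 ?pk_ge0// indicE.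
  apply: (@le_trans _ _ (RI I (pk ((radius n)%:C%C * expi s)))); last by rewrite RI_pk.
  apply: (RI_le fI (bmM bE bp) bp).
  by move=> t _; rewrite ler_piMl ?pk_ge0// indicE; case: (_ \in _).
apply: (@RI_dct _ _ (fun n t => w t * RI (I `&` E) (fun y => pk ((radius n)%:C%C * expi y) (u t))) _ (K * (2 * pi))) => //.
- by move=> n; apply: bmM => //; exact: (bm_comp (bu n) mu').
- by apply: bmM => //; apply: bmM; [exact: bm_cst|exact: (bm_comp bE mu')].
- by move=> n t _; have /andP[b1 b2] := bound n (u t); rewrite normrM ler_pM// ger0_norm.
have := aeS2 (fun _ a b => conj a b) (nf 0) (aeS2 (fun _ a b => conj a b) (nf p) (nf q)).
apply: aeS => t [h0 [hp hq]] It; apply: cvgM; first exact: cvg_cst.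
under eq_fun do rewrite E1; apply: poisson_radial_cst => //.
  have /segE/andP[u0 u1] := uI t; rewrite u1 andbT lt_def u0 andbT; exact: h0.
apply: hpq; [|exact: hp|exact: hq].
have /segE/andP[u0 u1] := uI t; rewrite u1 andbT lt_def u0 andbT; exact: h0.
Qed.

Lemma smoothing_swap (u w : R -> R) (E : set R) r : measurable_fun [set: R] u ->
  bm w -> (forall t, 0 <= w t) -> measurable E -> 0 <= r < 1 ->
  RI I (fun t => w t * RI (I `&` E) (fun y => pk (r%:C%C * expi y) (u t))) =
  RI (I `&` E) (fun y => RI I (fun t => w t * pk (r%:C%C * expi y) (u t))).
Proof.
move=> mu' bw w0 mE /andP[r0 r1]; have [mw [K HK]] := bw.
have fI := @fmeas_I R.
have fIE : fmeas (I `&` E).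
  exact: fmeasI.
have Nr y : N (r%:C%C * expi y) < 1 by rewrite N_polar.
have Nr0 : N r%:C%C < 1 by rewrite N_real ger0_norm.
have [||_ H] := @RI_fubini I (I `&` E) (fun p => w p.1 * pk r%:C%C (u p.1 - p.2)) (K * (2 / (1 - r))) fI fIE.
- apply: measurable_funM; first by apply: (measurableT_comp mw); exact: measurable_fst.
  apply: (measurableT_comp (bm_pk Nr0).1); apply: measurable_funB; last exact: measurable_snd.
  by apply: (measurableT_comp mu'); exact: measurable_fst.
- move=> [x y] /=; rewrite mulr_ge0 ?pk_ge0//=; apply: ler_pM => //; first exact: pk_ge0.
    by apply: le_trans (ler_norm _) (HK _).
  by apply: le_trans (pk_peak _ Nr0) _; rewrite N_real ger0_norm.
have bsh t : bm (fun y => pk (r%:C%C * expi y) (u t)).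
  by have := bm_pk (Nr (u t)); congr bm; apply/funext => y; exact: pk_sym.
transitivity (RI I (fun x => RI (I `&` E) (fun y => w x * pk r%:C%C (u x - y)))).
  apply: RI_eq => t _; rewrite -(RI_Z _ fIE (bsh t)).
  by apply: RI_eq => y _; rewrite pk_shift.
rewrite H; apply: RI_eq => y _; apply: RI_eq => t _.
by rewrite pk_shift.
Qed.

(* The Poisson kernels determine the pushforward: by symmetry of the kernel and Fubini,
   integrating over z = r e^{iy}, y in E, replaces the indicator of E by its Poisson
   extension, which tends to it off the endpoints of E as r -> 1. *)
Lemma pushforward_unique : null_fibers tau -> null_fibers id ->
  forall B, measurable B -> RI I (fun t => w1 t * \1_B (tau t)) = RI I (fun t => w2 t * \1_B t).
Proof.
move=> nft nfi; have fI := @fmeas_I R.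
have twopi := @twopi_gt0 R.
have b1 (w u : R -> R) : bm w -> measurable_fun [set: R] u -> forall B, measurable B ->
    bm (fun t => w t * \1_B (u t)).
  by move=> bw mu' B mB; apply: bmM => //; exact: (bm_comp (bm_indic mB) mu').
have mid : measurable_fun [set: R] (id : R -> R) by exact: measurable_id.
pose P (B : set R) := RI I (fun t => w1 t * \1_B (tau t)) = RI I (fun t => w2 t * \1_B t).
have tot : RI I w1 = RI I w2.
  have z0 : N (0 : C) < 1 by rewrite N0.
  have p0 t : pk (0 : C) t = 1 by rewrite /pk subr0 N_expi N0 expr0n/= subr0 expr1n divr1.
  have := kernel z0; under RI_eq do rewrite p0 mulr1.
  by under [in X in _ = X -> _]RI_eq do rewrite p0 mulr1.
have PT : P [set: R].
  rewrite /P; under RI_eq do rewrite indicT mulr1.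
  by under [RHS]RI_eq do rewrite indicT mulr1.
have Pitv : (@ocitv R) `<=` P.
  move=> _ [[a b] _ <-] /=; set E := `]a, b]%classic.
  have mE : measurable E by exact: measurable_itv.
  have loc : exists p q : R, forall s : R, 0 < s < 2 * pi -> s != p -> s != q -> locally_cst (\1_E) s.
    by exists a, b => s _ sa sb; exact: indic_itv_locally_cst.
  have L1 := smoothing_cvg mtau tauI bw1 nft mE loc.
  have idI : RI I (fun t => w2 t * RI (I `&` E) (fun y => pk ((radius n)%:C%C * expi y) t)) @[n --> \oo] -->
     RI I (fun t => w2 t * (2 * pi * \1_E t)).
    (* The identity, made to take values in [0, 2 pi) everywhere as [smoothing_cvg] requires. *)
    pose u t := if (0 <= t) && (t < 2 * pi) then t else 0 : R.
    have uE t : I t -> u t = t by rewrite /u => /segE ->.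
    have mu' : measurable_fun [set: R] u.
      apply: measurable_fun_ifT => //; apply: measurable_and.
        exact: measurable_fun_ler.
      exact: measurable_fun_ltr.
    have uI t : I (u t).
      by apply/segE; rewrite /u; case: ifP => // _; rewrite lexx.
    have nfu : null_fibers u by move=> s; apply: aeS (nfi s) => t H It; rewrite uE//; exact: H.
    have Eu : (fun n => RI I (fun t => w2 t * RI (I `&` E) (fun y => pk ((radius n)%:C%C * expi y) t))) =
      (fun n => RI I (fun t => w2 t * RI (I `&` E) (fun y => pk ((radius n)%:C%C * expi y) (u t)))).
      by apply/funext => n; apply: RI_eq => t It; rewrite (uE t It).
    have -> : RI I (fun t => w2 t * (2 * pi * \1_E t)) = RI I (fun t => w2 t * (2 * pi * \1_E (u t))).
      by apply: RI_eq => t It; rewrite (uE t It).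
    by rewrite Eu; exact: smoothing_cvg.
  have EQ : (fun n => RI I (fun t => w1 t * RI (I `&` E) (fun y => pk ((radius n)%:C%C * expi y) (tau t)))) =
    (fun n => RI I (fun t => w2 t * RI (I `&` E) (fun y => pk ((radius n)%:C%C * expi y) t))).
    apply/funext => n; have hr : 0 <= (radius n : R) < 1 by have /andP[a1 a2] := @radius_in R n; rewrite a2 ltW.
    etransitivity; first exact: (smoothing_swap mtau bw1 w10 mE hr).
    symmetry; etransitivity; first exact: (smoothing_swap mid bw2 w20 mE hr).
    apply: RI_eq => y _; symmetry; apply: kernel.
    by have /andP[? ?] := hr; rewrite N_polar.
  rewrite EQ in L1.
  have EQ2 : RI I (fun t => w1 t * (2 * pi * \1_E (tau t))) = RI I (fun t => w2 t * (2 * pi * \1_E t)).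
    by apply: (cvg_unique _ L1 idI).
  have S1 (w u : R -> R) : bm w -> measurable_fun [set: R] u ->
      RI I (fun t => w t * (2 * pi * \1_E (u t))) = 2 * pi * RI I (fun t => w t * \1_E (u t)).
    move=> bw mu'; rewrite -(RI_Z _ fI (b1 w u bw mu' E mE)).
    by apply: RI_eq => t _; ring.
  have n0 : 2 * pi != 0 :> R by rewrite gt_eqF.
  apply: (mulfI n0); rewrite -(S1 w1 tau bw1 mtau) EQ2.
  exact: (S1 w2 id bw2 mid).
(* Half-open intervals are stable under intersection and generate the Borel sets; complements use
   equality of the total weights, disjoint countable unions dominated convergence. *)
move=> B mB; apply: (@dynkin_induction _ (measurableTypeR R) (@ocitv R) P) => //.
- move=> _ _ [[a b] _ <-] [[a' b'] _ <-]; exists (Num.max a a', Num.min b b') => //=.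
  rewrite predeqE => t; rewrite /= !in_itv/= gt_max le_min; split.
    by move=> /andP[/andP[-> ->] /andP[-> ->]].
  by move=> [/andP[-> ->] /andP[-> ->]].
- move=> S mS PS; rewrite /P.
  have cE (w u : R -> R) : bm w -> measurable_fun [set: R] u ->
     RI I (fun t => w t * \1_(~` S) (u t)) = RI I w - RI I (fun t => w t * \1_S (u t)).
    move=> bw mu'; rewrite -RI_B//; last exact: b1.
    by apply: RI_eq => t _; rewrite -[X in X - _]mulr1 -mulrBr !indicE in_setC;
       case: (_ \in S); rewrite ?subrr ?subr0.
  by rewrite cE// (@cE w2 id)// tot PS.
move=> F mF tF PF; rewrite /P.
have uE (w u : R -> R) : bm w -> measurable_fun [set: R] u ->
    \sum_(k < n) RI I (fun t => w t * \1_(F k) (u t)) @[n --> \oo] --> RI I (fun t => w t * \1_(\bigcup_k F k) (u t)).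
  move=> bw mu'; have [_ [K HK]] := bw.
  have K0 : 0 <= K by apply: le_trans (normr_ge0 _) (HK 0).
  have -> : (fun n => \sum_(k < n) RI I (fun t => w t * \1_(F k) (u t))) =
     (fun n => RI I (fun t => \sum_(k < n) w t * \1_(F k) (u t))).
    apply/funext => n.
    by have [_ ->] := @RI_sum _ I _ (index_enum 'I_n) predT (fun k t => w t * \1_(F k) (u t)) fI (fun k => b1 w u bw mu' _ (mF k)).
  have sumE n s : \sum_(k < n) (\1_(F k) s : R) = \1_(\bigcup_(k < n) F k) s.
    rewrite indicE; have [[k /= kn Fk]|nF] := pselect ((\bigcup_(k < n) F k) s).
      rewrite mem_set; last by exists k.
      rewrite (bigD1 (Ordinal kn))//= big1 ?addr0 => [|j jk].
        by rewrite indicE mem_set.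
      rewrite indicE memNset// => Fj; move: jk; rewrite -val_eqE /=.
      by move/negP; apply; apply/eqP; apply: (tF j k) => //; exists s.
    rewrite memNset// big1// => k _; rewrite indicE memNset// => Fk.
    by apply: nF; exists k => //=.
  apply: (@RI_dct _ _ (fun n t => \sum_(k < n) w t * \1_(F k) (u t)) _ K) => //.
  - move=> n.
    by have [] := @RI_sum _ I _ (index_enum 'I_n) predT (fun k t => w t * \1_(F k) (u t)) fI (fun k => b1 w u bw mu' _ (mF k)).
  - apply: (b1 w u bw mu'); apply: bigcupT_measurable => k; exact: mF.
  - move=> n t _; rewrite -mulr_sumr sumE normrM -[leRHS]mulr1 ler_pM//.
    by rewrite indicE; case: (_ \in _); rewrite ?normr1 ?normr0.
  apply: ae_all => t _; under eq_fun do rewrite -mulr_sumr sumE.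
  apply: cvgM; first exact: cvg_cst.
  apply: cvg_near_cst; have [[k _ Fk]|nF] := pselect ((\bigcup_k F k) (u t)).
    exists k.+1 => // n /= kn; rewrite !indicE !mem_set//; first by exists k.
    by exists k.
  exists 0%N => // n _; rewrite !indicE !memNset// => -[k _ Fk].
  by apply: nF; exists k.
have L1 := uE w1 tau bw1 mtau; have L2 := uE w2 id bw2 mid.
have E : (fun n => \sum_(k < n) RI I (fun t => w1 t * \1_(F k) (tau t))) =
   (fun n => \sum_(k < n) RI I (fun t => w2 t * \1_(F k) t)).
  by apply/funext => n; apply: eq_bigr => k _; exact: PF.
rewrite E in L1; by apply: (cvg_unique _ L1 L2).
Qed.
End Uniqueness.

(** * Boundary behaviour of centred inner functions *)

Section CentredInner.
Context {R : realType}.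
Local Notation C := R[i].
Local Notation mu := (@lebesgue_measure R).
Local Notation I := (seg 0 (2 * pi) : set R).

(** What is retained of a centred inner function: d is its derivative at 0 and [tau] its boundary
    map. This form is stable under composition. *)
Definition cinner (f : C -> C) (tau : R -> R) (d : C) :=
  [/\ holo f, (forall z, N z < 1 -> N (f z) <= 1), f 0 = 0, cdiff f 0 d & boundary_angle f tau].

Lemma radius_ge0 n : 0 <= (radius n : R) < 1.
Proof. by have /andP[a b] := @radius_in R n; rewrite b ltW. Qed.

Lemma radial_boundary_angle (f : C -> C) (tau : R -> R) : boundary_angle f tau -> radial f (fun t => expi (tau t)).
Proof.
move=> [mt _ H]; split; first exact: (cbm_comp cbm_expi mt).
by apply: aeS H => t H It; apply: ntlim_radial (H It) _ _; [exact: radius_ge0|exact: radius_cvg].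
Qed.

Lemma holo_gholo (f : C -> C) K : holo f -> (forall z, N z < 1 -> N (f z) <= K) -> gholo K f.
Proof. by move=> hf fK; split=> // z z1; [exact: holo_ccont|move=> _; exact: hf]. Qed.

Section OneInner.
Variables (f : C -> C) (tau : R -> R) (d : C).
Hypothesis hf : cinner f tau d.

Definition quot (w : C) := if w == 0 then d else f w / w.

Lemma quotE w : f w = w * quot w.
Proof.
have [_ _ f0 _ _] := hf; rewrite /quot; case: eqP => [->|/eqP w0]; first by rewrite f0 mul0r.
by rewrite mulrCA mulfV ?mulr1.
Qed.

(** Any bound will do here; the sharp one, 1, is deduced afterwards from the unimodular boundary
    values. *)
Lemma gholo_quot : exists L, gholo L quot.
Proof.
have [hh f1 f0 hd _] := hf.
have loc (w : C) : w != 0 -> exists2 e, 0 < e & forall u, N (u - w) < e -> f u * u^-1 = quot u.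
  move=> w0; exists (N w); first by rewrite N_gt0.
  by move=> u; rewrite /quot; case: eqP => // ->; rewrite sub0r NN ltxx.
have c0 : ccont quot 0.
  move=> e e0; have e2 : 0 < e / 2 by rewrite divr_gt0.
  have [del del0 H] := hd _ e2; exists del => // w /H.
  rewrite /quot eqxx f0 !subr0; case: eqP => [->|/eqP w0]; first by rewrite (subrr d) N0.
  rewrite (_ : f w / w - d = (f w - d * w) / w); last by rewrite mulrBl mulfK.
  by rewrite NM NV -ler_pdivrMr ?N_gt0// => /le_lt_trans; apply; lra.
have [del del0 Hdel] := c0 1 ltr01.
exists ((N d + 1) + del^-1); split.
- move=> z z1; have [->//|z0] := eqVneq z 0.
  apply: ccont_local (loc z z0); apply: ccontM; first exact: holo_ccont.
  by apply: ccontV => //; exact: ccont_id.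
- move=> z z1 z0; have [l hl] := hh z z1; eexists; apply: cdiff_local (loc z z0).
  by apply: cdiffM; [exact: hl|apply: cdiffV => //; exact: cdiff_id].
move=> w w1; have Nd := N_ge0 d; have dV : 0 <= del^-1 by rewrite invr_ge0 ltW.
have [wd|wd] := ltP (N w) del.
  have := Hdel w; rewrite subr0 => /(_ wd); rewrite {2}/quot eqxx => h.
  by have := N_subge (quot w) d; lra.
have w0 : w != 0 by rewrite -N_gt0; lra.
rewrite /quot (negbTE w0) NM NV.
have : N (f w) / N w <= 1 * del^-1.
  by rewrite ler_pM ?N_ge0 ?invr_ge0 ?N_ge0 ?f1// lef_pV2 ?posrE//; lra.
by lra.
Qed.

Lemma radial_quot : radial quot (fun t => expi (tau t) * ((expi t)^*)%C).
Proof.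
have [hh f1 f0 hd hb] := hf; have [c1 H] := radial_boundary_angle hb.
split; first by apply: cbmM => //; apply: cbm_conj; exact: cbm_expi.
apply: aeS H => t H It.
have E1 : rlim (fun w => f w * w^-1) t (expi (tau t) * ((expi t)^*)%C).
  apply: rlimM; first exact: H.
  rewrite -expiV; apply: (@rlim_cont _ (fun w => w^-1)); apply: ccontV; last exact: expi_neq0.
  exact: ccont_id.
apply: cvg_trans E1; apply: near_eq_cvg; near=> n.
rewrite /quot; case: eqP => // E.
have := @N_polar R (radius n) t (ltW (andP (radius_in n)).1).
by rewrite E N0 => h; have /andP[] := @radius_in R n; rewrite -h ltxx.
Unshelve. all: by end_near. Qed.

(** The Schwarz lemma without the maximum principle: f(z) / z is an average of unimodular boundary
    values against the Poisson kernel. *)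
Lemma N_quot z : N z < 1 -> N (quot z) <= 1.
Proof.
move=> z1; have [L gL] := gholo_quot; have rq := radial_quot.
have H := poisson_formula gL rq z1.
have p0 := @twopi_gt0 R; have bp := bm_pk z1.
have : N ((2 * pi)%:C%C * quot z) <= 2 * pi.
  rewrite -H; apply: (@le_trans _ _ (RI I (pk z))); last by rewrite RI_pk.
  apply: N_CI_le => //; first exact: fmeas_I.
    by apply: cbmM; [exact: rq.1|exact: cbm_real].
  move=> t _; rewrite !NM N_conj !N_expi !mul1r N_real ger0_norm//; exact: pk_ge0.
rewrite NM N_real gtr0_norm// -[leRHS]mulr1 ler_pM2l//.
Qed.

Lemma schwarz z : N z < 1 -> N (f z) <= N z.
Proof. by move=> z1; rewrite quotE NM ler_piMr ?N_ge0// N_quot. Qed.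
Lemma N_deriv0 : N d <= 1.
Proof. by have := @N_quot 0; rewrite N0 /quot eqxx; exact. Qed.

Section Moments.
Variable z : C.
Hypothesis z1 : N z < 1.

Lemma gholo_ckf : gholo (1 - N z)^-1 (fun w => ck z (f w)).
Proof.
have [hh f1 f0 hd hb] := hf; split.
- move=> w w1; apply: (@ccont_comp _ f (ck z)); first exact: holo_ccont.
  by have [l] := cdiff_ck z1 (f1 w w1); exact: cdiff_ccont.
- move=> w w1 _; have [l hl] := cdiff_ck z1 (f1 w w1); have [l' hl'] := hh w w1.
  by eexists; exact: (cdiff_comp hl' hl).
- by move=> w w1; apply: N_ck => //; exact: f1.
Qed.
Lemma radial_ckf : radial (fun w => ck z (f w)) (fun t => ck z (expi (tau t))).
Proof.
have [hh f1 f0 hd hb] := hf; have [c1 H] := radial_boundary_angle hb; have [mt _ _] := hb.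
split; first exact: (cbm_comp (cbm_ck z1) mt).
apply: aeS H => t H It; apply: (rlim_comp (H It)).
by have [|l] := @cdiff_ck _ z z1 (expi (tau t)); [rewrite N_expi|exact: cdiff_ccont].
Qed.

Lemma gholo_id : gholo 1 (id : C -> C).
Proof. by split=> [w _|w _ _|w w1]; [exact: ccont_id|exists 1; exact: cdiff_id|exact: ltW]. Qed.
Lemma radial_id : radial (id : C -> C) expi.
Proof. by split; [exact: cbm_expi|apply: ae_all => t _; exact: rlim_id]. Qed.
Lemma gholo_cst (a : C) : gholo (N a) (fun=> a).
Proof. by split=> [w _|w _ _|w w1] //; [exact: ccont_cst|exists 0; exact: cdiff_cst]. Qed.
Lemma radial_cst (a : C) : radial (fun=> a) (fun=> a).
Proof. by split; [exact: cbm_cst|apply: ae_all => t _; exact: (@rlim_cont _ (fun=> a) t (ccont_cst _ _))]. Qed.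

Let f0 : f 0 = 0. Proof. by have [] := hf. Qed.

Lemma CI_ckf : CI I (fun t => ck z (expi (tau t))) = (2 * pi)%:C%C.
Proof. by rewrite (mean_radial gholo_ckf radial_ckf) f0 ck0 mulr1. Qed.
Lemma CI_x_ckf : CI I (fun t => expi t * ck z (expi (tau t))) = 0.
Proof.
rewrite (mean_radial (gholoM gholo_id gholo_ckf) (radialM radial_id radial_ckf)).
by rewrite mul0r mulr0.
Qed.
Lemma CI_conjx : CI I (fun t => ((expi t)^*)%C) = 0 :> C.
Proof.
rewrite CI_conj; [|exact: fmeas_I|exact: cbm_expi].
by rewrite (mean_radial gholo_id radial_id) mulr0 conjc0.
Qed.
(** With x = expi t and y = expi (tau t), expanding the Cauchy kernel once gives conj x ck(y) = conj
    x + conj z (y conj x) ck(y). The first term has mean 0, and y conj x is the boundary value of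
    f(w) / w, which equals d at the origin. *)
Lemma CI_conjx_ckf : CI I (fun t => ((expi t)^*)%C * ck z (expi (tau t))) = (2 * pi)%:C%C * ((z^*)%C * d).
Proof.
have [L gL] := gholo_quot.
have g1 := gholoM (gholo_cst (z^*)%C) (gholoM gL gholo_ckf).
have r1 := radialM (radial_cst (z^*)%C) (radialM radial_quot radial_ckf).
have := mean_radial g1 r1; rewrite f0 ck0 mulr1 /quot eqxx => <-.
have -> : (fun t => ((expi t)^*)%C * ck z (expi (tau t))) = (fun t => ((expi t)^*)%C +
    (z^*)%C * (expi (tau t) * ((expi t)^*)%C * ck z (expi (tau t)))).
  apply/funext => t; have h := ck_den_neq0 z1 (_ : N (expi (tau t)) <= 1).
  rewrite N_expi in h; have {}h := h (lexx _).
  by rewrite /ck; move: (expi (tau t)) h => w h; field.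
rewrite CI_D ?CI_conjx ?add0r//; [exact: fmeas_I|apply: cbm_conj; exact: cbm_expi|].
exact: r1.1.
Qed.

Lemma pk_ck t : (pk z t)%:C%C = ck z (expi t) + ((ck z (expi t))^*)%C - 1.
Proof. by rewrite pkE// conj_ck//; ring. Qed.

Let cbmck : cbm (fun t => ck z (expi (tau t))).
Proof. by have [] := radial_ckf. Qed.

Lemma RI_pkf : RI I (fun t => pk z (tau t)) = 2 * pi.
Proof.
have fI := @fmeas_I R.
have : CI I (fun t => (pk z (tau t))%:C%C) = (2 * pi)%:C%C.
  under CI_eq do rewrite pk_ck.
  have cJ := cbm_conj cbmck; have c1 := @cbm_cst R 1.
  rewrite (CI_B fI (cbmD cbmck cJ) c1) (CI_D fI cbmck cJ) (CI_conj fI cbmck) CI_ckf.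
  by rewrite (CI_cst _ fI) meas_I conjc_real mul1r addrK.
by rewrite CI_real// => -[].
Qed.
(** Of the terms of [pk_ck] only the conjugate Cauchy kernel survives, and it gives the conjugate of
    [CI_conjx_ckf]. The result is conj d times [CI_x_pk], that is, [inner_twist] tested on Poisson
    kernels. *)
Lemma CI_x_pkf : CI I (fun t => expi t * (pk z (tau t))%:C%C) = (2 * pi)%:C%C * ((d^*)%C * z).
Proof.
have fI := @fmeas_I R; have cx := @cbm_expi R.
under CI_eq do rewrite pk_ck.
have E : (fun t => expi t * (ck z (expi (tau t)) + ((ck z (expi (tau t)))^*)%C - 1)) =
  (fun t => (expi t * ck z (expi (tau t)) + ((((expi t)^*)%C * ck z (expi (tau t)))^*)%C) - expi t).
  by apply/funext => t; rewrite conjM conjcK; ring.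
have c1 := cbmM cx cbmck; have c2 := cbmM (cbm_conj cx) cbmck; have c3 := cbm_conj c2.
rewrite E (CI_B fI (cbmD c1 c3) cx) (CI_D fI c1 c3) (CI_conj fI c2) CI_x_ckf CI_conjx_ckf.
rewrite (mean_radial gholo_id radial_id) mulr0 subr0 add0r !conjM conjcK conjc_real.
by rewrite (mulrC z).
Qed.
Lemma CI_x_pk : CI I (fun t => expi t * (pk z t)%:C%C) = (2 * pi)%:C%C * z.
Proof. exact: (poisson_formula gholo_id radial_id z1). Qed.
End Moments.

Lemma CI_second_moment : CI I (fun t => (expi (tau t) * ((expi t)^*)%C) ^+ 2) = (2 * pi)%:C%C * d ^+ 2.
Proof.
have [L gL] := gholo_quot; have rq := radial_quot.
have := mean_radial (gholoM gL gL) (radialM rq rq).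
by rewrite /quot eqxx -!expr2 => <-.
Qed.

(** On the fibre over s, the kernel at r e^{is} takes its peak value (1 + r) / (1 - r), while its
    integral is 2 pi; so the fibre has length at most 2 pi (1 - r) for every r. Preservation of
    length is not yet available, since its proof relies on this. *)
Lemma null_fibers_inner : null_fibers tau.
Proof.
have [_ _ _ _ [mt _ _]] := hf; have fI := @fmeas_I R; have p0 := @twopi_gt0 R.
move=> s; pose A := I `&` tau @^-1` [set s].
have mA0 : measurable (tau @^-1` [set s]).
  by rewrite -[X in measurable X]setTI; apply: mt => //; exact: measurable_set1.
have fA : fmeas A by exact: fmeasI.
have bound n : meas A <= 2 * pi * n.+2%:R^-1.
  have hr := @radius_in R n; have /andP[r0 r1] := hr.
  pose z : C := (radius n)%:C%C * expi s.
  have Nz : N z = radius n by rewrite N_polar// ltW.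
  have z1 : N z < 1 by rewrite Nz.
  have bp : bm (fun t => pk z (tau t)) := bm_comp (bm_pk z1) mt.
  have ps : pk z s = (1 - radius n ^+ 2) / (1 - radius n) ^+ 2.
    rewrite /pk Nz; congr (_ / _ ^+ 2).
    rewrite /z -[X in N (X - _)]mul1r -mulrBl NM N_expi mulr1.
    have -> : 1 - (radius n)%:C%C = (1 - radius n : R)%:C%C :> C.
      by move: (radius n) => r; rewrite rmorphB.
    by rewrite N_real gtr0_norm ?subr_gt0.
  have low : RI A (fun t => pk z (tau t)) <= 2 * pi.
    rewrite -(RI_pkf z1) RI_indic; apply: RI_le => //.
      by apply: bmM => //; exact: bm_indic.
    by move=> t _; rewrite ler_piMr ?pk_ge0// indicE; case: (_ \in _).
  move: low; rewrite (@RI_eq _ _ _ (fun=> pk z s)); last by move=> t [_ ->].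
  rewrite (RI_cst _ fA) ps => low.
  have rE : 1 - radius n = n.+2%:R^-1 :> R by rewrite /radius subKr.
  rewrite -rE; move: low; move: (radius n) r0 r1 => r r0 r1.
  have -> : (1 - r ^+ 2) / (1 - r) ^+ 2 = (1 + r) / (1 - r) by field; lra.
  have d1 : 0 < 1 - r by lra.
  rewrite mulrAC ler_pdivrMr// => h.
  have := meas_ge0 A; nra.
have A0 : meas A = 0.
  apply/eqP; rewrite eq_le meas_ge0 andbT; apply/ler_addgt0Pr => e e0; rewrite add0r.
  have : 2 * pi * n.+2%:R^-1 @[n --> \oo] --> (2 * pi * 0 : R).
    by apply: cvgMr; exact: harmonic2_cvg.
  rewrite mulr0 => /cvgrPdist_lt/(_ _ e0)[n _ /(_ n (leqnn n))].
  rewrite sub0r normrN => h; apply: le_trans (bound n) (le_trans (ler_norm _) (ltW h)).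
exists A; split; first exact: fA.1.
  by rewrite fmeas_mu// A0.
move=> t /= /not_implyP[It]; move/negP; rewrite negbK => /eqP E; split => //.
Qed.

Lemma null_fibers_id : null_fibers (id : R -> R).
Proof.
move=> s; exists [set s]; split; [exact: measurable_set1|exact: lebesgue_measure_set1|].
by move=> t /= /not_implyP[_]; move/negP; rewrite negbK => /eqP.
Qed.

Let mt : measurable_fun [set: R] tau. Proof. by have [_ _ _ _ []] := hf. Qed.
Let tI t : I (tau t).
Proof. by have [_ _ _ _ [_ ti _]] := hf; apply/segE; exact: ti. Qed.

(** Löwner's lemma: with weights 1, both sides have the constant Poisson integral 2 pi. *)
Lemma inner_preserves (B : set R) : measurable B ->
  RI I (fun t => \1_B (tau t)) = RI I (\1_B : R -> R).
Proof.
move=> mB; have one01 (t : R) : 0 <= 1 :> R by [].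
have E1 (g : R -> R) : (fun t => 1 * g t) = g by apply/funext => t; rewrite mul1r.
have b1 := @bm_cst R 1.
have H := @pushforward_unique R tau (fun=> 1) (fun=> 1) mt tI b1 b1 one01 one01 _
  null_fibers_inner null_fibers_id B mB.
move: H; rewrite !E1; apply=> z z1.
by rewrite !E1 RI_pk// RI_pkf.
Qed.

(* The weight 1 is added because pushforward_unique needs nonnegative weights. *)
Lemma inner_weight (w1 w2 : R -> R) (B : set R) : bm w1 -> bm w2 ->
  (forall t, -1 <= w1 t) -> (forall t, -1 <= w2 t) ->
  (forall z, N z < 1 -> RI I (fun t => w1 t * pk z (tau t)) = RI I (fun t => w2 t * pk z t)) ->
  measurable B -> RI I (fun t => w1 t * \1_B (tau t)) = RI I (fun t => w2 t * \1_B t).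
Proof.
move=> bw1 bw2 w1N w2N ker mB; have fI := @fmeas_I R; have b1 := @bm_cst R 1.
have ge (w : R -> R) : (forall t, -1 <= w t) -> forall t, 0 <= 1 + w t.
  by move=> wN t; rewrite -lerBlDl sub0r.
have split_ (w g : R -> R) : bm w -> bm g ->
    RI I (fun t => (1 + w t) * g t) = RI I g + RI I (fun t => w t * g t).
  move=> bw bg; rewrite -(RI_D fI bg (bmM bw bg)).
  by apply: RI_eq => t _; rewrite mulrDl mul1r.
have H := @pushforward_unique R tau (fun t => 1 + w1 t) (fun t => 1 + w2 t) mt tI
  (bmD b1 bw1) (bmD b1 bw2) (ge _ w1N) (ge _ w2N) _ null_fibers_inner null_fibers_id B mB.
have bB := bm_indic mB.
have {}H := H _; move: H; rewrite (split_ _ _ bw1 (bm_comp bB mt)) (split_ _ _ bw2 bB).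
rewrite [X in X + _ = _](inner_preserves mB) => H; apply: (addrI (RI I (\1_B : R -> R))).
apply: H => z z1; have bp := bm_pk z1.
rewrite (split_ _ _ bw1 (bm_comp bp mt)) (split_ _ _ bw2 bp) ker//; congr (_ + _).
by rewrite (RI_pk z1); exact: RI_pkf.
Qed.

(** The conditional expectation of x given the boundary value y of f is conj d times y. The weights
    x and conj d y are treated through their real and imaginary parts, all at least -1 because |d|
    <= 1. *)
Lemma inner_twist (B : set R) : measurable B ->
  CI I (fun t => expi t * (\1_B (tau t))%:C%C) = (d^*)%C * CI I (fun t => expi t * (\1_B t)%:C%C).
Proof.
move=> mB; have fI := @fmeas_I R; have cx := @cbm_expi R; have bB := bm_indic mB.
have Nd := N_deriv0.
have cw : cbm (fun t => (d^*)%C * expi t) by apply: cbmM => //; exact: cbm_cst.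
have Nw t : N ((d^*)%C * expi t) <= 1 by rewrite NM N_conj N_expi mulr1.
rewrite -CI_Z//; last by apply: cbmM => //; exact: cbm_real.
have kz z (z1 : N z < 1) : CI I (fun t => expi t * (pk z (tau t))%:C%C) =
    CI I (fun t => (d^*)%C * expi t * (pk z t)%:C%C).
  have bp := bm_pk z1; have cp := cbm_real bp.
  rewrite (@CI_eq _ I (fun t => (d^*)%C * expi t * (pk z t)%:C%C)
    (fun t => (d^*)%C * (expi t * (pk z t)%:C%C))); last by move=> t _; rewrite mulrA.
  by rewrite (CI_Z _ fI (cbmM cx cp)) CI_x_pk// CI_x_pkf// mulrCA.
apply: complex_ext => /=.
  rewrite (@RI_eq _ _ _ (fun t => cos t * \1_B (tau t))); last first.
    by move=> t _; rewrite ?ReM /= mulr0 subr0.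
  rewrite (@RI_eq _ _ (fun t => Re ((d^*)%C * (expi t * (\1_B t)%:C%C)))
     (fun t => Re ((d^*)%C * expi t) * \1_B t)); last first.
    by move=> t _; rewrite mulrA ?ReM /= mulr0 subr0.
  apply: inner_weight => //; [exact: bm_cos|exact: cw.1|exact: cos_geN1| |].
    by move=> t; have := le_trans (N_Re _) (Nw t); rewrite ler_norml => /andP[].
  move=> z z1; have /(congr1 (@complex.Re R)) := kz z z1; rewrite /= => H.
  transitivity (RI I (fun t => Re (expi t * (pk z (tau t))%:C%C))).
    by apply: RI_eq => t _; rewrite ?ReM /= mulr0 subr0.
  by rewrite H; apply: RI_eq => t _; rewrite ?ReM /= mulr0 subr0.
rewrite (@RI_eq _ _ _ (fun t => sin t * \1_B (tau t))); last first.
  by move=> t _; rewrite ?ImM /= mulr0 add0r.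
rewrite (@RI_eq _ _ (fun t => Im ((d^*)%C * (expi t * (\1_B t)%:C%C)))
   (fun t => Im ((d^*)%C * expi t) * \1_B t)); last first.
  by move=> t _; rewrite mulrA ?ImM /= mulr0 add0r.
apply: inner_weight => //; [exact: bm_sin|exact: cw.2|exact: sin_geN1| |].
  by move=> t; have := le_trans (N_Im _) (Nw t); rewrite ler_norml => /andP[].
move=> z z1; have /(congr1 (@complex.Im R)) := kz z z1; rewrite /= => H.
transitivity (RI I (fun t => Im (expi t * (pk z (tau t))%:C%C))).
  by apply: RI_eq => t _; rewrite ?ImM /= mulr0 add0r.
by rewrite H; apply: RI_eq => t _; rewrite ?ImM /= mulr0 add0r.
Qed.

(** Since [tau] describes f only almost everywhere, this is what allows [tau] to be evaluated along
    another boundary map. *)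
Lemma inner_null (P : R -> Prop) : {ae mu, forall t, I t -> P t} ->
  {ae mu, forall t, I t -> P (tau t)}.
Proof.
move=> [B [mB B0 HB]]; have fI := @fmeas_I R.
have mtB : measurable (tau @^-1` B) by rewrite -[X in measurable X]setTI; exact: mt.
have fA : fmeas (I `&` tau @^-1` B) by exact: fmeasI.
have E (u : R -> R) (D : set R) : fmeas (I `&` D) -> RI I (\1_D : R -> R) = meas (I `&` D).
  move=> fD; rewrite meas_RI// RI_indic; apply: RI_eq => t _; by rewrite mul1r.
have A0 : meas (I `&` tau @^-1` B) = 0.
  rewrite -(E id _ fA) -[X in RI I X]/(fun t => \1_B (tau t)) (inner_preserves mB).
  rewrite (E id)//; last exact: fmeasI.
  rewrite /meas (@subset_measure0 _ _ _ mu (I `&` B) B)//.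
  by apply: measurableI => //; exact: fI.1.
exists (I `&` tau @^-1` B); split; [exact: fA.1|by rewrite fmeas_mu// A0|].
move=> t /= /not_implyP[It nP]; split=> //=; apply: HB => /= H; apply: nP; exact: H.
Qed.
End OneInner.

(* The Poisson formula for f(r F), in the limit r -> 1, shows that f o F is the Poisson
   integral of expi (tau (sigma t)); Fatou's theorem then gives its non-tangential
   limits. *)
Lemma cinner_comp F sigma e f tau d : cinner F sigma e -> cinner f tau d ->
  cinner (f \o F) (tau \o sigma) (d * e).
Proof.
move=> cF cf; have [hF F1 F0 dF bF] := cF; have [hf f1 f0 df bf] := cf.
have [ms si sl] := bF; have [mt ti tl] := bf.
have sch z : N z < 1 -> N (F z) < 1.
  by move=> z1; apply: le_lt_trans (schwarz cF z1) z1.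
have fI := @fmeas_I R.
split.
- move=> z z1; have [l hl] := hF z z1; have [l' hl'] := hf _ (sch z z1).
  by exists (l' * l); exact: cdiff_comp.
- by move=> z z1; apply: f1; exact: sch.
- by rewrite /= F0.
- by apply: cdiff_comp => //; rewrite F0.
pose b t := expi (tau (sigma t)) : C.
have mts : measurable_fun [set: R] (tau \o sigma) by exact: measurableT_comp.
have cb : cbm b by exact: (cbm_comp (@cbm_expi R) mts).
have rep z : N z < 1 -> CI I (fun t => b t * (pk z t)%:C%C) = (2 * pi)%:C%C * f (F z).
  move=> z1; pose h n w := f ((radius n)%:C%C * F w).
  have Nr n (w : C) : N w <= 1 -> N ((radius n)%:C%C * w) < 1.
    move=> w1; have /andP[r0 r1] := @radius_in R n.
    by rewrite NM N_real gtr0_norm//; apply: le_lt_trans r1; rewrite ler_piMr// ltW.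
  have gh n : gholo 1 (h n).
    apply: holo_gholo => w w1; last by apply: f1; apply: Nr; exact: F1.
    have [l hl] := hF w w1; have [l' hl'] := hf _ (Nr n _ (F1 w w1)).
    have dm : cdiff (fun w => (radius n)%:C%C * F w) w (0 * F w + (radius n)%:C%C * l).
      by apply: cdiffM => //; exact: cdiff_cst.
    by eexists; exact: (cdiff_comp dm hl').
  have rh n : radial (h n) (fun t => f ((radius n)%:C%C * expi (sigma t))).
    split.
      apply: (@cbm_comp _ (fun s => f ((radius n)%:C%C * expi s))) => //.
      exact: (cbm_circle (holo_ccont hf) f1 (radius_ge0 n)).
    apply: aeS (radial_boundary_angle bF).2 => t H It.
    apply: (@rlim_comp _ F (fun w => f ((radius n)%:C%C * w)) t _ (H It)).
    apply: (@ccont_comp _ (fun w => (radius n)%:C%C * w) f).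
      by apply: ccontM; [exact: ccont_cst|exact: ccont_id].
    by apply: holo_ccont => //; apply: Nr; rewrite N_expi.
  have L1 : CI I (fun t => f ((radius n)%:C%C * expi (sigma t)) * (pk z t)%:C%C) @[n --> \oo] -->
      CI I (fun t => b t * (pk z t)%:C%C).
    have cp := cbm_real (bm_pk z1).
    apply: (@CI_dct _ I (fun n t => f ((radius n)%:C%C * expi (sigma t)) * (pk z t)%:C%C) _ (2 / (1 - N z))).
    - exact: fI.
    - by move=> n; apply: cbmM => //; exact: (rh n).1.
    - exact: cbmM.
    - move=> n t _; rewrite NM N_real (ger0_norm (pk_ge0 z1 t)) -[leRHS]mul1r.
      by rewrite ler_pM ?N_ge0 ?pk_ge0 ?pk_peak// f1// Nr// N_expi.
    have := inner_null cF tl; apply: aeS => t H It.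
    have := ntlim_radial (H It) radius_ge0 (@radius_cvg R).
    move=> /cvg_ReIm[h1 h2]; apply/cvg_ReIm; split.
      under eq_fun do rewrite ?ReM /= mulr0 subr0.
      rewrite ReM /= mulr0 subr0; apply: cvgM => //; exact: cvg_cst.
    under eq_fun do rewrite ?ImM /= mulr0 add0r.
    rewrite ImM /= mulr0 add0r; apply: cvgM => //; exact: cvg_cst.
  have L2 : (2 * pi)%:C%C * f ((radius n)%:C%C * F z) @[n --> \oo] --> (2 * pi)%:C%C * f (F z).
    have c : ccont (fun w => (2 * pi)%:C%C * f w) (F z).
      by apply: ccontM; [exact: ccont_cst|apply: holo_ccont => //; exact: sch].
    apply/cvg_N => e' /c[del del0 Hd].
    have /cvgrPdist_lt/(_ _ del0) := @radius_cvg R; apply: filterS => n hn; apply: Hd.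
    rewrite -[X in _ - X]mul1r -mulrBl NM.
    have -> : (radius n)%:C%C - 1 = (radius n - 1 : R)%:C%C :> C.
      by move: (radius n) => r; rewrite rmorphB.
    rewrite N_real distrC; apply: le_lt_trans hn.
    by rewrite ler_piMr//; apply: F1.
  have EQ : (fun n => CI I (fun t => f ((radius n)%:C%C * expi (sigma t)) * (pk z t)%:C%C)) =
      (fun n => (2 * pi)%:C%C * f ((radius n)%:C%C * F z)).
    by apply/funext => n; rewrite (poisson_formula (gh n) (rh n) z1).
  rewrite EQ in L1; move/(@cvg_lim C^o): L1 => /(_ (@norm_hausdorff _ _)) <-.
  by move/(@cvg_lim C^o): L2 => /(_ (@norm_hausdorff _ _)) <-.
split; [exact: mts|by move=> t; exact: ti|].
have [br bi] := cb.
have K1 t : `|Re (b t)| <= 1 by apply: le_trans (N_Re _) _; rewrite N_expi.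
have K2 t : `|Im (b t)| <= 1 by apply: le_trans (N_Im _) _; rewrite N_expi.
(* Besides Lebesgue points of both parts, t is required to be nonzero, Fatou's estimate being for
   interior angles. *)
have := aeS2 (fun _ a b => conj a b) (null_fibers_id 0)
  (aeS2 (fun _ a b => conj a b) (bm_lebesgue_pt br) (bm_lebesgue_pt bi)).
apply: aeS => t [t0 [lr li]] It; have tin : 0 < t < 2 * pi.
  by move/segE: (It) => /andP[h1 h2]; rewrite h2 andbT lt_def h1 andbT; exact: t0.
move=> M M1; apply/cvg_N => e' e'0.
have p0 := pi_gt0 R.
(* Fatou's estimate carries the factor 2 pi, so each of the two parts is within e' / 4. *)
have e1 : 0 < pi * e' / 2 by rewrite divr_gt0// mulr_gt0.
have [d1 d10 H1] := fatou_lebesgue_point br K1 tin M1 (lebesgue_pt_RI br lr) e1.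
have [d2 d20 H2] := fatou_lebesgue_point bi K2 tin M1 (lebesgue_pt_RI bi li) e1.
rewrite /within /=; apply/nbhs_N; exists (Num.min d1 d2); first by rewrite lt_min d10.
move=> z; rewrite lt_min => /andP[z1 z2] [zd zM].
have Nz : N z < 1 by move: zd; rewrite /unit_disc /= normE ltcR.
have NM' : N (z - expi t) < M * (1 - N z).
  move: zM; rewrite /= !normE (_ : M%:C%C * (1 - (N z)%:C%C) = (M * (1 - N z))%:C%C).
    by rewrite ltcR.
  by rewrite rmorphM/= rmorphB.
have := H1 z Nz z1 NM'; have := H2 z Nz z2 NM'.
have := rep z Nz => E.
have -> : RI I (fun s => Re (b s) * pk z s) = 2 * pi * Re (f (F z)).
  have := congr1 (@complex.Re R) E; rewrite ReM /= mul0r subr0 => <-.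
  by apply: RI_eq => s _; rewrite ?ReM /= mulr0 subr0.
have -> : RI I (fun s => Im (b s) * pk z s) = 2 * pi * Im (f (F z)).
  have := congr1 (@complex.Im R) E; rewrite ImM /= mul0r addr0 => <-.
  by apply: RI_eq => s _; rewrite ?ImM /= mulr0 add0r.
rewrite -!mulrBr !normrM (gtr0_norm p0) (gtr0_norm (_ : 0 < 2 :> R))// => h2 h1.
apply: le_lt_trans (N_le _) _; rewrite ReD ReN ImD ImN.
move: h1 h2; rewrite /b /=; set X := `|_ - cos _|; set Y := `|_ - sin _| => h1 h2.
have h3 : pi * (2 * (X + Y)) <= pi * e' by lra.
have := ler_pM2l p0 (2 * (X + Y)) e'; rewrite h3 => /esym h4.
by move/idP: h4 => h4; lra.
Qed.
End CentredInner.

(** * Splitting a mass by the eight arcs: entropy and Fourier coefficients *)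

Section EntropyStep.
Context {R : realType}.
Local Notation C := R[i].
Local Notation mu := (@lebesgue_measure R).
Local Notation I := (seg 0 (2 * pi) : set R).

Lemma le_quad (x y c : R) : 0 <= y -> (y = 0 -> x = 0) -> 2 * c * x - c ^+ 2 * y <= x ^+ 2 / y.
Proof.
rewrite le_eqVlt => /predU1P[<- /(_ erefl) ->|y0 _].
  by rewrite !mulr0 subr0 expr0n/= mul0r.
by rewrite ler_pdivlMr//; have := sqr_ge0 (x - c * y); nra.
Qed.

(** Cauchy-Schwarz in quotient form: sum the tangent bounds [le_quad] with the common slope c = X /
    Y. Division by zero gives 0, consistently with x l = 0 when y l = 0. *)
Lemma sqr_sum_div_le (T : finType) (x y : T -> R) : (forall l, 0 <= y l) -> (forall l, y l = 0 -> x l = 0) ->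
  (\sum_l x l) ^+ 2 / (\sum_l y l) <= \sum_l x l ^+ 2 / y l.
Proof.
move=> y0 xy; set X := \sum_l x l; set Y := \sum_l y l.
have Y0 : 0 <= Y by exact: sumr_ge0.
have [YE|Yn] := eqVneq Y 0.
  by rewrite YE invr0 mulr0; apply: sumr_ge0 => l _; rewrite divr_ge0 ?sqr_ge0.
have -> : X ^+ 2 / Y = \sum_l (2 * (X / Y) * x l - (X / Y) ^+ 2 * y l).
  rewrite sumrB -!mulr_sumr -/X -/Y; field; exact: Yn.
by apply: ler_sum => l _; apply: le_quad => // /xy.
Qed.

Lemma ln_bound (a q : R) : 0 < a -> 0 < q -> 1 - a / q <= ln (q / a).
Proof.
move=> a0 q0; have aq : 0 < a / q by rewrite divr_gt0.
have -> : q / a = (a / q)^-1 by rewrite invf_div.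
rewrite lnV ?posrE// lerBlDr addrC -lerBlDr opprK.
by have := expR_ge1Dx (ln (a / q)); rewrite lnK ?posrE// addrC.
Qed.

Lemma entropy_term_split (T : finType) (a : T -> R) (q : R) : (forall i, 0 <= a i) ->
  \sum_i a i = q ->
  q - \sum_i a i ^+ 2 / q <= \sum_i entropy_term (a i) - entropy_term q.
Proof.
move=> a0 qE; have q0 : 0 <= q by rewrite -qE; exact: sumr_ge0.
have p0 : 0 < 2 * pi :> R := @twopi_gt0 R.
have [q_eq0|qn] := eqVneq q 0.
  have aE i : a i = 0.
    apply/eqP; have : q == 0 by rewrite q_eq0.
    by rewrite -qE psumr_eq0// => /allP/(_ i); rewrite mem_index_enum => /(_ isT).
  rewrite q_eq0 /entropy_term eqxx !big1 ?subrr// => i _; first by rewrite aE eqxx.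
  by rewrite invr0 mulr0.
have qp : 0 < q by rewrite lt_def qn.
rewrite /entropy_term (negbTE qn).
have -> : q * ln (2 * pi / q) = \sum_i a i * ln (2 * pi / q) by rewrite -mulr_suml qE.
rewrite -{1}qE -!sumrB; apply: ler_sum => i _; case: eqP => [->|/eqP an].
  by rewrite expr0n/= !mul0r !subrr.
have ap : 0 < a i by rewrite lt_def an a0.
have -> : a i * ln (2 * pi / a i) - a i * ln (2 * pi / q) = a i * ln (q / a i).
  rewrite -mulrBr -ln_div ?posrE ?divr_gt0//; congr (_ * ln _).
  have : 2 * pi != 0 :> R by rewrite gt_eqF.
  by move: (2 * pi) => P P0; field; rewrite qn an P0.
by rewrite -[X in X - _]mulr1 expr2 -mulrA -mulrBr ler_pM2l// ln_bound.
Qed.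

Lemma entropy_term_ge0 x : 0 <= x <= 2 * pi -> 0 <= entropy_term x :> R.
Proof.
move=> /andP[x0 x1]; rewrite /entropy_term; case: eqP => // /eqP xn.
have xp : 0 < x by rewrite lt_def xn.
by rewrite mulr_ge0// ln_ge0// ler_pdivlMr// mul1r.
Qed.

Definition arc (n : nat) (i : 'I_n) : set R := seg (2 * pi * i%:R / n%:R) (2 * pi * i.+1%:R / n%:R).

Lemma measurable_arc n (i : 'I_n) : measurable (arc i).
Proof. exact: measurable_itv. Qed.

Lemma arc_diam n (i : 'I_n) s t : (0 < n)%N -> arc i s -> arc i t -> `|s - t| <= 2 * pi / n%:R.
Proof.
move=> n0 /segE h1 /segE h2.
have : 2 * pi * i.+1%:R / n%:R = 2 * pi * i%:R / n%:R + 2 * pi / n%:R :> R.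
  by rewrite -natr1; field; rewrite pnatr_eq0 -lt0n.
by move=> h3; rewrite ler_norml; lra.
Qed.

Lemma sum_arc n t : (0 < n)%N -> I t -> \sum_(i < n) \1_(arc i) t = 1 :> R.
Proof.
move=> n0 /segE/andP[t0 t1]; have p0 := @twopi_gt0 R.
have nn : 0 < n%:R :> R by rewrite ltr0n.
(* The angle in units of one arc; its integer part is the index of the arc that contains t. *)
pose x := t * n%:R / (2 * pi).
have x0 : 0 <= x := divr_ge0 (mulr_ge0 t0 (ltW nn)) (ltW p0).
have xn : x < n%:R by rewrite ltr_pdivrMr// mulrC ltr_pM2l.
have /andP[k1 k2] := truncn_itv x0; set k := Num.truncn x in k1 k2.
have kn : (k < n)%N by rewrite -(ltr_nat R); apply: le_lt_trans xn.
have inarc (i : 'I_n) : (t \in arc i) = (i%:R <= x < i.+1%:R).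
  rewrite /x; apply/idP/idP.
    move=> /set_mem/segE/andP[]; rewrite ler_pdivrMr// ltr_pdivlMr// => h1 h2.
    by rewrite ler_pdivlMr// ltr_pdivrMr// !(mulrC _ (2 * pi)) h1 h2.
  rewrite ler_pdivlMr// ltr_pdivrMr// !(mulrC _ (2 * pi)) => /andP[h1 h2].
  by apply/mem_set/segE; rewrite ler_pdivrMr// ltr_pdivlMr// h1 h2.
rewrite (bigD1 (Ordinal kn))//= big1 ?addr0 => [|j jk].
  by rewrite indicE inarc k1 k2.
rewrite indicE inarc; case: (boolP (_ && _)) => // /andP[j1 j2].
move: jk; rewrite -val_eqE /=; have h1 : (j < k.+1)%N by rewrite -(ltr_nat R); apply: le_lt_trans k2.
have h2 : (k < j.+1)%N by rewrite -(ltr_nat R); apply: le_lt_trans j2.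
by rewrite eqn_leq -ltnS h1 -ltnS h2.
Qed.

Lemma chord_poly_le (u : R) : -1 <= u <= 1 -> 4 * u ^+ 2 - 6 * u + 2 <= 12.
Proof. nra. Qed.
Lemma chord_poly_le0 (u : R) : 2^-1 <= u <= 1 -> 4 * u ^+ 2 - 6 * u + 2 <= 0.
Proof. nra. Qed.

(* |x - y|^4 - |x - y|^2 for the chord joining two points of the circle: nonpositive on
   chords of length at most 1, such as those within one of the 8 arcs, and at most 12
   always. Its double integral involves only the first two Fourier coefficients. *)
Definition chord_kernel (x y : R) : R := 4 * cos (x - y) ^+ 2 - 6 * cos (x - y) + 2.

Lemma pi_lt4 : pi < 4 :> R.
Proof. by have /andP[_] := @pihalf_02 R; lra. Qed.

(** Two points of a common arc are at angular distance at most 2 pi / 8, and eight is the number of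
    arcs for which pi < 4 already makes this at most 1, hence the cosine at least 1 / 2. The sum of
    products of indicators is 1 for a common arc and 0 otherwise. *)
Lemma chord_kernel_le (x y : R) : I x -> I y ->
  chord_kernel x y <= 12 * (1 - \sum_(i < 8) \1_(arc i) x * \1_(arc i) y).
Proof.
move=> Ix Iy; rewrite /chord_kernel; set u := cos _.
have u1 : -1 <= u <= 1 by rewrite cos_geN1 cos_le1.
have n0 : (0 < 8)%N by [].
have [[i [xi yi]]|no] := pselect (exists i : 'I_8, arc i x /\ arc i y).
  have hu : 2^-1 <= u.
    apply: cos_ge_half; apply: (le_trans (arc_diam n0 xi yi)).
    by have := pi_lt4; rewrite ler_pdivrMr ?ltr0n//; lra.
  have u2 : 2^-1 <= u <= 1 by rewrite hu; case/andP: u1.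
  have s1 : \sum_(j < 8) \1_(arc j) x * \1_(arc j) y <= 1 :> R.
    rewrite -(sum_arc n0 Ix); apply: ler_sum => j _.
    by rewrite ler_piMr// ?indicE//; case: (_ \in _).
  by have := chord_poly_le0 u2; lra.
rewrite big1 ?subr0 ?mulr1; first exact: chord_poly_le.
move=> i _; rewrite !indicE; case: (boolP (x \in _)) => xi; rewrite ?mul0r//.
case: (boolP (y \in _)) => yi; rewrite ?mulr0//.
by case: no; exists i; split; exact: set_mem.
Qed.

(** The kernel as 4 + 2 cos 2 theta - 6 cos theta, with the variables separated: against g(x) g(y)
    it integrates to 4 q^2 + 2 |Z_2|^2 - 6 |Z_1|^2, where q is the mass and Z_k the moments of g. *)
Lemma chord_kernelE (x y : R) : chord_kernel x y = 4 +
  2 * Re ((expi y ^+ 2)^*%C * expi x ^+ 2) - 6 * Re (((expi y)^*)%C * expi x).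
Proof.
have E1 : ((expi y)^*)%C * expi x = expi (x - y) by rewrite expi_conj mulrC expiD.
have E2 : ((expi y ^+ 2)^*)%C * expi x ^+ 2 = expi ((x - y) + (x - y)).
  by rewrite expiD -E1 !expr2 conjM; ring.
rewrite E1 E2 /= cosD /chord_kernel -!expr2; have := cos2Dsin2 (x - y); lra.
Qed.

Lemma Re_CI (z : C) (h : R -> C) (g : R -> R) : cbm h -> bm g ->
  RI I (fun t => Re (z * h t) * g t) = Re (z * CI I (fun t => h t * (g t)%:C%C)).
Proof.
move=> ch bg; have fI := @fmeas_I R.
rewrite -CI_Z//; last by apply: cbmM => //; exact: cbm_real.
by apply: RI_eq => t _; rewrite mulrA [in RHS]ReM /= mulr0 subr0.
Qed.

Lemma Re_conj_mul (z w : C) : Re ((z^*)%C * w) = Re ((w^*)%C * z).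
Proof. by rewrite !ReM !Re_conj !Im_conj; ring. Qed.

Definition arc_mass (g : R -> R) (i : 'I_8) : R := RI I (fun t => \1_(arc i) t * g t).
Definition moment (g : R -> R) (k : nat) : C := CI I (fun t => expi t ^+ k * (g t)%:C%C).

(** [chord_kernel_le] integrated against g(x) g(y); q^2 minus the squares of the arc masses is the
    mass of the pairs in different arcs. The integrations are done one after the other, [inner]
    being the first, so no product measure is needed. *)
Lemma cell_variation (g : R -> R) : bm g -> (forall t, 0 <= g t <= 1) ->
  4 * RI I g ^+ 2 + 2 * N (moment g 2) ^+ 2 - 6 * N (moment g 1) ^+ 2 <=
  12 * (RI I g ^+ 2 - \sum_(i < 8) arc_mass g i ^+ 2).
Proof.
set q := RI I g; set a := arc_mass g; set Z := moment g.
move=> bg g01; have fI := @fmeas_I R; have cx := @cbm_expi R.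
have cx1 : cbm (fun t : R => expi t ^+ 1 : C) by under eq_fun do rewrite expr1.
have cx2 : cbm (fun t : R => expi t ^+ 2 : C) by under eq_fun do rewrite expr2; exact: cbmM.
have bi (i : 'I_8) : bm (\1_(arc i) : R -> R) := bm_indic (measurable_arc i).
have bci (i : 'I_8) y : bm (fun t : R => \1_(arc i) t * \1_(arc i) y : R) by apply: bmM => //; exact: bm_cst.
have bia (i : 'I_8) : bm (fun t => \1_(arc i) t * g t) by exact: bmM.
pose L y := 4 * q + 2 * Re ((Z 2%N)^*%C * expi y ^+ 2) - 6 * Re ((Z 1%N)^*%C * expi y ^+ 1).
have inner y : I y -> L y <= 12 * (q - \sum_(i < 8) a i * \1_(arc i) y).
  move=> Iy.
  pose h1 t := Re ((expi y ^+ 2)^*%C * expi t ^+ 2) * g t.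
  pose h2 t := Re ((expi y ^+ 1)^*%C * expi t ^+ 1) * g t.
  have b1 : bm h1 by apply: bmM => //; exact: (cbmM (cbm_cst _) cx2).1.
  have b2 : bm h2 by apply: bmM => //; exact: (cbmM (cbm_cst _) cx1).1.
  have -> : L y = RI I (fun t => 4 * g t + 2 * h1 t - 6 * h2 t).
    have bz (k : R) h : bm h -> bm (fun t => k * h t) by move=> bh; apply: bmM => //; exact: bm_cst.
    rewrite (RI_B fI (bmD (bz 4 _ bg) (bz 2 _ b1)) (bz 6 _ b2)) (RI_D fI (bz 4 _ bg) (bz 2 _ b1)).
    rewrite (RI_Z _ fI bg) (RI_Z _ fI b1) (RI_Z _ fI b2) (Re_CI _ cx2 bg) (Re_CI _ cx1 bg).
    by rewrite /L (Re_conj_mul (Z 2%N)) (Re_conj_mul (Z 1%N)).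
  have -> : 12 * (q - \sum_(i < 8) a i * \1_(arc i) y) =
     RI I (fun t => 12 * (g t - \sum_(i < 8) \1_(arc i) y * (\1_(arc i) t * g t))).
    have bis (i : 'I_8) : bm (fun t => \1_(arc i) y * (\1_(arc i) t * g t)) by apply: bmM => //; exact: bm_cst.
    have [bs sE] := @RI_sum _ I _ (index_enum 'I_8) predT (fun i t => \1_(arc i) y * (\1_(arc i) t * g t)) fI bis.
    rewrite (RI_Z _ fI (bmB bg bs)) (RI_B fI bg bs) sE; congr (_ * (_ - _)).
    by apply: eq_bigr => i _; rewrite (RI_Z _ fI (bia i)) mulrC.
  apply: RI_le => //.
  - by apply: bmB; [apply: bmD; apply: bmM => //; exact: bm_cst|apply: bmM => //; exact: bm_cst].
  - have bis (i : 'I_8) : bm (fun t => \1_(arc i) y * (\1_(arc i) t * g t)) by apply: bmM => //; exact: bm_cst.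
    have [bs _] := @RI_sum _ I _ (index_enum 'I_8) predT (fun i t => \1_(arc i) y * (\1_(arc i) t * g t)) fI bis.
    by apply: bmM; [exact: bm_cst|exact: bmB].
  move=> t It; have /andP[g0 g1] := g01 t.
  have := chord_kernel_le It Iy; rewrite chord_kernelE => H.
  have {H} := ler_wpM2r g0 H.
  have -> : 12 * (1 - \sum_(i < 8) \1_(arc i) t * \1_(arc i) y) * g t =
     12 * (g t - \sum_(i < 8) \1_(arc i) y * (\1_(arc i) t * g t)).
    rewrite -mulrA mulrBl mul1r mulr_suml; congr (_ * (_ - _)).
    by apply: eq_bigr => i _; ring.
  by rewrite /h1 /h2 !expr1; apply: le_trans; rewrite le_eqVlt; apply/orP; left; apply/eqP; ring.
have bL : bm L.
  apply: bmB; last by apply: bmM; [exact: bm_cst|exact: (cbmM (cbm_cst _) cx1).1].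
  by apply: bmD; [exact: bm_cst|apply: bmM; [exact: bm_cst|exact: (cbmM (cbm_cst _) cx2).1]].
have bis (i : 'I_8) : bm (fun y => a i * \1_(arc i) y) by apply: bmM => //; exact: bm_cst.
have [bs _] := @RI_sum _ I _ (index_enum 'I_8) predT (fun i y => a i * \1_(arc i) y) fI bis.
have bRt : bm (fun y => 12 * (q - \sum_(i < 8) a i * \1_(arc i) y)).
  by apply: bmM; [exact: bm_cst|apply: bmB => //; exact: bm_cst].
have : RI I (fun y => L y * g y) <= RI I (fun y => 12 * (q - \sum_(i < 8) a i * \1_(arc i) y) * g y).
  apply: RI_le => //; [exact: bmM|exact: bmM|].
  by move=> y Iy; have /andP[g0 _] := g01 y; rewrite ler_wpM2r// inner.
have -> : RI I (fun y => L y * g y) = 4 * q ^+ 2 + 2 * N (Z 2%N) ^+ 2 - 6 * N (Z 1%N) ^+ 2.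
  pose h1 t := Re ((Z 2%N)^*%C * expi t ^+ 2) * g t.
  pose h2 t := Re ((Z 1%N)^*%C * expi t ^+ 1) * g t.
  have b1 : bm h1 by apply: bmM => //; exact: (cbmM (cbm_cst _) cx2).1.
  have b2 : bm h2 by apply: bmM => //; exact: (cbmM (cbm_cst _) cx1).1.
  have bz (k : R) h : bm h -> bm (fun t => k * h t) by move=> bh; apply: bmM => //; exact: bm_cst.
  transitivity (RI I (fun t => 4 * q * g t + 2 * h1 t - 6 * h2 t)).
    by apply: RI_eq => t _; rewrite /L /h1 /h2; ring.
  rewrite (RI_B fI (bmD (bz (4 * q) _ bg) (bz 2 _ b1)) (bz 6 _ b2)) (RI_D fI (bz (4 * q) _ bg) (bz 2 _ b1)).
  rewrite (RI_Z _ fI bg) (RI_Z _ fI b1) (RI_Z _ fI b2) (Re_CI _ cx2 bg) (Re_CI _ cx1 bg).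
  by rewrite -/(Z 2%N) -/(Z 1%N) !(mulrC ((Z _)^*)%C) !mul_conj /= -/q; ring.
have -> // : RI I (fun y => 12 * (q - \sum_(i < 8) a i * \1_(arc i) y) * g y) = 12 * (q ^+ 2 - \sum_(i < 8) a i ^+ 2).
have biag (i : 'I_8) : bm (fun t => a i * (\1_(arc i) t * g t)) by apply: bmM => //; exact: bm_cst.
have [bs' sE'] := @RI_sum _ I _ (index_enum 'I_8) predT (fun i t => a i * (\1_(arc i) t * g t)) fI biag.
transitivity (RI I (fun t => 12 * (q * g t - \sum_(i < 8) a i * (\1_(arc i) t * g t)))).
  apply: RI_eq => t _; rewrite -mulrA; congr (_ * _); rewrite mulrBl mulr_suml; congr (_ - _).
  by apply: eq_bigr => i _; rewrite mulrA.
have bqg : bm (fun t => q * g t) by apply: bmM => //; exact: bm_cst.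
rewrite (RI_Z _ fI (bmB bqg bs')) (RI_B fI bqg bs') (RI_Z _ fI bg) sE' -/q expr2; congr (_ * (_ - _)).
by apply: eq_bigr => i _; rewrite (RI_Z _ fI (bia i)) expr2.
Qed.
End EntropyStep.

(** * The entropy gained by one inner function, and along an orbit *)

Section InnerStep.
Context {R : realType}.
Local Notation C := R[i].
Local Notation mu := (@lebesgue_measure R).
Local Notation I := (seg 0 (2 * pi) : set R).

(** Disjointness and covering in a single equation, which can be integrated term by term; cells may
    be empty. *)
Definition disjoint_cover (T : finType) (P : T -> set R) :=
  (forall l, measurable (P l)) /\ forall t, I t -> \sum_l \1_(P l) t = 1 :> R.

Lemma indic01 (A : set R) t : 0 <= (\1_A t : R) <= 1.
Proof. by rewrite indicE; case: (_ \in _); rewrite ?lexx ?ler01. Qed.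

(** With p = pi, n = |f'(0)| and X the sum of tested second moments, the left side is at most 2 p -
    (p / 3) (1 - n^2) (2 - n^2) plus the error in e. Moreover (1 - n^2) (2 - n^2) exceeds 1 - n by
    (1 - n) (n + (1 - n^2) (1 + n)), which is nonnegative. *)
Lemma variation_estimate (p n X e : R) : 0 < p -> 0 <= n -> n <= 1 ->
  2 * p * n ^+ 4 - 2 * e * (2 * p) <= X ->
  (1 - 12^-1 * (4 - 2 * n ^+ 4 - 6 * n ^+ 2)) * (2 * p) - 3^-1 * X <=
  2 * p - p / 3 * (1 - n) + 4 * p / 3 * e.
Proof.
move=> p0 n0 n1 hX.
have h : 0 <= p * ((1 - n) * (n + (1 - n ^+ 2) * (1 + n))).
  rewrite mulr_ge0 ?(ltW p0)// mulr_ge0 ?subr_ge0// addr_ge0// mulr_ge0 ?subr_ge0 ?expr_le1//.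
  by rewrite addr_ge0.
have E : n ^+ 4 = n ^+ 2 * n ^+ 2 by rewrite -exprD.
nra.
Qed.

Section OneStep.
Variables (f : C -> C) (tau : R -> R) (d : C).
Hypothesis hf : cinner f tau d.

Let mt : measurable_fun [set: R] tau. Proof. by have [_ _ _ _ []] := hf. Qed.
Let tI t : I (tau t).
Proof. by have [_ _ _ _ [_ ti _]] := hf; apply/segE; exact: ti. Qed.

Definition pull (P : set R) (t : R) : R := \1_P (tau t).

Lemma bm_pull P : measurable P -> bm (pull P).
Proof. by move=> mP; exact: (bm_comp (bm_indic mP) mt). Qed.
Lemma pull01 P t : 0 <= pull P t <= 1. Proof. exact: indic01. Qed.

Lemma sum_mass (T : finType) (P : T -> set R) : disjoint_cover P ->
  \sum_l RI I (pull (P l)) = 2 * pi.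
Proof.
move=> [mP sP]; have fI := @fmeas_I R.
have [_ <-] := @RI_sum _ I _ (index_enum T) predT (fun l => pull (P l)) fI (fun l => bm_pull (mP l)).
transitivity (RI I (fun=> 1)); last by rewrite (RI_cst 1 fI) meas_I mul1r.
by apply: RI_eq => t _; rewrite /pull sP.
Qed.

Lemma arc_mass_bounds g i : bm g -> (forall t, 0 <= g t <= 1) -> 0 <= arc_mass g i <= RI I g.
Proof.
move=> bg g01; have fI := @fmeas_I R; apply/andP; split.
  apply: RI_ge0 => t _; have /andP[h1 _] := indic01 (arc i) t; have /andP[h2 _] := g01 t.
  exact: mulr_ge0.
apply: (RI_le fI (bmM (bm_indic (measurable_arc i)) bg) bg) => t _.
have /andP[_ h1] := indic01 (arc i) t; have /andP[h2 _] := g01 t.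
exact: ler_piMl.
Qed.

Lemma sum_arc_mass g : bm g -> \sum_(i < 8) arc_mass g i = RI I g.
Proof.
move=> bg; have fI := @fmeas_I R.
have bi (i : 'I_8) : bm (fun t => \1_(arc i) t * g t) := bmM (bm_indic (measurable_arc i)) bg.
have [_ <-] := @RI_sum _ I _ (index_enum 'I_8) predT (fun i t => \1_(arc i) t * g t) fI bi.
by apply: RI_eq => t It; rewrite -mulr_suml sum_arc// mul1r.
Qed.

Lemma moment_bound g k : bm g -> (forall t, 0 <= g t <= 1) -> N (moment g k) <= RI I g.
Proof.
move=> bg g01; have fI := @fmeas_I R; apply: N_CI_le => //.
  apply: cbmM; last exact: cbm_real.
  elim: k => [|k IH]; first by under eq_fun do rewrite expr0; exact: cbm_cst.
  by under eq_fun do rewrite exprS; apply: cbmM => //; exact: cbm_expi.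
move=> t _; have /andP[g0 _] := g01 t.
by rewrite NM NX N_expi expr1n mul1r N_real ger0_norm.
Qed.

(** [inner_twist] moves the moment to P itself with the factor conj d, and the trivial bound is
    applied there. *)
Lemma moment1_bound P : measurable P -> N (moment (pull P) 1) <= N d * RI I (pull P).
Proof.
move=> mP; rewrite (inner_preserves hf mP) /moment.
under CI_eq do rewrite expr1.
rewrite (inner_twist hf mP) NM N_conj ler_wpM2l ?N_ge0//.
have := @moment_bound (\1_P) 1 (bm_indic mP) (indic01 P); rewrite /moment.
by under CI_eq do rewrite expr1.
Qed.

(** [cell_variation] divided by the mass q. The quotient |Z|^2 / q of the second moment Z is
    replaced by its lower bound 2 Re (conj c Z) - |c|^2 q, valid for every c and linear in Z and q,
    so that it can be summed over cells. *)
Lemma pointwise_variation P (c : C) : measurable P ->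
  \sum_(i < 8) arc_mass (pull P) i ^+ 2 / RI I (pull P) <=
  RI I (pull P) - 12^-1 * (4 * RI I (pull P) +
    2 * (2 * Re ((c^*)%C * moment (pull P) 2) - N c ^+ 2 * RI I (pull P)) -
    6 * N d ^+ 2 * RI I (pull P)).
Proof.
move=> mP; have bg := bm_pull mP; have g01 := pull01 P.
have CV := cell_variation bg g01; have M1 := moment1_bound mP; have M2 := moment_bound 2 bg g01.
have AM i := arc_mass_bounds i bg g01.
rewrite -mulr_suml; move: CV M1 M2 AM; set g := pull P; set q := RI I g.
set A := \sum_(i < 8) _; set Z1 := moment g 1; set Z2 := moment g 2 => CV M1 M2 AM.
have q0 : 0 <= q by have /andP[h1 h2] := AM ord0; exact: le_trans h2.
have cs : Re ((c^*)%C * Z2) <= N c * N Z2.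
  by apply: le_trans (ler_norm _) _; apply: le_trans (N_Re _) _; rewrite NM N_conj.
have [qE|qn] := eqVneq q 0.
  have Z0 : N Z2 = 0 by apply/eqP; rewrite eq_le N_ge0 andbT -qE.
  rewrite qE invr0 !mulr0; rewrite Z0 mulr0 in cs; lra.
have qp : 0 < q by rewrite lt_def qn.
rewrite ler_pdivrMr//.
have h1 : N Z1 ^+ 2 <= N d ^+ 2 * q ^+ 2.
  by rewrite -exprMn ler_sqr ?nnegrE ?N_ge0 ?mulr_ge0 ?N_ge0.
have h2 : (2 * Re ((c^*)%C * Z2) - N c ^+ 2 * q) * q <= N Z2 ^+ 2.
  have h3 := sqr_ge0 (N Z2 - N c * q).
  have h4 : Re ((c^*)%C * Z2) * q <= N c * N Z2 * q by rewrite ler_wpM2r.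
  lra.
lra.
Qed.

(* inner_twist controls the first coefficients; the second ones are tested against the
   squares of conj d * x, x in the image cell, and CI_second_moment, the mean of
   (f(z) / z) ^ 2, is used. *)
Lemma fine_variation (T : finType) (P : T -> set R) (s : T -> R) (e : R) : disjoint_cover P ->
  (forall l t, I t -> P l t -> N (expi t - expi (s l)) <= e) ->
  \sum_l \sum_(i < 8) arc_mass (pull (P l)) i ^+ 2 / RI I (pull (P l)) <=
  2 * pi - pi / 3 * (1 - N d) + 4 * pi / 3 * e.
Proof.
move=> dP hs; have [mP sP] := dP; have fI := @fmeas_I R; have cx := @cbm_expi R.
pose c l : C := ((d^*)%C * expi (s l)) ^+ 2.
pose W l t : C := (c l)^*%C * (expi t ^+ 2 * (pull (P l) t)%:C%C).
have cx2 : cbm (fun t : R => expi t ^+ 2 : C) by under eq_fun do rewrite expr2; exact: cbmM.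
have cg l : cbm (fun t => expi t ^+ 2 * (pull (P l) t)%:C%C).
  by apply: cbmM => //; apply: cbm_real; exact: bm_pull.
have cW l : cbm (W l) by apply: cbmM; [exact: cbm_cst|exact: cg].
have [cS SE] := @CI_sum _ I _ (index_enum T) predT W fI cW.
have WE l : CI I (W l) = (c l)^*%C * moment (pull (P l)) 2 by rewrite (CI_Z _ fI (cg l)).
have Nd := N_deriv0 hf; have Nd0 := N_ge0 d.
have Nc l : N (c l) = N d ^+ 2 by rewrite NX NM N_conj N_expi mulr1.
(* The integrand [W l] with the exact image point y = expi (tau t) in place of the sample point:
   conj c x^2 becomes d^2 times the conjugate of (y conj x)^2, whose mean is known. *)
pose V t : C := d ^+ 2 * (((expi (tau t) * ((expi t)^*)%C) ^+ 2)^*)%C.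
have cq : cbm (fun t => (expi (tau t) * ((expi t)^*)%C) ^+ 2 : C).
  under eq_fun do rewrite expr2.
  have h : cbm (fun t => expi (tau t) * ((expi t)^*)%C : C).
    by apply: cbmM; [exact: (cbm_comp cx mt)|exact: cbm_conj].
  exact: cbmM.
have cV : cbm V by apply: cbmM; [exact: cbm_cst|exact: cbm_conj].
have VE : Re (CI I V) = 2 * pi * N d ^+ 4.
  rewrite (CI_Z _ fI (cbm_conj cq)) (CI_conj fI cq) (CI_second_moment hf) conjM conjc_real.
  rewrite mulrCA mul_conj -rmorphM /= NX -exprM.
  by [].
(* On each preimage the sample point is within e of y, and squares of unit numbers differ by at most
   twice their distance. *)
have diff : N (CI I (fun t => \sum_l W l t) - CI I V) <= 2 * e * (2 * pi).
  rewrite -(CI_B fI cS cV) -[X in _ <= _ * X]meas_I; apply: N_CI => //; first exact: cbmB.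
  move=> t It.
  have -> : V t = \sum_l (V t * (pull (P l) t)%:C%C).
    rewrite -mulr_sumr -(rmorph_sum (real_complex R)) /=.
    by rewrite /pull sP// mulr1.
  rewrite -sumrB.
  have -> : 2 * e = \sum_l 2 * e * pull (P l) t by rewrite -mulr_sumr /pull sP// mulr1.
  have Nsum (F : T -> C) (r : seq T) : N (\sum_(l <- r) F l) <= \sum_(l <- r) N (F l).
    elim: r => [|x r IH]; first by rewrite !big_nil N0.
    by rewrite !big_cons; apply: le_trans (ND _ _) _; rewrite lerD2l.
  apply: le_trans (Nsum _ _) _; apply: ler_sum => l _.
  have -> : W l t - V t * (pull (P l) t)%:C%C =
     ((c l)^*%C * expi t ^+ 2 - V t) * (pull (P l) t)%:C%C by rewrite /W; ring.
  have /andP[g0 _] := pull01 (P l) t.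
  rewrite NM N_real (ger0_norm g0) /pull indicE.
  case: (boolP (tau t \in P l)) => [/set_mem Pt|_]; last by rewrite !mulr0.
  rewrite !mulr1 /V /c.
  have -> : ((((d^*)%C * expi (s l)) ^+ 2)^*)%C * expi t ^+ 2 -
      d ^+ 2 * (((expi (tau t) * ((expi t)^*)%C) ^+ 2)^*)%C =
      d ^+ 2 * expi t ^+ 2 * (((expi (s l) - expi (tau t))^*)%C * ((expi (s l) + expi (tau t))^*)%C).
    by rewrite !expr2 !conjM !conjcK !conjD !conjN; ring.
  rewrite NM (NM (d ^+ 2)) (NX d) (NX (expi t)) NM !N_conj N_expi expr1n mulr1.
  have h1 := hs l (tau t) (tI t) Pt; rewrite NB in h1.
  have h2 : N (expi (s l) + expi (tau t)) <= 2.
    by apply: le_trans (ND _ _) _; rewrite !N_expi.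
  have h3 : N d ^+ 2 <= 1 by rewrite expr_le1.
  have h4 : N (expi (s l) - expi (tau t)) * N (expi (s l) + expi (tau t)) <= e * 2.
    by rewrite ler_pM ?N_ge0.
  rewrite (mulrC 2 e); apply: le_trans h4; rewrite ler_piMl// mulr_ge0 ?N_ge0//.
have sumZ : 2 * pi * N d ^+ 4 - 2 * e * (2 * pi) <= \sum_l Re ((c l)^*%C * moment (pull (P l)) 2).
  have -> : \sum_l Re ((c l)^*%C * moment (pull (P l)) 2) = Re (CI I (fun t => \sum_l W l t)).
    rewrite SE (eq_bigr (fun l => (c l)^*%C * moment (pull (P l)) 2)) => [|l _]; last exact: WE.
    by elim/big_rec2: _ => // l x y _ ->; rewrite ReD.
  rewrite -VE; have := le_trans (N_Re _) diff; rewrite ReD ReN ler_norml => /andP[h _].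
  by lra.
have sq := sum_mass dP.
apply: (@le_trans _ _ (\sum_l (RI I (pull (P l)) - 12^-1 * (4 * RI I (pull (P l)) +
    2 * (2 * Re ((c l)^*%C * moment (pull (P l)) 2) - N (c l) ^+ 2 * RI I (pull (P l))) -
    6 * N d ^+ 2 * RI I (pull (P l)))))).
  by apply: ler_sum => l _; exact: pointwise_variation.
have -> : \sum_l (RI I (pull (P l)) - 12^-1 * (4 * RI I (pull (P l)) +
    2 * (2 * Re ((c l)^*%C * moment (pull (P l)) 2) - N (c l) ^+ 2 * RI I (pull (P l))) -
    6 * N d ^+ 2 * RI I (pull (P l)))) =
    (1 - 12^-1 * (4 - 2 * N d ^+ 4 - 6 * N d ^+ 2)) * (\sum_l RI I (pull (P l))) -
    3^-1 * \sum_l Re ((c l)^*%C * moment (pull (P l)) 2).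
  rewrite !mulr_sumr -sumrB; apply: eq_bigr => l _; rewrite Nc.
  by have -> : (12 : R)^-1 = 3^-1 / 4; [field|move: (3^-1) => k; field].
rewrite sq; set X := \sum_l _ in sumZ *; have p0 := pi_gt0 R.
exact: (variation_estimate p0 Nd0 Nd sumZ).
Qed.

Lemma arc_mass_eq0 g i : bm g -> (forall t, 0 <= g t <= 1) -> RI I g = 0 -> arc_mass g i = 0.
Proof.
move=> bg g01 g0; apply/eqP; rewrite eq_le; have := arc_mass_bounds i bg g01.
by rewrite g0 andbC.
Qed.

(* Refining the cover by short arcs only increases the left-hand side. *)
Lemma cover_variation (T : finType) (Q : T -> set R) : disjoint_cover Q ->
  \sum_m \sum_(i < 8) arc_mass (pull (Q m)) i ^+ 2 / RI I (pull (Q m)) <=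
  2 * pi - pi / 3 * (1 - N d).
Proof.
move=> [mQ sQ]; have fI := @fmeas_I R; have p0 := pi_gt0 R.
apply/ler_addgt0Pr => e e0.
have [k hk] : exists k, 4 * pi / 3 * (2 * pi / k.+2%:R) <= e :> R.
  have : 4 * pi / 3 * (2 * pi) * n.+2%:R^-1 @[n --> \oo] --> (4 * pi / 3 * (2 * pi) * 0 : R).
    by apply: cvgMr; exact: harmonic2_cvg.
  rewrite mulr0 => /cvgrPdist_lt/(_ _ e0)[n _ /(_ n (leqnn n))].
  rewrite sub0r normrN => h; exists n; rewrite mulrA; exact: le_trans (ler_norm _) (ltW h).
pose K := k.+2.
pose P (ml : T * 'I_K) := Q ml.1 `&` @arc R K ml.2.
have mP ml : measurable (P ml) by apply: measurableI => //; exact: measurable_arc.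
have indP m l t : \1_(P (m, l)) t = \1_(Q m) t * \1_(@arc R K l) t :> R.
  by rewrite !indicE in_setI; case: (t \in Q m); case: (t \in arc l); rewrite ?mulr1 ?mulr0.
have K0 : (0 < K)%N by [].
have dP : disjoint_cover P.
  split=> // t It; rewrite -(sQ t It) -(pair_bigA _ (fun m l => \1_(P (m, l)) t)) /=.
  apply: eq_bigr => m _; rewrite (eq_bigr (fun l => \1_(Q m) t * \1_(@arc R K l) t)) => [|l _]; last exact: indP.
  by rewrite -mulr_sumr sum_arc// mulr1.
have := @fine_variation _ P (fun ml => 2 * pi * ml.2%:R / K%:R) (2 * pi / K%:R) dP.
have hs ml t : I t -> P ml t -> N (expi t - expi (2 * pi * ml.2%:R / K%:R)) <= 2 * pi / K%:R.
  move=> It [_ at']; apply: (le_trans (N_expiB _ _)); apply: (arc_diam K0 at').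
  apply/segE; rewrite lexx /= ltr_pM2r ?invr_gt0 ?ltr0n// ltr_pM2l ?twopi_gt0//.
  by rewrite ltr_nat.
move=> /(_ hs) H; apply: le_trans (le_trans H _); last by rewrite lerD2l.
rewrite -(pair_bigA _ (fun m l => \sum_(i < 8) arc_mass (pull (P (m, l))) i ^+ 2 / RI I (pull (P (m, l))))) /=.
apply: ler_sum => m _; rewrite exchange_big /=; apply: ler_sum => i _.
have pullE l : pull (P (m, l)) = (fun t => pull (Q m) t * \1_(@arc R K l) (tau t)).
  by apply/funext => t; rewrite /pull indP.
have bq := bm_pull (mQ m).
have bml l := bm_pull (mP (m, l)).
have sum_pull t : \sum_l pull (P (m, l)) t = pull (Q m) t.
  under eq_bigr do rewrite pullE.
  by rewrite -mulr_sumr sum_arc// mulr1.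
have -> : RI I (pull (Q m)) = \sum_l RI I (pull (P (m, l))).
  have [_ <-] := @RI_sum _ I _ (index_enum 'I_K) predT (fun l => pull (P (m, l))) fI bml.
  by apply: RI_eq => t _; rewrite sum_pull.
have -> : arc_mass (pull (Q m)) i = \sum_l arc_mass (pull (P (m, l))) i.
  have ba l : bm (fun t => \1_(arc i) t * pull (P (m, l)) t) := bmM (bm_indic (measurable_arc i)) (bml l).
  have [_ <-] := @RI_sum _ I _ (index_enum 'I_K) predT (fun l t => \1_(arc i) t * pull (P (m, l)) t) fI ba.
  by apply: RI_eq => t _; rewrite -mulr_sumr sum_pull.
apply: sqr_sum_div_le => l.
  by apply: RI_ge0 => t _; have /andP[] := pull01 (P (m, l)) t.
by apply: arc_mass_eq0 => //; exact: pull01.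
Qed.

Lemma entropy_step (T : finType) (Q : T -> set R) : disjoint_cover Q ->
  pi / 3 * (1 - N d) <= \sum_m \sum_(i < 8) entropy_term (arc_mass (pull (Q m)) i) -
    \sum_m entropy_term (RI I (\1_(Q m) : R -> R)).
Proof.
move=> dQ; have [mQ sQ] := dQ; have V := cover_variation dQ; have S := sum_mass dQ.
rewrite -sumrB; apply: (@le_trans _ _ (\sum_m (RI I (pull (Q m)) -
    \sum_(i < 8) arc_mass (pull (Q m)) i ^+ 2 / RI I (pull (Q m))))).
  by rewrite sumrB S; lra.
apply: ler_sum => m _; rewrite -(inner_preserves hf (mQ m)).
have bq := bm_pull (mQ m).
apply: entropy_term_split; last exact: sum_arc_mass.
by move=> i; have /andP[] := arc_mass_bounds i bq (pull01 (Q m)).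
Qed.
End OneStep.

Fixpoint orbit_map (sigma : nat -> R -> R) (n : nat) (t : R) : R :=
  if n is m.+1 then sigma m (orbit_map sigma m t) else t.

Definition shift_seq (T : Type) (u : nat -> T) (n : nat) : T := u n.+1.

(** Peels off the first map where the definition peels off the last; the induction on the number of
    maps adds a time at the beginning of the orbit. *)
Lemma orbit_map_shift sigma n t : orbit_map sigma n.+1 t = orbit_map (shift_seq sigma) n (sigma 0%N t).
Proof. by elim: n => //= n <-. Qed.

Definition arc_cell (sigma : nat -> R -> R) n (k : {ffun 'I_n.+1 -> 'I_8}) : set R :=
  [set t | forall j : 'I_n.+1, arc (k j) (orbit_map sigma j t)].

Definition ffun_cons n (i : 'I_8) (k : {ffun 'I_n.+1 -> 'I_8}) : {ffun 'I_n.+2 -> 'I_8} :=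
  [ffun j => if unlift ord0 j is Some j' then k j' else i].

Lemma arc_cell_cons sigma n i k : arc_cell sigma (@ffun_cons n i k) =
  arc i `&` sigma 0%N @^-1` (arc_cell (shift_seq sigma) k).
Proof.
rewrite predeqE => t; split=> [H|[H1 H2] j].
  split; first by have := H ord0; rewrite ffunE unlift_none.
  by move=> j; have := H (lift ord0 j); rewrite ffunE liftK lift0 orbit_map_shift.
rewrite ffunE; case: unliftP => [j' ->|->] //.
by rewrite lift0 orbit_map_shift; exact: H2.
Qed.

Lemma sum_ffun_cons n (F : {ffun 'I_n.+2 -> 'I_8} -> R) :
  \sum_k F k = \sum_(k : {ffun 'I_n.+1 -> 'I_8}) \sum_i F (ffun_cons i k).
Proof.
rewrite pair_bigA /=.
rewrite (reindex (fun p : {ffun 'I_n.+1 -> 'I_8} * 'I_8 => ffun_cons p.2 p.1)) //=.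
exists (fun k : {ffun 'I_n.+2 -> 'I_8} => ([ffun j => k (lift ord0 j)], k ord0)).
  move=> [k i] _ /=; congr (_, _); last by rewrite ffunE unlift_none.
  by apply/ffunP => j; rewrite !ffunE liftK.
move=> k _; apply/ffunP => j; rewrite ffunE /=; case: unliftP => [j' ->|->] //.
by rewrite ffunE.
Qed.

Lemma measurable_orbit_map (sigma : nat -> R -> R) n : (forall j, measurable_fun [set: R] (sigma j)) ->
  measurable_fun [set: R] (orbit_map sigma n).
Proof. by move=> ms; elim: n => [|n IH]; [exact: measurable_id|exact: measurableT_comp]. Qed.

Lemma measurable_arc_cell sigma n k : (forall j, measurable_fun [set: R] (sigma j)) ->
  measurable (@arc_cell sigma n k).
Proof.
move=> ms.
have -> : arc_cell sigma k = \bigcap_(j in [set: 'I_n.+1]) (orbit_map sigma j @^-1` arc (k j)).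
  by rewrite predeqE => t; split=> [H j _|H j]; [exact: H|apply: H].
apply: fin_bigcap_measurable => // j _.
rewrite -[X in measurable X]setTI; apply: measurable_orbit_map => //; exact: measurable_arc.
Qed.

Lemma sum_ffun0 (F : {ffun 'I_1 -> 'I_8} -> R) : \sum_k F k = \sum_i F [ffun=> i].
Proof.
rewrite (reindex (fun i : 'I_8 => [ffun=> i] : {ffun 'I_1 -> 'I_8})) //=.
exists (fun k : {ffun 'I_1 -> 'I_8} => k ord0) => [i _|k _]; first by rewrite ffunE.
by apply/ffunP => j; rewrite ffunE (ord1 j).
Qed.

Lemma arc_cell_cover sigma n : (forall j, measurable_fun [set: R] (sigma j)) ->
  (forall j t, I (sigma j t)) -> disjoint_cover (@arc_cell sigma n).
Proof.
move=> ms sI; split=> [k|]; first exact: measurable_arc_cell.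
elim: n sigma ms sI => [|n IH] sigma ms sI t It.
  rewrite sum_ffun0 -(sum_arc (isT : (0 < 8)%N) It); apply: eq_bigr => i _.
  congr (\1_(_) t); rewrite predeqE => s; split=> [H|H j].
    by have := H ord0; rewrite ffunE.
  by rewrite ffunE (ord1 j).
rewrite sum_ffun_cons -(IH (shift_seq sigma) (fun j => ms j.+1) (fun j => sI j.+1) _ (sI 0%N t)).
apply: eq_bigr => k _.
rewrite (eq_bigr (fun i => \1_(@arc R 8 i) t * \1_(arc_cell (shift_seq sigma) k) (sigma 0%N t))).
  by rewrite -mulr_suml sum_arc// mul1r.
move=> i _; rewrite arc_cell_cons !indicE in_setI.
have -> : (t \in sigma 0%N @^-1` arc_cell (shift_seq sigma) k) = (sigma 0%N t \in arc_cell (shift_seq sigma) k).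
  by apply/idP/idP => /set_mem h; exact/mem_set.
by case: (t \in _); case: (_ \in _); rewrite ?mulr1 ?mulr0.
Qed.

Definition arc_entropy sigma n : R :=
  \sum_(k : {ffun 'I_n.+1 -> 'I_8}) entropy_term (RI I (\1_(arc_cell sigma k) : R -> R)).

(* The induction removes the first map: the cells of the shifted sequence are pulled back
   by sigma 0 and cut by the 8 arcs. *)
Lemma arc_entropy_ge (f : nat -> C -> C) (sigma : nat -> R -> R) (d : nat -> C) n :
  (forall j, cinner (f j) (sigma j) (d j)) ->
  pi / 3 * \sum_(j < n) (1 - N (d j)) <= arc_entropy sigma n.
Proof.
have fI := @fmeas_I R.
elim: n f sigma d => [|n IH] f sigma d hf; have ms j : measurable_fun [set: R] (sigma j) by have [_ _ _ _ []] := hf j.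
  rewrite big_ord0 mulr0; apply: sumr_ge0 => k _; apply: entropy_term_ge0.
  have mA := measurable_arc_cell k ms.
  apply/andP; split; first by apply: RI_ge0 => t _; have /andP[] := indic01 (arc_cell sigma k) t.
  apply: (@le_trans _ _ (RI I (fun=> 1))); last by rewrite (RI_cst 1 fI) meas_I mul1r.
  by apply: (RI_le fI (bm_indic mA) (bm_cst 1)) => t _; have /andP[] := indic01 (arc_cell sigma k) t.
have sI j t : I (sigma j t) by have [_ _ _ _ [_ h _]] := hf j; apply/segE; exact: h.
have {}IH := IH (shift_seq f) (shift_seq sigma) (shift_seq d) (fun j => hf j.+1).
have dQ := @arc_cell_cover (shift_seq sigma) n (fun j => ms j.+1) (fun j => sI j.+1).
have ST := entropy_step (hf 0%N) dQ.
rewrite big_ord_recl mulrDr.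
have -> : arc_entropy sigma n.+1 = \sum_k \sum_(i < 8)
   entropy_term (arc_mass (pull (sigma 0%N) (@arc_cell (shift_seq sigma) n k)) i).
  rewrite /arc_entropy sum_ffun_cons; apply: eq_bigr => k _; apply: eq_bigr => i _.
  congr entropy_term; apply: RI_eq => t _; rewrite arc_cell_cons /pull !indicE in_setI.
  have -> : (t \in sigma 0%N @^-1` arc_cell (shift_seq sigma) k) = (sigma 0%N t \in arc_cell (shift_seq sigma) k).
    by apply/idP/idP => /set_mem h; exact/mem_set.
  by case: (t \in _); case: (_ \in _); rewrite ?mulr1 ?mulr0.
move: IH; rewrite {1}/arc_entropy => IH.
have -> : \sum_(i < n) (1 - N (d (lift ord0 i))) = \sum_(j < n) (1 - N (shift_seq d j)).
  by apply: eq_bigr => i _; rewrite lift0.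
lra.
Qed.
End InnerStep.

(** * Upper and lower limits of real sequences *)

Section UpperLowerLimits.
Context {R : realType}.
Implicit Types u v : nat -> R.

(** A strict inequality with a real bound amounts to a margin e for the terms of the sequence.
    Comparisons of limits below go through this and its three companions, without case analysis on
    infinite values. *)
Lemma limn_esup_ltP u (l : R) : (limn_esup (fun n => (u n)%:E) < l%:E)%E <->
  exists2 e : R, e < l & exists n0, forall n, (n0 <= n)%N -> u n <= e.
Proof.
rewrite /limn_esup limf_esupE; split.
  move=> /ereal_inf_lt[_ [V [n0 _ Vn] <-] sl].
  have [e el se] : exists2 e : R, e < l & (ereal_sup [set (u n)%:E | n in V] <= e%:E)%E.
    case: ereal_sup sl => [r rl|//|_]; first by exists r; rewrite // -lte_fin.
    by exists (l - 1); rewrite ?leNye//; lra.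
  exists e => //; exists n0 => n hn; rewrite -lee_fin; apply: le_trans se.
  by apply: ereal_sup_ubound; exists n => //; exact: Vn.
move=> [e el [n0 he]]; apply: (@le_lt_trans _ _ e%:E); last by rewrite lte_fin.
apply: (@le_trans _ _ (ereal_sup [set (u n)%:E | n in [set n | (n0 <= n)%N]])).
  apply: ereal_inf_lbound; exists [set n | (n0 <= n)%N] => //.
  by exists n0.
by apply: ge_ereal_sup => _ [n hn <-]; rewrite lee_fin; exact: he.
Qed.

Lemma limn_esup_gtP u (l : R) : (l%:E < limn_esup (fun n => (u n)%:E))%E <->
  exists2 e : R, l < e & forall n0, exists2 n, (n0 <= n)%N & e <= u n.
Proof.
rewrite /limn_esup limf_esupE; split.
  set L := ereal_inf _ => lL.
  have [e le eL] : exists2 e : R, l < e & (e%:E < L)%E.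
    case: L lL => [r|_|//]; last by exists (l + 1); [lra|rewrite ltry].
    by rewrite lte_fin => lr; exists ((l + r) / 2); rewrite ?lte_fin; lra.
  exists e => // n0.
  have : (e%:E < ereal_sup [set (u n)%:E | n in [set n | (n0 <= n)%N]])%E.
    apply: (lt_le_trans eL); apply: ereal_inf_lbound; exists [set n | (n0 <= n)%N] => //.
    by exists n0.
  by move=> /ereal_sup_gt[_ [n hn <-]]; rewrite lte_fin => /ltW; exists n.
move=> [e le he]; apply: (@lt_le_trans _ _ e%:E); first by rewrite lte_fin.
apply: le_ereal_inf_tmp => _ [V [n0 _ Vn] <-].
have [n hn en] := he n0; apply: (@le_trans _ _ (u n)%:E); first by rewrite lee_fin.
by apply: ereal_sup_ubound; exists n => //; exact: Vn.
Qed.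

Lemma limn_einfE u : limn_einf (fun n => (u n)%:E) = (- limn_esup (fun n => (- u n)%:E))%E.
Proof. by []. Qed.

Lemma limn_einf_gtP u (l : R) : (l%:E < limn_einf (fun n => (u n)%:E))%E <->
  exists2 e : R, l < e & exists n0, forall n, (n0 <= n)%N -> e <= u n.
Proof.
rewrite limn_einfE lteNr limn_esup_ltP; split=> [][e el [n0 he]];
  by exists (- e); [lra|exists n0 => n /he; lra].
Qed.

Lemma limn_einf_ltP u (l : R) : (limn_einf (fun n => (u n)%:E) < l%:E)%E <->
  exists2 e : R, e < l & forall n0, exists2 n, (n0 <= n)%N & u n <= e.
Proof.
rewrite limn_einfE lteNl limn_esup_gtP; split=> [][e el he];
  by exists (- e); [lra|move=> n0; have [n hn hu] := he n0; exists n => //; lra].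
Qed.

Lemma lte_between (x y : \bar R) : (x < y)%E -> exists r : R, (x < r%:E < y)%E.
Proof.
case: x y => [x||] [y||] //.
- by rewrite lte_fin => xy; exists ((x + y) / 2); rewrite !lte_fin; lra.
- by move=> _; exists (x + 1); rewrite ltry lte_fin; lra.
- by move=> _; exists (y - 1); rewrite ltNyr lte_fin; lra.
- by move=> _; exists 0; rewrite ltNyr ltry.
Qed.

(** [L] stands for the upper or the lower limit; a real number strictly between the two sides
    reduces the claim to real bounds. *)
Lemma limn_scale_le (L : (nat -> \bar R) -> \bar R) (c : R) u v : 0 < c ->
  (forall (e r : R), (r%:E < L (fun n => (u n)%:E))%E -> r = e / c -> (e%:E <= L (fun n => (v n)%:E))%E) ->
  (c%:E * L (fun n => (u n)%:E) <= L (fun n => (v n)%:E))%E.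
Proof.
move=> c0 H; rewrite leNgt; apply/negP => /lte_between[r /andP[rv ru]].
have : ((r / c)%:E < L (fun n => (u n)%:E))%E by rewrite EFinM lte_pdivrMr// muleC.
by move=> /H/(_ erefl); rewrite leNgt rv.
Qed.

Lemma limn_esup_scale_le (c : R) u v : 0 < c -> (forall n, (0 < n)%N -> c * u n <= v n) ->
  (c%:E * limn_esup (fun n => (u n)%:E) <= limn_esup (fun n => (v n)%:E))%E.
Proof.
move=> c0 H; apply: limn_scale_le => // e r ru re; apply: ltW; apply/limn_esup_gtP.
move: ru => /limn_esup_gtP[s rs hs]; exists (c * s); first by rewrite -ltr_pdivrMl// mulrC -re.
move=> n0; have [n hn su] := hs n0.+1; exists n; first exact: ltnW.
by apply: le_trans (H n _); [rewrite ler_pM2l|exact: leq_ltn_trans hn].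
Qed.

Lemma limn_einf_scale_le (c : R) u v : 0 < c -> (forall n, (0 < n)%N -> c * u n <= v n) ->
  (c%:E * limn_einf (fun n => (u n)%:E) <= limn_einf (fun n => (v n)%:E))%E.
Proof.
move=> c0 H; apply: limn_scale_le => // e r ru re; apply: ltW; apply/limn_einf_gtP.
move: ru => /limn_einf_gtP[s rs [n0 hs]]; exists (c * s); first by rewrite -ltr_pdivrMl// mulrC -re.
exists n0.+1 => n hn.
by apply: le_trans (H n _); [rewrite ler_pM2l// hs// ltnW|exact: leq_ltn_trans hn].
Qed.
End UpperLowerLimits.

(** * The two forms of the hypotheses *)

Section GeometricMean.
Context {R : realType}.
Variables (f : nat -> R[i] -> R[i]) (a : R).
Hypotheses (a0 : 0 < a) (la : forall n, (0 < n)%N -> a <= lambda f n)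
  (l1 : forall n, (0 < n)%N -> lambda f n <= 1).

Lemma geometric_meanE n : lambda_geometric_mean f n =
  expR (- (n%:R^-1 * \sum_(1 <= k < n.+1) - ln (lambda f k))).
Proof.
have la' := la; have a0' := a0.
have lp k : (0 < k)%N -> 0 < lambda f k by move=> /la'; exact: lt_le_trans.
rewrite /lambda_geometric_mean; have -> : lambda_prod f n = expR (\sum_(1 <= k < n.+1) ln (lambda f k)).
  rewrite expR_sum /lambda_prod; apply: eq_big_nat => k /andP[k0 _].
  by rewrite lnK// posrE lp.
by rewrite -expRM mulrC sumrN mulrN opprK.
Qed.

Lemma geometric_mean_bounds n : expR (- (mu_mean f n / a)) <= lambda_geometric_mean f n <= expR (- mu_mean f n).
Proof.
have la' := la; have a0' := a0; have l1' := l1.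
rewrite geometric_meanE !ler_expR !lerN2 /mu_mean -mulrA mulr_suml.
apply/andP; split; rewrite ler_wpM2l ?invr_ge0//; apply: ler_sum_nat => k /andP[k0 _]; rewrite /mu.
  have lk := la' _ k0; have lp : 0 < lambda f k by exact: lt_le_trans lk.
  rewrite -lnV ?posrE//; apply: (@le_trans _ _ ((lambda f k)^-1 - 1)).
    have ip : 0 < (lambda f k)^-1 by rewrite invr_gt0.
    by have := @le_ln1Dx R ((lambda f k)^-1 - 1) ltac:(lra); rewrite [1 + _]addrC subrK.
  have -> : (lambda f k)^-1 - 1 = (1 - lambda f k) / lambda f k by field; rewrite gt_eqF.
  by rewrite ler_wpM2l ?subr_ge0 ?l1'// lef_pV2 ?posrE.
have := @le_ln1Dx R (lambda f k - 1); rewrite [1 + _]addrC subrK => h.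
have lp : 0 < lambda f k by exact: lt_le_trans (la' _ k0).
have := h ltac:(lra); lra.
Qed.

Lemma geometric_mean_small e : e < 1 -> exists2 e', 0 < e' &
  forall n, lambda_geometric_mean f n <= e -> e' <= mu_mean f n.
Proof.
have a0' := a0.
move=> e1; case: (ltP 0 e) => e0; last first.
  (* Geometric means are positive, so a bound e <= 0 is never attained and any positive witness
     works. *)
  exists 1 => // n he; have /andP[h _] := geometric_mean_bounds n.
  by have := expR_gt0 (- (mu_mean f n / a)); lra.
exists (- (a * ln e)); first by have := @ln_lt0 R e ltac:(lra); nra.
move=> n he; have /andP[h _] := geometric_mean_bounds n.
have : expR (- (mu_mean f n / a)) <= expR (ln e) by rewrite lnK ?posrE//; lra.
by rewrite ler_expR lerNl ler_pdivlMr// mulNr mulrC.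
Qed.

Lemma mu_mean_large e : 0 < e -> expR (- e) < 1 /\
  forall n, e <= mu_mean f n -> lambda_geometric_mean f n <= expR (- e).
Proof.
move=> e0; split; first by rewrite expR_lt1; lra.
move=> n he; have /andP[_ h] := geometric_mean_bounds n; apply: (le_trans h).
by rewrite ler_expR lerN2.
Qed.

Lemma geometric_mean_esup_lt1 : (limn_esup (fun n => (lambda_geometric_mean f n)%:E) < 1%:E)%E <->
  (0%:E < lower_mu f)%E.
Proof.
split=> [/limn_esup_ltP[e e1 [n0 h]]|/limn_einf_gtP[e e0 [n0 h]]].
  have [e' e'0 he] := geometric_mean_small e1.
  by apply/limn_einf_gtP; exists e' => //; exists n0 => n /h/he.
have [e1 he] := mu_mean_large e0.
by apply/limn_esup_ltP; exists (expR (- e)) => //; exists n0 => n /h/he.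
Qed.

Lemma geometric_mean_einf_lt1 : (limn_einf (fun n => (lambda_geometric_mean f n)%:E) < 1%:E)%E <->
  (0%:E < upper_mu f)%E.
Proof.
split=> [/limn_einf_ltP[e e1 h]|/limn_esup_gtP[e e0 h]].
  have [e' e'0 he] := geometric_mean_small e1.
  by apply/limn_esup_gtP; exists e' => // n0; have [n hn /he] := h n0; exists n.
have [e1 he] := mu_mean_large e0.
by apply/limn_einf_ltP; exists (expR (- e)) => // n0; have [n hn /he] := h n0; exists n.
Qed.
End GeometricMean.

(** * From subsets of the circle to sets of angles *)

Section ArcPartition.
Context {R : realType}.
Local Notation C := R[i].
Local Notation mu := (@lebesgue_measure R).
Local Notation I := (seg 0 (2 * pi) : set R).

Lemma ntlim_unique (f : C -> C) (t : R) w w' : ntlim f t w -> ntlim f t w' -> w = w'.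
Proof.
move=> h h'.
have /cvg_ReIm[a b] := ntlim_radial h (@radius_ge0 R) (@radius_cvg R).
have /cvg_ReIm[a' b'] := ntlim_radial h' (@radius_ge0 R) (@radius_cvg R).
apply: complex_ext; [exact: (cvg_unique _ a a')|exact: (cvg_unique _ b b')].
Qed.

Lemma expi_inj (s t : R) : I s -> I t -> expi s = expi t :> C -> s = t.
Proof.
wlog st : s t / t <= s => [H Is It E|].
  by case: (leP t s) => [|/ltW] h; [exact: H|apply/esym/H].
move=> /segE /andP[s0 s1] /segE /andP[t0 t1] E; apply/eqP; case: eqVneq => // ne.
have h : 0 < sin ((s - t) / 2).
  have lts : t < s by rewrite lt_neqAle eq_sym ne.
  by apply: sin_gt0_pi; apply/andP; split; lra.
have : expi (s - t) = 1 :> C by rewrite expiD E -expiD subrr expi0.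
move=> /(congr1 (@complex.Re R)) /=.
have -> : s - t = (s - t) / 2 + (s - t) / 2 by lra.
rewrite cosD; have := cos2Dsin2 ((s - t) / 2); nra.
Qed.

Lemma unit_circleE (z : C) : unit_circle z <-> exists2 t, I t & z = expi t.
Proof.
rewrite /unit_circle /= normE; split=> [z1|[t _ ->]]; last by rewrite N_expi.
have Nz : N z = 1 by move: z1 => /(congr1 (@complex.Re R)).
exists (angle (Re z) (Im z)); first by apply/segE; exact: angle_in.
by rewrite expi_angle; [case: (z)|rewrite -N_sqr Nz expr1n].
Qed.

Lemma arc_sub n (i : 'I_n) : arc i `<=` I.
Proof.
move=> t /segE/andP[h1 h2]; apply/segE.
have n0 : 0 < n%:R :> R by rewrite ltr0n; case: n i {h1 h2} => [[]|].
have p0 := @twopi_gt0 R.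
rewrite (le_trans _ h1) ?divr_ge0 ?mulr_ge0 ?ler0n ?pi_ge0//=; apply: (lt_le_trans h2).
by rewrite ler_pdivrMr// ler_pM2l// ler_nat.
Qed.

Definition circle_arc n (i : 'I_n) : set C := [set expi t | t in arc i].

Lemma circle_arcE n (i : 'I_n) t : I t -> circle_arc i (expi t) <-> arc i t.
Proof.
move=> It; split=> [[s si E]|]; last by exists t.
by rewrite -(expi_inj (arc_sub si) It E).
Qed.

Lemma circle_arc_partition n : (0 < n)%N -> circle_partition (@circle_arc n).
Proof.
move=> n0; split.
- move=> i; split=> [_ [t ti <-]|]; first by apply/unit_circleE; exists t => //; exact: arc_sub ti.
  have -> : angles (circle_arc i) = arc i.
    rewrite predeqE => t; split=> [[t2 h]|h]; first by apply/circle_arcE => //; apply/segE.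
    by split; [apply/segE; exact: arc_sub h|exists t].
  by apply: sub_caratheodory; exact: (measurable_arc i).
- move=> i j _ _ [_ [[t ti <-] [s sj E]]].
  have It := arc_sub ti; have Es := expi_inj (arc_sub sj) It E; subst s.
  (* Disjointness is read off the sum of the indicators, which would be at least 2 if t lay in two
     arcs. *)
  have := @sum_arc R n t n0 It; rewrite (bigD1 i)//= indicE mem_set// => S.
  apply/eqP; apply/negPn/negP => ij.
  have : \sum_(k < n | k != i) \1_(arc k) t = 0 :> R by apply: (addrI 1); rewrite S addr0.
  rewrite (bigD1 j) ?(eq_sym j)//= indicE mem_set//= => /eqP.
  by rewrite gt_eqF// ltr_pwDl// sumr_ge0.
- rewrite predeqE => z; split=> [[i _ [t ti <-]]|/unit_circleE[t It ->]].
    by apply/unit_circleE; exists t => //; exact: arc_sub ti.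
  have [i ti] : exists i : 'I_n, arc i t.
    apply: contrapT => h; have := @sum_arc R n t n0 It; rewrite big1 => [/eqP|i _].
      by rewrite eq_sym oner_eq0.
    by rewrite indicE memNset// => ti; apply: h; exists i.
  by exists i => //; exists t.
Qed.

(* The completed Lebesgue measure is the outer measure, so neither Borel measurability of
   angles E nor completeness has to be discussed. *)
Lemma arclengthE (E : set C) (S : set R) : measurable S ->
  {ae mu, forall t, I t -> E (expi t) <-> S t} -> fine (arclength E) = RI I (\1_S : R -> R).
Proof.
move=> mS [Z [mZ Z0 hZ]].
have mSI : measurable (S `&` I) by apply: measurableI => //; exact: measurable_itv.
pose om := (@wlength R idfun)^*%mu.
have omU A B : (om (A `|` B) <= om A + om B)%E by exact: outer_measureU2.
have omZ : om Z = 0 by [].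
suff -> : arclength E = mu (S `&` I).
  have fSI : fmeas (I `&` S).
    split; first by rewrite setIC.
    apply: (le_lt_trans _ (@fmeas_I R).2); apply: le_measure; rewrite ?inE//; first by rewrite setIC.
    exact: measurable_itv.
  rewrite setIC -/(meas _) (meas_RI fSI) RI_indic; apply: RI_eq => t _; exact: mul1r.
have h t : I t -> ~ Z t -> E (expi t) <-> S t.
  by move=> It nZ; apply: contrapT => h; apply: nZ; apply: hZ => /= /(_ It).
apply/eqP; rewrite eq_le; apply/andP; split.
  apply: (@le_trans _ _ (om ((S `&` I) `|` Z))).
    apply: le_outer_measure => t [t2 Et]; have It : I t by apply/segE.
    by case: (pselect (Z t)) => hz; [right|left; split=> //; apply/h].
  by apply: (le_trans (omU _ _)); rewrite omZ adde0.
apply: (@le_trans _ _ (om (angles E `|` Z))).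
  apply: le_outer_measure => t [St It].
  by case: (pselect (Z t)) => hz; [right|left; split; [apply/segE|apply/h]].
by apply: (le_trans (omU _ _)); rewrite omZ adde0.
Qed.
End ArcPartition.

(** * The entropy of the partition into eight arcs *)

Section EntropyBound.
Context {R : realType}.
Local Notation C := R[i].
Local Notation mu := (@lebesgue_measure R).
Local Notation I := (seg 0 (2 * pi) : set R).

Lemma boundary_preimageE (f : C -> C) tau n (i : 'I_n) : boundary_angle f tau ->
  {ae mu, forall t, I t -> boundary_preimage f (circle_arc i) (expi t) <-> arc i (tau t)}.
Proof.
move=> [_ ti]; apply: aeS => t H It.
have It' : I (tau t) by apply/segE; exact: ti.
rewrite -circle_arcE//; split=> [[_ [w [hw Aw]]]|At].
  by rewrite (ntlim_unique (H It) hw).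
split; first by apply/unit_circleE; exists t.
by exists (expi (tau t)); split=> //; exact: H.
Qed.

Variables (f : nat -> C -> C) (sigma : nat -> R -> R).
Hypothesis hf : forall n, cinner (f n.+1) (sigma n) ((f n.+1)^`()%classic 0).

Lemma cinner_iterate n : exists d, cinner (forward_iterate f n.+1) (orbit_map sigma n.+1) d.
Proof.
elim: n => [|n [e IH]]; first by exists ((f 1%N)^`()%classic 0); exact: (hf 0).
by exists ((f n.+2)^`()%classic 0 * e); exact: (cinner_comp IH (hf n.+1)).
Qed.

Lemma cellE n (k : {ffun 'I_n.+1 -> 'I_8}) :
  {ae mu, forall t, I t -> cell f (@circle_arc R 8) k (expi t) <-> arc_cell sigma k t}.
Proof.
(* [inord] makes the condition meaningful for every natural j, so that the exceptional sets are a
   countable family with null union; only j < n is used afterwards. *)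
pose P j t := I t -> boundary_preimage (forward_iterate f j.+1) (circle_arc (k (inord j.+1))) (expi t) <->
  arc (k (inord j.+1)) (orbit_map sigma j.+1 t).
have : {ae mu, forall t, forall j, P j t}.
  apply: ae_foralln => j; have [d [_ _ _ _ hb]] := cinner_iterate j.
  exact: boundary_preimageE hb.
apply: aeS => t H It; split=> [[k0 hk] j|hk].
  case: (unliftP ord0 j) => [j' ->|->]; last by apply/circle_arcE.
  have := H j' It; rewrite (_ : inord j'.+1 = lift ord0 j'); last first.
    by apply: ord_inj; rewrite lift0 inordK ?ltnS.
  by rewrite lift0 => <-; exact: hk.
split; first by apply/circle_arcE => //; exact: (hk ord0).
move=> j _; have := H j It; rewrite (_ : inord j.+1 = lift ord0 j); last first.
  by apply: ord_inj; rewrite lift0 inordK ?ltnS.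
by move=> ->; have := hk (lift ord0 j); rewrite lift0.
Qed.

Lemma mean_partition_entropyE n :
  mean_partition_entropy f (@circle_arc R 8) n = n.+1%:R^-1 * arc_entropy sigma n.
Proof.
have ms j : measurable_fun [set: R] (sigma j) by have [_ _ _ _ []] := hf j.
congr (_ * _); apply: eq_bigr => k _; congr entropy_term.
apply: arclengthE; last exact: cellE.
exact: measurable_arc_cell.
Qed.

(** The entropy at time n contains n gains but is divided by n + 1; the constant drops from pi / 3
    to pi / 6 because n / (n + 1) >= 1 / 2 for n >= 1. *)
Lemma mean_partition_entropy_ge n : (0 < n)%N ->
  pi / 6 * mu_mean f n <= mean_partition_entropy f (@circle_arc R 8) n.
Proof.
move=> n0; have fh := hf; have p0 := pi_gt0 R.
rewrite mean_partition_entropyE ler_pdivlMl ?ltr0n//.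
apply: le_trans (arc_entropy_ge n (fun j => hf j)).
set S := \sum_(j < n) _.
have S0 : 0 <= S.
  by apply: sumr_ge0 => j _; rewrite subr_ge0; exact: (N_deriv0 (fh j)).
have -> : mu_mean f n = n%:R^-1 * S by rewrite /mu_mean big_add1 big_mkord.
have nn : 1 <= n%:R :> R by rewrite ler1n.
have -> : n.+1%:R * (pi / 6 * (n%:R^-1 * S)) = (n.+1%:R / n%:R / 2) * (pi / 3 * S).
  by field; rewrite gt_eqF//; lra.
apply: ler_piMl; first by rewrite mulr_ge0// divr_ge0// ltW.
by rewrite -natr1 !ler_pdivrMr//; lra.
Qed.
End EntropyBound.

Lemma cinner_deriv (R : realType) (f : R[i] -> R[i]) : centred_inner_function f ->
  exists tau, cinner f tau (f^`()%classic 0).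
Proof.
move=> [hf f0]; have [tau hb] := inner_boundary_angle hf; exists tau; split=> //.
- exact: inner_holo.
- exact: inner_le1.
- have [h _ _] := hf; apply: derivable_cdiff; apply: h.
  by rewrite /unit_disc /= normr0 ltr01.
Qed.

Theorem theoremC (R : realType) (a : R) (a_gt0 : 0 < a) :
  exists c : R, 0 < c /\
  forall f : nat -> R[i] -> R[i],
    (forall n, (0 < n)%N -> centred_inner_function (f n)) ->
    (forall n, (0 < n)%N -> a <= lambda f n) ->
    lambda_prod f n @[n --> \oo] --> (0 : R) ->
    [/\ ((limn_esup (fun n => (lambda_geometric_mean f n)%:E) < 1%:E)%E <->
          (0%:E < lower_mu f)%E),
        ((limn_esup (fun n => (lambda_geometric_mean f n)%:E) < 1%:E)%E ->
          (c%:E * lower_mu f <= lower_entropy f)%E),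
        ((limn_einf (fun n => (lambda_geometric_mean f n)%:E) < 1%:E)%E <->
          (0%:E < upper_mu f)%E) &
        ((limn_einf (fun n => (lambda_geometric_mean f n)%:E) < 1%:E)%E ->
          (c%:E * upper_mu f <= metric_entropy f)%E)].
Proof.
have c0 : 0 < pi / 6 :> R by rewrite divr_gt0// pi_gt0.
exists (pi / 6); split=> // f hf la _.
have [sigma hs] := choice (fun n => cinner_deriv (hf n.+1 isT)).
have l1 n : (0 < n)%N -> lambda f n <= 1 by case: n => // n _; exact: (N_deriv0 (hs n)).
have part := @circle_arc_partition R 8 isT.
split.
- exact: geometric_mean_esup_lt1 a_gt0 la l1.
- move=> _; apply: le_trans (limn_einf_scale_le c0 (mean_partition_entropy_ge hs)) _.
  by apply: ereal_sup_ubound; exists 8%N, (@circle_arc R 8).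
- exact: geometric_mean_einf_lt1 a_gt0 la l1.
- move=> _; apply: le_trans (limn_esup_scale_le c0 (mean_partition_entropy_ge hs)) _.
  by apply: ereal_sup_ubound; exists 8%N, (@circle_arc R 8).
Qed.
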